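(* Let $I\subseteq S=\Bbbk[x_1,\ldots,x_n]$ be a monomial ideal over a field $\Bbbk$. If $\dim(S/I)=d$, then the real distracting arrangement $V_I(\mathbb R)=V_I\cap\mathbb R^n$ is not Cohen--Macaulay over $\Bbbk$ near $\alpha\in\mathbb R^n$ if and only if $\alpha\in\mathrm{qdeg}_{\mathbb R}\big(H^i_{\mathfrak m}(S/I)\big)$ for some $i<d$.
   Context: $\mathfrak m=\langle x_1,\ldots,x_n\rangle$, and $H^i_{\mathfrak m}$ denotes local cohomology with support $\mathfrak m$, which is $\mathbb Z^n$-graded for $\mathbb Z^n$-graded modules. $\Lambda_I\subseteq\mathbb N^n$ is the set of exponent vectors of monomials not in $I$. The distracting arrangement $V_I\subseteq\mathbb C^n$ is the Zariski closure of $\Lambda_I$ in $\mathbb C^n$; it is a finite union of translates of coordinate subspaces $\mathbb C^F$ (vectors supported in $F\subseteq\{1,\ldots,n\}$). For a $\mathbb Z^n$-graded module $N$, the true degree set is $\mathrm{tdeg}(N)=\{\mathbf a\in\mathbb Z^n\mid N_{\mathbf a}\ne0\}$, the quasidegree set $\mathrm{qdeg}(N)$ is the Zariski closure of $\mathrm{tdeg}(N)$ in $\mathbb C^n$, and $\mathrm{qdeg}_{\mathbb R}(N)=\mathrm{qdeg}(N)\cap\mathbb R^n$ is the real quasidegree set. For $\alpha\in\mathbb C^n$, let $Z_\alpha$ be the union of the irreducible components of $V_I$ passing through $\alpha$. Then $-\alpha+Z_\alpha$ is a coordinate subspace arrangement, and the exponent simplicial complex is $\mathrm{E}\Delta_\alpha=\{F\subseteq\{1,\ldots,n\}\mid\mathbb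 C^F\subseteq-\alpha+Z_\alpha\}$. For $\alpha\in\mathbb R^n$, the arrangement $V_I(\mathbb R)$ near $\alpha$ is a translate of the real coordinate subspace arrangement given by $\mathrm{E}\Delta_\alpha$, and $V_I(\mathbb R)$ is Cohen--Macaulay over $\Bbbk$ near $\alpha$ when $\mathrm{E}\Delta_\alpha$ is Cohen--Macaulay over $\Bbbk$. A simplicial complex is Cohen--Macaulay over $\Bbbk$ if its Stanley--Reisner ring over $\Bbbk$ is Cohen--Macaulay.
   Formalization: ''Cohen–Macaulay near α'' is read as Cohen–Macaulay of dimension d: for α on V_I the Stanley–Reisner ring of EΔ_α must also have dimension d; without this the claim fails for I=⟨x²,xy⟩ at α=(1,0). *)

(* Defs.v *)
From HB Require Import structures.
From mathcomp Require Import all_boot all_order all_algebra.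
From mathcomp Require Import boolp classical_sets reals.
From mathcomp Require Import complex mpoly zify.

Set Implicit Arguments.
Unset Strict Implicit.
Unset Printing Implicit Defensive.

Import GRing.Theory.
Local Open Scope ring_scope.
Local Open Scope quotient_scope.
Local Open Scope classical_set_scope.

(* Unlike [idealr] of ring_quotient.v, the unit ideal is an ideal here; hence
   quotients are only [comPzRingType]s. *)
HB.mixin Record isAbsorbing (R : comPzRingType) (I : R -> bool) := {
  idealMl : forall a, {in I, forall u, a * u \in I}
}.

#[short(type="ideal")]
HB.structure Definition Ideal (R : comPzRingType) :=
  {I of GRing.ZmodClosed R I & isAbsorbing R I}.

Section GeneratedIdeal.
Variables (R : comPzRingType) (A : set R).

Definition ideal_gen : R -> bool :=
  fun y => `[< forall J : ideal R, (forall x, A x -> x \in J) -> y \in J >].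

Lemma ideal_gen_zmod : zmod_closed ideal_gen.
Proof.
split=> [|x y /asboolP hx /asboolP hy]; apply/asboolP => J AJ.
  exact: rpred0.
by rewrite rpredB ?hx ?hy.
Qed.

Lemma ideal_gen_absorb a : {in ideal_gen, forall u, a * u \in ideal_gen}.
Proof. by move=> u /asboolP hu; apply/asboolP => J AJ; rewrite idealMl ?hu. Qed.

HB.instance Definition _ := GRing.isZmodClosed.Build R ideal_gen ideal_gen_zmod.
HB.instance Definition _ := isAbsorbing.Build R ideal_gen ideal_gen_absorb.

Definition generated_ideal : ideal R := Ideal.clone R ideal_gen _.

End GeneratedIdeal.

Section RingQuotient.
Variables (R : comPzRingType) (I : ideal R).

Definition ring_quot : Type := Quotient.quot I.
HB.instance Definition _ := GRing.Zmodule.on ring_quot.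

Definition qproj (x : R) : ring_quot := \pi_(Quotient.quot I) x.

Lemma qproj_eq x y : (qproj x = qproj y) <-> (x - y \in I).
Proof. by rewrite Quotient.idealrBE; split => [h|/eqP]//; apply/eqP. Qed.

Lemma qprojD : {morph qproj : x y / x + y}.
Proof. by move=> x y; rewrite /qproj /= !piE. Qed.

Lemma qproj_repr (u : ring_quot) :
  qproj (repr (u : Quotient.quot I)) = u.
Proof. exact: reprK. Qed.

Definition qone : ring_quot := qproj 1.
Definition qmul (u v : ring_quot) : ring_quot :=
  qproj (repr (u : Quotient.quot I) * repr (v : Quotient.quot I)).
Definition qscale (a : R) (u : ring_quot) : ring_quot :=
  qproj (a * repr (u : Quotient.quot I)).

Lemma repr_qproj x : repr (qproj x : Quotient.quot I) - x \in I.
Proof. by apply/qproj_eq; rewrite qproj_repr. Qed.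

Lemma qmulE x y : qmul (qproj x) (qproj y) = qproj (x * y).
Proof.
apply/qproj_eq; set a := repr _; set b := repr _.
have -> : a * b - x * y = b * (a - x) + x * (b - y).
  by rewrite !mulrBr [b * a]mulrC [b * x]mulrC addrA subrK.
by rewrite rpredD ?idealMl ?repr_qproj.
Qed.

Lemma qscaleE a x : qscale a (qproj x) = qproj (a * x).
Proof. by apply/qproj_eq; rewrite -mulrBr idealMl ?repr_qproj. Qed.

Lemma qmulA : associative qmul.
Proof.
move=> u v w; rewrite -[u]qproj_repr -[v]qproj_repr -[w]qproj_repr.
by rewrite !qmulE mulrA.
Qed.
Lemma qmulC : commutative qmul.
Proof. by move=> u v; rewrite /qmul mulrC. Qed.
Lemma qmul1 : left_id qone qmul.
Proof. by move=> u; rewrite -[u]qproj_repr qmulE mul1r. Qed.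
Lemma qmulDl : left_distributive qmul +%R.
Proof.
move=> u v w; rewrite -[u]qproj_repr -[v]qproj_repr -[w]qproj_repr.
by rewrite -qprojD !qmulE mulrDl qprojD.
Qed.

HB.instance Definition _ :=
  GRing.Zmodule_isComPzRing.Build ring_quot qmulA qmulC qmul1 qmulDl.

Lemma qscaleA a b u : qscale a (qscale b u) = qscale (a * b) u.
Proof. by rewrite -[u]qproj_repr !qscaleE mulrA. Qed.
Lemma qscale1 : left_id 1 qscale.
Proof. by move=> u; rewrite -[u]qproj_repr !qscaleE mul1r. Qed.
Lemma qscaleDr : right_distributive qscale +%R.
Proof.
move=> a u v; rewrite -[u]qproj_repr -[v]qproj_repr.
by rewrite -qprojD !qscaleE mulrDr qprojD.
Qed.
Lemma qscaleDl u : {morph qscale^~ u : a b / a + b}.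
Proof. by move=> a b /=; rewrite -[u]qproj_repr !qscaleE mulrDl qprojD. Qed.

HB.instance Definition _ :=
  GRing.Zmodule_isLmodule.Build R ring_quot qscaleA qscale1 qscaleDr qscaleDl.

End RingQuotient.

Section CohenMacaulayRing.
Variable R : comPzRingType.
Implicit Types (P J : ideal R) (s : seq R).

Definition prime_ideal P : Prop :=
  1 \notin P /\ forall x y, x * y \in P -> x \in P \/ y \in P.

Definition maximal_ideal P : Prop :=
  1 \notin P /\
  forall J, {subset P <= J} -> 1 \notin J -> {subset J <= P}.

Definition prime_chain (C : nat -> ideal R) (l : nat) : Prop :=
  (forall i, (i <= l)%N -> prime_ideal (C i)) /\
  (forall i, (i < l)%N ->
     {subset C i <= C i.+1} /\ exists2 x, x \in C i.+1 & x \notin C i).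

(* The zero ring has no prime ideal, hence no Krull dimension in [nat]. *)
Definition krull_dim (d : nat) : Prop :=
  (exists C, prime_chain C d) /\
  (forall C l, prime_chain C l -> (l <= d)%N).

Definition height P (h : nat) : Prop :=
  (exists C, prime_chain C h /\ C h =i P) /\
  (forall C l, prime_chain C l -> C l =i P -> (l <= h)%N).

Definition regular_sequence s : Prop :=
  1 \notin generated_ideal [set` s] /\
  forall i, (i < size s)%N -> forall y,
    s`_i * y \in generated_ideal [set` take i s] ->
    y \in generated_ideal [set` take i s].

Definition depth P (r : nat) : Prop :=
  (exists s, [/\ regular_sequence s, {subset s <= P} & size s = r]) /\
  (forall s, regular_sequence s -> {subset s <= P} -> (size s <= r)%N).

(* For a Noetherian ring R.  As depth (P R_P) = depth (P, R) for P maximal, this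
   says that every localization of R at a maximal ideal is Cohen-Macaulay.  The
   zero ring is Cohen-Macaulay. *)
Definition cohen_macaulay_ring : Prop :=
  forall P, maximal_ideal P -> exists h, height P h /\ depth P h.

End CohenMacaulayRing.

Section Localization.
Variables (R : comPzRingType) (M : lmodType R) (s : R).
Implicit Types p q : M * nat.

(* The pair (m, k) stands for the fraction m / s^k. *)
Definition loc_equiv p q : bool :=
  `[< exists N, s ^+ (N + q.2) *: p.1 = s ^+ (N + p.2) *: q.1 >].

Lemma loc_equivP : equiv_class_of loc_equiv.
Proof.
split=> [p|p q|q p r].
- by apply/asboolP; exists 0%N.
- by apply/asboolP/asboolP => -[N e]; exists N; rewrite e.
move=> /asboolP[N1 e1] /asboolP[N2 e2]; apply/asboolP.
exists (N1 + N2 + q.2)%N.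
have -> : (N1 + N2 + q.2 + r.2 = (N2 + r.2) + (N1 + q.2))%N by lia.
rewrite exprD -scalerA e1 scalerA -exprD.
have -> : (N2 + r.2 + (N1 + p.2) = (N1 + p.2) + (N2 + r.2))%N by lia.
by rewrite exprD -scalerA e2 scalerA -exprD; congr (_ ^+ _ *: _); lia.
Qed.

Canonical loc_equiv_equiv := EquivRelPack loc_equivP.
Canonical loc_equiv_encModRel := defaultEncModRel loc_equiv.

Definition localization : Type := {eq_quot loc_equiv}.
HB.instance Definition _ := EqQuotient.on localization.
HB.instance Definition _ := Choice.on localization.

Definition frac (m : M) (k : nat) : localization := \pi_localization (m, k).

Lemma frac_eq m k m' k' : frac m k = frac m' k' <->
  exists N, s ^+ (N + k') *: m = s ^+ (N + k) *: m'.
Proof.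
split=> [/eqP|h]; first by rewrite /frac piE => /asboolP.
by apply/eqP; rewrite /frac piE; apply/asboolP.
Qed.

Lemma frac_repr (u : localization) : frac (repr u).1 (repr u).2 = u.
Proof. by rewrite /frac -surjective_pairing reprK. Qed.

Lemma fracP (u : localization) : exists m k, u = frac m k.
Proof. by exists (repr u).1, (repr u).2; rewrite frac_repr. Qed.

Definition loc_zero : localization := frac 0 0.
Definition loc_opp (u : localization) : localization :=
  frac (- (repr u).1) (repr u).2.
Definition loc_add (u v : localization) : localization :=
  frac (s ^+ (repr v).2 *: (repr u).1 + s ^+ (repr u).2 *: (repr v).1)
       ((repr u).2 + (repr v).2).

Lemma loc_oppE m k : loc_opp (frac m k) = frac (- m) k.
Proof.
have [N e] := (frac_eq _ _ _ _).1 (frac_repr (frac m k)).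
by apply/frac_eq; exists N; rewrite !scalerN e.
Qed.

Lemma loc_addE m k m' k' : loc_add (frac m k) (frac m' k') =
  frac (s ^+ k' *: m + s ^+ k *: m') (k + k').
Proof.
have [N e] := (frac_eq _ _ _ _).1 (frac_repr (frac m k)).
have [N' e'] := (frac_eq _ _ _ _).1 (frac_repr (frac m' k')).
rewrite /loc_add.
move: (repr (frac m k)) (repr (frac m' k')) e e' => [a i] [b j] /= e e'.
apply/frac_eq; exists (N + N')%N; rewrite !scalerDr !scalerA -!exprD.
congr (_ + _).
  have -> : (N + N' + (k + k') + j = (N' + k' + j) + (N + k))%N by lia.
  by rewrite exprD -scalerA e scalerA -exprD; congr (_ ^+ _ *: _); lia.
have -> : (N + N' + (k + k') + i = (N + k + i) + (N' + k'))%N by lia.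
by rewrite exprD -scalerA e' scalerA -exprD; congr (_ ^+ _ *: _); lia.
Qed.

Lemma loc_addA : associative loc_add.
Proof.
move=> u v w; have [m [i ->]] := fracP u; have [m' [j ->]] := fracP v.
have [m'' [k ->]] := fracP w; rewrite !loc_addE addnA !scalerDr !scalerA -!exprD.
by rewrite addrA [(k + j)%N]addnC [(k + i)%N]addnC.
Qed.
Lemma loc_addC : commutative loc_add.
Proof.
move=> u v; have [m [i ->]] := fracP u; have [m' [j ->]] := fracP v.
by rewrite !loc_addE addrC addnC.
Qed.
Lemma loc_add0 : left_id loc_zero loc_add.
Proof.
move=> u; have [m [i ->]] := fracP u.
by rewrite loc_addE scaler0 add0r scale1r add0n.
Qed.
Lemma loc_addN : left_inverse loc_zero loc_opp loc_add.
Proof.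
move=> u; have [m [i ->]] := fracP u; rewrite loc_oppE loc_addE.
by apply/frac_eq; exists 0%N; rewrite scalerN addNr !scaler0.
Qed.

HB.instance Definition _ :=
  GRing.isZmodule.Build localization loc_addA loc_addC loc_add0 loc_addN.

End Localization.

Section CechComplex.
Variables (R : comPzRingType) (M : lmodType R) (n : nat) (x : 'I_n -> R).
Implicit Types F G : {set 'I_n}.

Definition xprod F : R := \prod_(i in F) x i.

Definition cech_cochain : Type := forall F, localization M (xprod F).

(* For F contained in G, the canonical map from M[1/x^F] to M[1/x^G]; see
   [cech_resE] for its independence of the chosen representative. *)
Definition cech_res F G (u : localization M (xprod F)) :
    localization M (xprod G) :=
  frac (xprod G) (xprod (G :\: F) ^+ (repr u).2 *: (repr u).1) (repr u).2.

Lemma cech_resE F G m k : F \subset G ->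
  cech_res G (frac (xprod F) m k) = frac (xprod G) (xprod (G :\: F) ^+ k *: m) k.
Proof.
move=> sFG; have /frac_eq[N] := frac_repr (frac (xprod F) m k).
rewrite /cech_res; move: (repr _) => [a i] /= e; apply/frac_eq; exists N.
have -> : xprod G = xprod (G :\: F) * xprod F.
  by rewrite /xprod [LHS](big_setID F) /= (finset.setIidPr sFG) mulrC.
rewrite !exprMn !scalerA mulrAC -exprD -[LHS]scalerA e !scalerA.
by rewrite [in RHS]mulrAC -exprD; congr (_ ^+ _ * _ *: _); lia.
Qed.

Definition cech_d (c : cech_cochain) : cech_cochain := fun G =>
  \sum_(j in G) cech_res G (c (G :\ j)) *~ (-1) ^+ #|[set i in G | (i < j)%N]|.

Definition cech_concentrated (i : nat) (c : cech_cochain) : Prop :=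
  forall F, #|F| != i -> c F = 0.

Definition cech_cocycle (i : nat) (c : cech_cochain) : Prop :=
  cech_concentrated i c /\ forall G, cech_d c G = 0.

Definition cech_coboundary (i : nat) (c : cech_cochain) : Prop :=
  exists b, (forall F, #|F|.+1 != i -> b F = 0) /\ forall G, c G = cech_d b G.

(* Z^n-graded M ([gr a] is the component of degree a) and x_j of degree e_j. *)
Variable gr : ('I_n -> int) -> set M.

Definition cech_homogeneous (a : 'I_n -> int) (c : cech_cochain) : Prop :=
  forall F, exists m k,
    gr (fun j => a j + (if j \in F then k%:Z else 0)) m /\
    c F = frac (xprod F) m k.

(* True degree set of the i-th local cohomology of M with support in the ideal
   generated by the x_j: the degrees a such that some homogeneous i-cocycle of
   degree a has a nonzero class. *)
Definition tdeg_local_cohomology (i : nat) : set ('I_n -> int) :=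
  [set a | exists c, [/\ cech_cocycle i c, cech_homogeneous a c &
                        ~ cech_coboundary i c]].

End CechComplex.

Section Zariski.
Variables (K : fieldType) (n : nat).
Implicit Types A V X : set ('I_n -> K).

Definition zariski_closure A : set ('I_n -> K) :=
  [set v | forall p : {mpoly K[n]}, (forall a, A a -> p.@[a] = 0) -> p.@[v] = 0].

Definition zariski_closed A : Prop := zariski_closure A `<=` A.

Definition zariski_irreducible X : Prop :=
  X !=set0 /\
  forall A B, zariski_closed A -> zariski_closed B ->
    X `<=` A `|` B -> X `<=` A \/ X `<=` B.

Definition irreducible_component V X : Prop :=
  [/\ X `<=` V, zariski_irreducible X &
     forall Y, zariski_irreducible Y -> X `<=` Y -> Y `<=` V -> Y `<=` X].

Definition components_through V (alpha : 'I_n -> K) : set ('I_n -> K) :=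
  [set v | exists X, [/\ irreducible_component V X, X alpha & X v]].

Definition coord_subspace (F : {set 'I_n}) : set ('I_n -> K) :=
  [set v | forall j, j \notin F -> v j = 0].

Definition exponent_complex V (alpha : 'I_n -> K) : set {set 'I_n} :=
  [set F | forall v, coord_subspace F v ->
                     components_through V alpha (fun j => alpha j + v j)].

End Zariski.

Section MonomialIdeals.
Variables (k : fieldType) (n : nat).
Local Notation S := {mpoly k[n]}.

Definition monomial_ideal (I : ideal S) : Prop :=
  exists A : set 'X_{1..n}, I =i generated_ideal [set 'X_[u] | u in A].

Definition stanley_reisner_ideal (D : set {set 'I_n}) : ideal S :=
  generated_ideal [set xprod (fun j => 'X_j : S) F | F in ~` D].

Definition stanley_reisner_ring (D : set {set 'I_n}) : comPzRingType :=
  ring_quot (stanley_reisner_ideal D).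

Definition CM_complex (D : set {set 'I_n}) : Prop :=
  cohen_macaulay_ring (stanley_reisner_ring D).

Definition quot_grading (I : ideal S) (a : 'I_n -> int) : set (ring_quot I) :=
  [set y | exists p : S, y = qproj I p /\
     forall u, u \in msupp p -> forall j, (u j)%:Z = a j].

Definition tdeg_lc (I : ideal S) (i : nat) : set ('I_n -> int) :=
  tdeg_local_cohomology (fun j => 'X_j : S) (quot_grading (I := I)) i.

Variable R : realType.

Definition complex_point (alpha : 'I_n -> R) : 'I_n -> R[i] :=
  fun j => (alpha j)%:C%C.

Definition qdeg (T : set ('I_n -> int)) : set ('I_n -> R[i]) :=
  zariski_closure [set fun j => (a j)%:~R | a in T].

Definition qdegR (T : set ('I_n -> int)) : set ('I_n -> R) :=
  [set alpha | qdeg T (complex_point alpha)].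

Definition distracting_arrangement (I : ideal S) : set ('I_n -> R[i]) :=
  zariski_closure [set (fun j => (u j)%:R)
                   | u in [set u : 'X_{1..n} | 'X_[u] \notin I]].

Definition CM_near (V : set ('I_n -> R[i])) (alpha : 'I_n -> R) : Prop :=
  CM_complex (exponent_complex V (complex_point alpha)).

(* Cohen-Macaulayness near alpha as an arrangement of dimension d: the complex
   at a point of V is moreover required to have a ring of dimension d.  At an
   isolated point of the arrangement of <x^2, xy>, the point (1, 0), the complex
   is the Cohen-Macaulay complex {set0}, but d = 1 and H^0 of k[x,y]/<x^2, xy> is
   nonzero in degree (1, 0).  Off V the complex is void and its ring is zero. *)
Definition CM_near_of_dim (V : set ('I_n -> R[i])) (d : nat)
    (alpha : 'I_n -> R) : Prop :=
  CM_near V alpha /\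
  (V (complex_point alpha) ->
   krull_dim
     (stanley_reisner_ring (exponent_complex V (complex_point alpha))) d).

End MonomialIdeals.

(* Main.v *)
(* For a degree a in Z^n, the degree-a strand of the Cech complex of S/I is the
   cochain complex of the faces, containing G = {j | a_j < 0}, of the simplicial
   complex D_a of those F for which x^a times all monomials in the variables of F
   stays outside I; hence H^i in degree a is reduced cohomology of the link of G
   in D_a.  Dickson's lemma describes V_I and the quasidegree sets as finite
   unions of translated coordinate subspaces, and the exponent complex Delta at
   alpha has the same faces above G as D_a whenever alpha_j = a_j for j outside G.
   So alpha is a real quasidegree of some H^i with i < d exactly when some link in
   Delta has cohomology in one of the degrees excluded by Reisner's criterion for
   Cohen-Macaulayness in dimension d.

   Reisner's criterion is proved with Koszul complexes.  Vanishing of cohomology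
   of links is equivalent, one vertex at a time, to vanishing for restrictions of
   Delta, which is Koszul vanishing for k[Delta] in the multidegrees with entries
   -1 and 0; the other multidegrees give cones.  A regular sequence in the
   irrelevant ideal forces Koszul vanishing.  Conversely let P be any maximal
   ideal.  By Zariski's lemma P contains polynomials p_j = x_j^q + lower terms, so
   the elementary symmetric functions e_1, ..., e_d of the p_j lie in P and have
   leading forms e_i(x_1^q, ..., x_n^q), a system of parameters of k[Delta].
   Passing to the associated graded complexes, one adds these parameters to the
   Koszul complex of the variables, removes the variables (which are nilpotent
   modulo the parameters), and concludes by graded Nakayama that the e_i form a
   regular sequence.  Dimensions are bounded above by counting monomials outside
   the ideal, and chains of primes are produced by Zorn's lemma. *)
Require Import Defs.
From HB Require Import structures.
From mathcomp Require Import all_boot all_order all_algebra.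
From mathcomp Require Import boolp classical_sets reals.
From mathcomp Require Import complex mpoly zify ring.

Set Implicit Arguments.
Unset Strict Implicit.
Unset Printing Implicit Defensive.
Import Order.TTheory GRing.Theory Num.Theory.
Local Open Scope ring_scope.
Local Open Scope classical_set_scope.

(** * Koszul-type complexes *)

(** Cohen-Macaulayness is tested at every maximal ideal over an arbitrary field, so the ideals need
    not be homogeneous. Hence parameters are controlled only through their leading forms, and
    exactness passes through a degree filtration rather than a grading. Symmetric functions avoid
    genericity, which finite fields would not provide: when faces have at most d vertices, e_i(x^q)
    vanishes for i > d, and the polynomial with roots x_l^q writes a power of each variable
    explicitly through d functions.

    No quotient complex or derived functor is formed. A complex is a family of subgroups [U F]
    modulo [J F], and the only property used is [kvan], vanishing in one degree; the inductions on
    index sets use exactness at one place of the sequence that splits off one index.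

    Chains of primes are likewise handled by identities between ring elements, as in the
    Coquand-Lombardi description of Krull dimension: 0 lies in the [nested_monoid] of a sequence.
    Counting proves such identities; regular sequences and independent variables exclude them. Upper
    and lower bounds on dimension thus meet in one notion. *)

Section Koszul.
Variables (R : comPzRingType) (m : nat) (z : 'I_m -> R).
Implicit Types (A F G : {set 'I_m}) (j l : 'I_m) (c b : {set 'I_m} -> R).

Definition ksign j F : R := (-1) ^+ #|[set i in F | (i < j)%N]|.

Lemma ksign_sq j F : ksign j F * ksign j F = 1.
Proof. by rewrite -expr2 /ksign sqrr_sign. Qed.

Lemma ksignU1 j F : ksign j (j |: F) = ksign j F.
Proof.
rewrite /ksign; congr (_ ^+ _); apply: eq_card => i; rewrite !inE.
by case: eqP => [->|] //=; rewrite ltnn andbF.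
Qed.

Lemma ksign_swap j l F : j \notin F -> l \in F ->
  ksign l (j |: F) * ksign j (F :\ l) = - (ksign l F * ksign j F).
Proof.
move=> jF lF; have jl : j != l by apply: contraNneq jF => ->.
rewrite /ksign; case: (ltngtP j l) => [lt_jl|lt_lj|/val_inj/eqP]; last by rewrite (negPf jl).
- have -> : #|[set i in j |: F | (i < l)%N]| = #|[set i in F | (i < l)%N]|.+1.
    rewrite -[X in _ = X.+1]add0n -addSn (cardsD1 j) !inE eqxx lt_jl add1n.
    congr _.+1; apply: eq_card => i; rewrite !inE.
    by case: eqP => [->|] //=; rewrite (negPf jF).
  have -> : #|[set i in F :\ l | (i < j)%N]| = #|[set i in F | (i < j)%N]|.
    apply: eq_card => i; rewrite !inE; case: eqP => [->|] //=.
    by rewrite (ltnNge l) ltnW ?andbF.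
  by rewrite exprS mulN1r mulNr.
- have -> : #|[set i in j |: F | (i < l)%N]| = #|[set i in F | (i < l)%N]|.
    apply: eq_card => i; rewrite !inE; case: eqP => [->|] //=.
    by rewrite (negPf jF) (ltnNge j) ltnW.
  have -> : #|[set i in F | (i < j)%N]| = #|[set i in F :\ l | (i < j)%N]|.+1.
    rewrite -[X in _ = X.+1]add0n -addSn (cardsD1 l) !inE lF lt_lj add1n.
    congr _.+1; apply: eq_card => i; rewrite !inE.
    by case: eqP => [->|] //=.
  by rewrite exprS mulN1r mulrN opprK.
Qed.

Definition kd c F : R := \sum_(j in F) ksign j F * z j * c (F :\ j).

Definition kslice j c F : R := ksign j F * c (j |: F).
Definition kglue j u v F : R := if j \in F then ksign j F * v (F :\ j) else u F.

(** Splitting a cochain into its values away from [j] and its slice at [j] presents the complex as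
    the mapping cone of multiplication by [z j] on the complex without [j]; [kglue] reassembles the
    two parts. *)
Lemma kd_U1 j c F : j \notin F ->
  kd c (j |: F) = ksign j F * (z j * c F - kd (kslice j c) F).
Proof.
move=> jF; rewrite /kd (big_setU1 _ jF) /= (setU1K jF) ksignU1.
rewrite mulrBr mulrA; congr (_ + _); rewrite mulr_sumr -sumrN.
apply: eq_bigr => l lF; rewrite /kslice.
have jl : j != l by apply: contraNneq jF => ->.
have -> : (j |: F) :\ l = j |: F :\ l.
  by apply/setP => i; rewrite !inE; case: (eqVneq i j) => [->|]; rewrite ?jl.
rewrite -[ksign l (j |: F)]mulr1 -(ksign_sq j (F :\ l)) mulrA ksign_swap //.
ring.
Qed.

Lemma kd_ext c c' F : (forall j, j \in F -> c (F :\ j) = c' (F :\ j)) ->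
  kd c F = kd c' F.
Proof. by move=> e; apply: eq_bigr => j jF; rewrite e. Qed.

Lemma kdD c c' F : kd (fun G => c G + c' G) F = kd c F + kd c' F.
Proof. by rewrite -big_split; apply: eq_bigr => j _; rewrite mulrDr. Qed.

Lemma kdZ a c F : kd (fun G => a * c G) F = a * kd c F.
Proof. by rewrite mulr_sumr; apply: eq_bigr => j _; ring. Qed.

Lemma kdN c F : kd (fun G => - c G) F = - kd c F.
Proof. by rewrite -sumrN; apply: eq_bigr => j _; ring. Qed.

Lemma kdB c c' F : kd (fun G => c G - c' G) F = kd c F - kd c' F.
Proof. by rewrite kdD kdN. Qed.

Lemma kd0 F : kd (fun _ => 0) F = 0.
Proof. by rewrite /kd big1 // => j _; rewrite mulr0. Qed.

Lemma kd_kd c F : kd (kd c) F = 0.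
Proof.
have [r] := ubnP #|F|; elim: r F c => // r IH F c ltF.
have [->|[j jF]] := set_0Vmem F; first by rewrite /kd big_set0.
have jF' : j \notin F :\ j by rewrite !inE eqxx.
rewrite -(finset.setD1K jF) kd_U1 //.
have -> : kd (kslice j (kd c)) (F :\ j) =
    kd (fun G => z j * c G - kd (kslice j c) G) (F :\ j).
  apply: kd_ext => l lF; rewrite /kslice kd_U1; last by rewrite !inE eqxx andbF.
  by rewrite mulrA ksign_sq mul1r.
rewrite kdB kdZ IH ?subr0 ?subrr ?mulr0 //.
by move: ltF; rewrite (cardsD1 j) jF; lia.
Qed.

Lemma kslice_glue j u v F : j \notin F -> kslice j (kglue j u v) F = v F.
Proof.
move=> jF; rewrite /kslice /kglue setU11 ksignU1 setU1K //.
by rewrite mulrA ksign_sq mul1r.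
Qed.

Lemma kd_glue j u v F : j \notin F -> kd (kglue j u v) F = kd u F.
Proof.
by move=> jF; apply: kd_ext => l _; rewrite /kglue !inE (negPf jF) andbF.
Qed.

Lemma kd_glueU1 j u v F : j \notin F ->
  kd (kglue j u v) (j |: F) = ksign j F * (z j * u F - kd v F).
Proof.
move=> jF; rewrite kd_U1 // /kglue (negPf jF); congr (_ * (_ - _)).
by apply: kd_ext => l lF; rewrite kslice_glue // !inE (negPf jF) andbF.
Qed.

Lemma ksliceK j c F : j \notin F -> c (j |: F) = ksign j F * kslice j c F.
Proof. by move=> jF; rewrite mulrA ksign_sq mul1r. Qed.

(* The complex with term U F / J F in position F, for F contained in A, has
   no cohomology in degree i. *)
Definition kvan A (U J : {set 'I_m} -> set R) (i : nat) : Prop :=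
  forall c,
    (forall F, F \subset A -> #|F| = i -> U F (c F)) ->
    (forall F, F \subset A -> #|F| = i.+1 -> J F (kd c F)) ->
  exists b, (forall F, F \subset A -> #|F|.+1 = i -> U F (b F)) /\
    (forall F, F \subset A -> #|F| = i -> J F (c F - kd b F)).

(** These closure properties make the terms [U F] a subcomplex. They are only additive subgroups,
    since a level of a degree filtration is not stable under the ring. *)
Definition kstable (U : {set 'I_m} -> set R) : Prop :=
  [/\ forall F, U F 0, forall F x y, U F x -> U F y -> U F (x - y) &
      forall j F x, j \notin F -> U F x -> U (j |: F) (z j * x)].

Lemma kstableN U F x : kstable U -> U F x -> U F (- x).
Proof. by case=> U0 UB _ Ux; rewrite -sub0r; apply: UB. Qed.

Lemma kstableD U F x y : kstable U -> U F x -> U F y -> U F (x + y).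
Proof.
move=> kU Ux Uy; rewrite -[y]opprK; case: (kU) => _ UB _; apply: UB => //.
exact: kstableN.
Qed.

Lemma kstable_sign U j G F x : kstable U -> U F x -> U F (ksign j G * x).
Proof.
move=> kU Ux; rewrite /ksign -signr_odd; case: odd; rewrite ?expr0 ?mul1r //.
by rewrite expr1 mulN1r; apply: kstableN.
Qed.

Lemma kstable_signE U j G F x : kstable U -> U F (ksign j G * x) -> U F x.
Proof.
move=> kU /(kstable_sign j G kU); by rewrite mulrA ksign_sq mul1r.
Qed.

Lemma kstable_sum U F (I : finType) (P : pred I) (x : I -> R) : kstable U ->
  (forall i, P i -> U F (x i)) -> U F (\sum_(i | P i) x i).
Proof.
move=> kU Ux; elim/big_ind: _ => //; first by case: kU.
by move=> *; apply: kstableD.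
Qed.

Lemma kstable_kd U c F : kstable U ->
  (forall j, j \in F -> U (F :\ j) (c (F :\ j))) -> U F (kd c F).
Proof.
move=> kU Uc; apply: kstable_sum => // j jF; rewrite -mulrA.
apply: kstable_sign => //; case: kU => _ _ kz.
by rewrite -{1}(finset.setD1K jF); apply: kz; [rewrite !inE eqxx | exact: Uc].
Qed.

Lemma kvan_ext A U J U' J' i :
  (forall F, F \subset A -> U F = U' F) -> (forall F, F \subset A -> J F = J' F) ->
  kvan A U J i -> kvan A U' J' i.
Proof.
move=> eU eJ H c Uc Jc; case: (H c) => [F FA|F FA|b [Ub Jb]].
- by rewrite eU //; apply: Uc.
- by rewrite eJ //; apply: Jc.
exists b; split=> F FA; first by rewrite -eU //; apply: Ub.
by rewrite -eJ //; apply: Jb.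
Qed.

Lemma kvan_trivial A U J i : kstable J ->
  (forall F, F \subset A -> #|F| = i -> U F `<=` J F) -> kstable U -> kvan A U J i.
Proof.
move=> kJ UJ kU c Uc _; exists (fun=> 0); split=> F FA eF; first by case: kU.
by rewrite kd0 subr0; apply: UJ => //; apply: Uc.
Qed.

(** * The long exact sequence of adjoining one index *)

Section LongExactSequence.
Variables (A : {set 'I_m}) (j : 'I_m) (U J : {set 'I_m} -> set R).
Hypotheses (jA : j \notin A) (kU : kstable U) (kJ : kstable J).

Let nin F : F \subset A -> j \notin F.
Proof. by move=> FA; apply: contraNN jA; apply: fintype.subsetP. Qed.

Let sub F : F \subset A -> j |: F \subset j |: A.
Proof. by apply: finset.setUS. Qed.
Let sub' F : F \subset A -> F \subset j |: A.
Proof. by move=> FA; apply: fintype.subset_trans FA (finset.subsetUr _ _). Qed.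

Let cases F : F \subset j |: A ->
  F \subset A \/ exists2 G : {set 'I_m}, G \subset A & F = j |: G.
Proof.
move=> FA; have [jF|jF] := boolP (j \in F); last first.
  left; apply/fintype.subsetP => l lF; have := fintype.subsetP FA _ lF.
  by rewrite !inE => /predU1P[e|//]; rewrite -e lF in jF.
right; exists (F :\ j); last by rewrite finset.setD1K.
by rewrite finset.subDset.
Qed.

Let card F : F \subset A -> #|j |: F| = #|F|.+1.
Proof. by move=> FA; rewrite cardsU1 nin. Qed.

Local Notation U' := (fun F => U (j |: F)).
Local Notation J' := (fun F => J (j |: F)).

(** Exactness at one term of the cone sequence H^i(A; U) -> H^i(A; U') -> H^(i+1)(j |: A; U) ->
    H^(i+1)(A; U) -> H^(i+1)(A; U'), where coefficients are taken modulo J and J', and the maps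
    between terms over [A] are multiplication by [z j]. The family U' records how levels shift when
    [j] is adjoined. *)
Lemma kvan_cone i : kvan A U J i.+1 -> kvan A U' J' i -> kvan (j |: A) U J i.+1.
Proof.
move=> X Y c Uc Jc.
have [F FA eF|F FA eF|b [Ub Jb]] := X c.
- by apply: Uc; rewrite ?sub'.
- by apply: Jc; rewrite ?sub'.
pose w F := z j * b F - kslice j c F.
have [F FA eF|F FA eF|e [Ue Je]] := Y w.
- have [_ UB kz] := kU; apply: UB.
    by apply: kz; rewrite ?nin //; apply: Ub; rewrite ?eF.
  by apply: kstable_sign => //; apply: Uc; rewrite ?sub ?card ?eF.
- rewrite kdB kdZ.
  have -> : z j * kd b F - kd (kslice j c) F =
      - (z j * (c F - kd b F)) + (z j * c F - kd (kslice j c) F) by ring.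
  apply: kstableD => //.
    apply: kstableN => //; have [_ _ kz] := kJ; apply: kz; first exact: nin.
    exact: Jb.
  apply: (@kstable_signE _ j F) => //; rewrite -kd_U1 ?nin //.
  by apply: Jc; rewrite ?sub ?card ?eF.
exists (kglue j b e); split=> F /cases[FA eF|[G GA ->]].
- by rewrite /kglue (negPf (nin FA)); apply: Ub.
- rewrite card // => eG; rewrite /kglue setU11 setU1K ?nin //.
  by apply: kstable_sign => //; apply: Ue => //; case: eG.
- by rewrite kd_glue ?nin //; apply: Jb.
- rewrite card // => -[eG]; rewrite kd_glueU1 ?nin // (ksliceK c) ?nin //.
  rewrite -mulrBr; apply: kstable_sign => //.
  have -> : kslice j c G - (z j * b G - kd e G) = - (w G - kd e G).
    by rewrite /w; ring.
  by apply: kstableN => //; apply: Je.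
Qed.

Lemma kvan_cone0 : kvan A U J 0 -> kvan (j |: A) U J 0.
Proof.
move=> X c Uc Jc.
have [F FA eF|F FA eF|b [Ub Jb]] := X c.
- by apply: Uc; rewrite ?sub'.
- by apply: Jc; rewrite ?sub'.
exists b; split=> F /cases[FA|[G GA ->]] //; last by rewrite card.
by move=> eF; apply: Jb.
Qed.

(** Injectivity of [z j] on H^i over [A]. It is kept elementwise because, when variables are removed
    later, the target class is known to vanish for one cocycle only and not for the whole group. *)
Lemma kvan_cone_inj i : kvan (j |: A) U J i ->
  forall u b, (forall F, F \subset A -> #|F| = i -> U F (u F)) ->
    (forall F, F \subset A -> #|F| = i.+1 -> J F (kd u F)) ->
    (forall F, F \subset A -> #|F|.+1 = i -> U' F (b F)) ->
    (forall F, F \subset A -> #|F| = i -> J' F (z j * u F - kd b F)) ->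
  exists b', (forall F, F \subset A -> #|F|.+1 = i -> U F (b' F)) /\
    (forall F, F \subset A -> #|F| = i -> J F (u F - kd b' F)).
Proof.
move=> Z u b Uu Ju Ub Jb; have [F|F|b' [Ub' Jb']] := Z (kglue j u b).
- case/cases=> [FA eF|[G GA ->]]; first by rewrite /kglue (negPf (nin FA)); apply: Uu.
  rewrite card // => eG; rewrite /kglue setU11 setU1K ?nin //.
  by apply: kstable_sign => //; apply: Ub.
- case/cases=> [FA eF|[G GA ->]]; first by rewrite kd_glue ?nin //; apply: Ju.
  rewrite card // => -[eG]; rewrite kd_glueU1 ?nin //.
  by apply: kstable_sign => //; apply: Jb.
exists b'; split=> F FA eF; first by apply: Ub'; rewrite ?sub'.
by have := Jb' F (sub' FA) eF; rewrite /kglue (negPf (nin FA)).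
Qed.

Lemma kvan_base i : kvan (j |: A) U J i -> kvan A U' J' i -> kvan A U J i.
Proof.
move=> Z Y c Uc Jc; have [_ _ kzU] := kU; have [_ _ kzJ] := kJ.
have [F FA eF|F FA eF|b [Ub Jb]] := Y (fun F => z j * c F).
- by apply: kzU; [exact: nin | apply: Uc].
- by rewrite kdZ; apply: kzJ; [exact: nin | apply: Jc].
exact: kvan_cone_inj Uc Jc Ub Jb.
Qed.

Lemma kvan_fiber i : kvan A U J i -> kvan (j |: A) U J i.+1 -> kvan A U' J' i.
Proof.
move=> X Z c Uc Jc; have [U0 _ kzU] := kU; have [J0 _ kzJ] := kJ.
have [F|F|b [Ub Jb]] := Z (kglue j (fun=> 0) c).
- case/cases=> [FA eF|[G GA ->]]; first by rewrite /kglue (negPf (nin FA)).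
  rewrite card // => -[eG]; rewrite /kglue setU11 setU1K ?nin //.
  by apply: kstable_sign => //; apply: Uc.
- case/cases=> [FA eF|[G GA ->]]; first by rewrite kd_glue ?nin // kd0.
  rewrite card // => -[eG]; rewrite kd_glueU1 ?nin // mulr0 sub0r.
  by apply: kstable_sign => //; apply: kstableN => //; apply: Jc.
have [F FA eF|F FA eF|e [Ue Je]] := X b.
- by apply: Ub; rewrite ?sub' ?eF.
- have := Jb F (sub' FA) eF; rewrite /kglue (negPf (nin FA)) sub0r.
  by move/(kstableN kJ); rewrite opprK.
exists (fun F => z j * e F - kslice j b F); split=> F FA eF.
  have [_ UB _] := kU; apply: UB; first by apply: kzU; [exact: nin | apply: Ue].
  by apply: kstable_sign => //; apply: Ub; rewrite ?sub ?card // eF.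
rewrite kdB kdZ.
have /(kzJ j _ _ (nin FA)) h1 := Je F FA eF.
have := Jb (j |: F) (sub FA); rewrite card // eF => /(_ erefl).
rewrite /kglue setU11 setU1K ?nin // ksignU1 kd_U1 ?nin // -mulrBr.
move/(kstable_signE kJ) => h2.
have -> : c F - (z j * kd e F - kd (kslice j b) F) =
  (c F - (z j * b F - kd (kslice j b) F)) + z j * (b F - kd e F) by ring.
exact: kstableD.
Qed.

(** This is the cone of an identity map; the slice at [j] is the contracting homotopy. *)
Lemma kvan_acyclic i : z j = 1 -> (forall F, F \subset A -> U (j |: F) = U F) ->
  (forall F, F \subset A -> J (j |: F) = J F) -> kvan (j |: A) U J i.
Proof.
move=> z1 eU eJ c Uc Jc; have [U0 _ _] := kU; have [J0 _ _] := kJ.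
exists (kglue j (kslice j c) (fun=> 0)); split=> F /cases[FA eF|[G GA ->]].
- rewrite /kglue (negPf (nin FA)) -eU //; apply: kstable_sign => //.
  by apply: Uc; rewrite ?sub ?card.
- by move=> _; rewrite /kglue setU11 mulr0.
- rewrite kd_glue ?nin // -eJ //; apply: (@kstable_signE _ j F) => //.
  rewrite -[c F]mul1r -z1 -kd_U1 ?nin //; apply: Jc; rewrite ?sub ?card ?eF //.
- move=> eG; rewrite kd_glueU1 ?nin // kd0 subr0 z1 mul1r.
  by rewrite -ksliceK ?nin // subrr.
Qed.

End LongExactSequence.

(* Multiplication by z l is homotopic to zero. *)
Lemma kd_contract l c : exists b,
  (forall F, l \in F -> b F = 0) /\ (forall F, l \notin F -> b F = kslice l c F) /\
  forall F, z l * c F - kd b F =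
    if l \in F then 0 else ksign l F * kd c (l |: F).
Proof.
exists (kglue l (kslice l c) (fun=> 0)); split=> [F lF|].
  by rewrite /kglue lF mulr0.
split=> [F lF|F]; first by rewrite /kglue (negPf lF).
case: ifPn => lF.
  rewrite -(finset.setD1K lF) kd_glueU1 ?kd0 ?subr0 ?(ksliceK c) ?inE ?eqxx //.
  by rewrite /kslice; ring.
by rewrite kd_glue // kd_U1 // mulrA ksign_sq mul1r.
Qed.

End Koszul.

(** * Simplicial cochains of links and restrictions *)

Section SimplicialCochains.
Variables (k : fieldType) (n : nat).
Implicit Types (A F G L : {set 'I_n}) (j : 'I_n) (U J : {set 'I_n} -> set k).

Local Notation one := (fun _ : 'I_n => 1 : k).
Local Notation full := (fun _ : {set 'I_n} => [set: k]).

Definition mono_fam U : Prop :=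
  [/\ forall F, U F 0, forall F x y, U F x -> U F y -> U F (x - y) &
      forall F F', F \subset F' -> U F `<=` U F'].

Definition shift_fam L U F : set k := U (L :|: F).

Lemma mono_fam_stable U : mono_fam U -> kstable one U.
Proof.
by case=> U0 UB Um; split=> // j F x _; rewrite mul1r; apply: Um; apply: finset.subsetUr.
Qed.

Lemma mono_fam_shift L U : mono_fam U -> mono_fam (shift_fam L U).
Proof.
case=> U0 UB Um; split=> [F|F x y|F F' FF']; [exact: U0|exact: UB|].
by apply: Um; apply: finset.setUS.
Qed.

Lemma mono_fam_full : mono_fam full.
Proof. by split. Qed.

(** Modulo [off D], the family [above G] leaves one copy of k for each face of D containing G and
    zero elsewhere. Positions are cardinalities, so for empty G index i is reduced cohomology in
    degree i - 1. *)
Definition above G F : set k := [set x | G \subset F \/ x = 0].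
Definition off (D : set {set 'I_n}) F : set k := [set x | D F -> x = 0].

Lemma mono_fam_above G : mono_fam (above G).
Proof.
split=> [F|F x y|F F' FF' x] /=; first by right.
- by case=> [?|->]; [left|case=> [?|->]; [left|right; rewrite subr0]].
- by case=> [GF|->]; [left; apply: fintype.subset_trans GF FF'|right].
Qed.

Lemma mono_fam_off D : (forall F F', F \subset F' -> D F' -> D F) ->
  mono_fam (off D).
Proof.
move=> Dd; split=> [F|F x y Dx Dy DF|F F' FF' x Dx DF'] //=.
  by rewrite Dx // Dy // subr0.
by apply: Dx; apply: Dd FF' DF'.
Qed.

Lemma setC_U1 j L : j \notin L -> j |: ~: (j |: L) = ~: L.
Proof.
move=> jL; apply/setP => i; rewrite !inE; by case: (eqVneq i j) => [->|] //=; rewrite ?jL ?orbT.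
Qed.

Lemma shift_famU1 j L U A i J :
  kvan one A (fun F => shift_fam L U (j |: F)) (fun F => shift_fam L J (j |: F)) i <->
  kvan one A (shift_fam (j |: L) U) (shift_fam (j |: L) J) i.
Proof.
have e V F : shift_fam L V (j |: F) = shift_fam (j |: L) V F.
  by rewrite /shift_fam finset.setUCA finset.setUA.
by split; apply: kvan_ext => F _; rewrite e.
Qed.

(** When the quotient is zero on the sets without [j], only the slice of the cone remains, and
    cohomology moves by one degree. *)
Lemma kvan_shift_step j L U J i : j \notin L -> mono_fam U -> mono_fam J ->
  (forall F, j \notin F -> U F `<=` J F) ->
  kvan one (~: L) (shift_fam L U) (shift_fam L J) 0 /\
  (kvan one (~: L) (shift_fam L U) (shift_fam L J) i.+1 <->
   kvan one (~: (j |: L)) (shift_fam (j |: L) U) (shift_fam (j |: L) J) i).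
Proof.
move=> jL mU mJ UJ.
have jA : j \notin ~: (j |: L) by rewrite !inE eqxx.
have sU := mono_fam_stable (mono_fam_shift L mU).
have sJ := mono_fam_stable (mono_fam_shift L mJ).
have X i' : kvan one (~: (j |: L)) (shift_fam L U) (shift_fam L J) i'.
  apply: kvan_trivial => // F FA _; apply: UJ; rewrite inE negb_or jL /=.
  by apply: contraNN jA; apply: fintype.subsetP.
rewrite -(setC_U1 jL) -shift_famU1; split; first exact: kvan_cone0.
by split; [apply: kvan_fiber|apply: kvan_cone].
Qed.

(** Peeling off the vertices of G one at a time turns the faces above G into those of the link of G,
    at the cost of one degree per vertex. *)
Lemma kvan_above G J i : mono_fam J ->
  kvan one [set: 'I_n] (above G) J (i + #|G|) <->
  kvan one (~: G) full (shift_fam G J) i.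
Proof.
move=> mJ.
have aux r : forall L, L \subset G -> #|G :\: L| = r ->
    kvan one (~: L) (shift_fam L (above G)) (shift_fam L J) (i + r) <->
    kvan one (~: G) full (shift_fam G J) i.
  elim: r => [|r IH] L LG.
    move/eqP; rewrite cards_eq0 finset.setD_eq0 => GL.
    have /eqP -> : L == G by rewrite finset.eqEsubset LG.
    rewrite addn0; have e F : shift_fam G (above G) F = setT.
      by apply/seteqP; split=> // x _; left; apply: finset.subsetUl.
    by split; apply: kvan_ext => F _; rewrite ?e.
  move=> cGL; have [e|[j]] := set_0Vmem (G :\: L).
    by rewrite e cards0 in cGL.
  rewrite inE => /andP[jL jG].
  have mA := mono_fam_above G.
  have [|_ st] := @kvan_shift_step j L (above G) J (i + r) jL mA mJ.
    move=> F jF x [GF|->]; last by case: mJ.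
    by rewrite (fintype.subsetP GF _ jG) in jF.
  rewrite addnS st; apply: IH; first by rewrite finset.subUset finset.sub1set jG.
  move: cGL; rewrite (cardsD1 j) inE jL jG add1n => -[<-].
  by congr #|pred_of_set _|; apply/setP => l; rewrite !inE negb_or andbA.
rewrite -(aux #|G| finset.set0) ?finset.sub0set ?finset.setD0 //.
have e U F : shift_fam finset.set0 U F = U F by rewrite /shift_fam finset.set0U.
by rewrite finset.setC0; split; apply: kvan_ext => F _; rewrite ?e.
Qed.

Lemma kvan_above_lt G J i : mono_fam J -> (i < #|G|)%N ->
  kvan one [set: 'I_n] (above G) J i.
Proof.
move=> mJ ltiG; apply: kvan_trivial; try exact: mono_fam_stable.
- move=> F _ eF x [GF|->]; last by case: mJ.
  by have := subset_leq_card GF; rewrite eF leqNgt ltiG.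
- exact/mono_fam_stable/mono_fam_above.
Qed.

(** For J = [off D] and r = d this is Reisner's condition: the reduced cohomology of the link of L
    vanishes in degrees below d - 1 - #|L|. An L that is not a face imposes nothing. *)
Definition link_vanishing J r : Prop :=
  forall L i, (i + #|L| < r)%N -> kvan one (~: L) full (shift_fam L J) i.
Definition restriction_vanishing J r : Prop :=
  forall G i, (i + #|G| < r)%N -> kvan one (~: G) full J i.

Lemma link_vanishingE J r : mono_fam J ->
  link_vanishing J r <->
  forall G i, (i < r)%N -> kvan one [set: 'I_n] (above G) J i.
Proof.
move=> mJ; split=> H G i hi; last by rewrite -kvan_above //; apply: H.
have [ltiG|leGi] := ltnP i #|G|; first exact: kvan_above_lt.
rewrite -(subnK leGi) kvan_above //; apply: H; lia.
Qed.

(** The auxiliary statement interpolates: delete G and take the link of L. For j in G, deleting j is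
    controlled by not deleting it and by the link of j in the same degree, and neither increases i +
    #|G| + #|L|. *)
Lemma link_to_restriction J r : mono_fam J ->
  link_vanishing J r -> restriction_vanishing J r.
Proof.
move=> mJ H.
have aux g : forall G L i, #|G| = g -> G \subset ~: L ->
    (i + #|G| + #|L| < r)%N -> kvan one (~: (G :|: L)) full (shift_fam L J) i.
  elim: g => [|g IH] G L i.
    move/eqP; rewrite cards_eq0 => /eqP-> _; rewrite cards0 addn0 finset.set0U.
    exact: H.
  move=> cG dGL hi; have [e|[j jG]] := set_0Vmem G.
    by rewrite e cards0 in cG.
  have jL : j \notin L by have := fintype.subsetP dGL _ jG; rewrite inE.
  have jA : j \notin ~: (G :|: L) by rewrite !inE jG.
  have cG' : #|G :\ j| = g by move: cG; rewrite (cardsD1 j) jG; case.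
  have dG' : G :\ j \subset ~: L.
    by apply: fintype.subset_trans dGL; apply: finset.subsetDl.
  have eA : j |: ~: (G :|: L) = ~: ((G :\ j) :|: L).
    apply/setP => l; rewrite !inE; by case: (eqVneq l j) => [->|] //=; rewrite ?jL ?orbT.
  apply: (kvan_base jA (mono_fam_stable mono_fam_full)
                       (mono_fam_stable (mono_fam_shift L mJ))) => //.
    by rewrite eA; apply: IH; rewrite ?cG' //; lia.
  have eA' : ~: (G :|: L) = ~: ((G :\ j) :|: (j |: L)).
    apply/setP => l; rewrite !inE; by case: (eqVneq l j) => [->|] //=; rewrite ?jG ?orbT.
  apply/(shift_famU1 j L full _ i J); rewrite eA'; apply: IH => //.
    apply/fintype.subsetP => l lG; have := fintype.subsetP dG' _ lG.
    by move: lG; rewrite !inE negb_or => /andP[-> _] ->.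
  by rewrite cG' cardsU1 jL; lia.
move=> G i hi; have := aux _ G finset.set0 i erefl.
rewrite finset.setU0 cards0 addn0 => /(_ _ hi) h.
apply: kvan_ext (h _) => // [F _|]; first by rewrite /shift_fam finset.set0U.
by apply/fintype.subsetP => l; rewrite !inE.
Qed.

(** The same sequence read at another place: the link of j is controlled by the deletion of j in
    degree i and by the undeleted complex in degree i + 1, both with the same total i + #|G| +
    #|L|. *)
Lemma restriction_to_link J r : mono_fam J ->
  restriction_vanishing J r -> link_vanishing J r.
Proof.
move=> mJ H.
have aux g : forall L G i, #|L| = g -> G \subset ~: L ->
    (i + #|G| + #|L| < r)%N -> kvan one (~: (G :|: L)) full (shift_fam L J) i.
  elim: g => [|g IH] L G i.
    move/eqP; rewrite cards_eq0 => /eqP-> _; rewrite cards0 addn0 finset.setU0.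
    move=> hi; apply: kvan_ext (H _ _ hi) => // F _.
    by rewrite /shift_fam finset.set0U.
  move=> cL dGL hi; have [e|[j jL]] := set_0Vmem L.
    by rewrite e cards0 in cL.
  have jG : j \notin G.
    by apply: contraL jL => /(fintype.subsetP dGL); rewrite inE.
  have jA : j \notin ~: (G :|: L) by rewrite !inE jL orbT.
  have cL' : #|L :\ j| = g by move: cL; rewrite (cardsD1 j) jL; case.
  have dL' : G \subset ~: (L :\ j).
    apply: fintype.subset_trans dGL _; rewrite finset.setCS.
    exact: finset.subsetDl.
  have eA : j |: ~: (G :|: L) = ~: (G :|: (L :\ j)).
    apply/setP => l; rewrite !inE; by case: (eqVneq l j) => [->|] //=; rewrite ?(negPf jG) ?orbT.
  rewrite -{2}(finset.setD1K jL); apply/(shift_famU1 j (L :\ j) full _ i J).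
  apply: (kvan_fiber jA (mono_fam_stable mono_fam_full)
                       (mono_fam_stable (mono_fam_shift (L :\ j) mJ))).
    have -> : ~: (G :|: L) = ~: ((j |: G) :|: (L :\ j)).
      apply/setP => l; rewrite !inE; by case: (eqVneq l j) => [->|] //=; rewrite ?jL ?orbT.
    apply: IH => //; first by rewrite finset.subUset finset.sub1set dL' !inE eqxx.
    by rewrite cL' cardsU1 jG; lia.
  by rewrite eA; apply: IH => //; rewrite cL'; lia.
move=> L i hi; have := aux _ L finset.set0 i erefl.
rewrite finset.set0U cards0 addn0; apply=> //.
by apply: finset.sub0set.
Qed.

End SimplicialCochains.

(** * Ideals and monomial ideals *)

Section IdealsAsSets.
Variable R : comPzRingType.

(** Membership is a proposition here, so that unions of chains and ideals of the form P + (y) can be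
    written as sets and then turned into a boolean [ideal]. *)
Record ideal_set := IdealSet {
  ideal_carrier :> R -> Prop;
  ideal_set0 : ideal_carrier 0;
  ideal_setB : forall x y, ideal_carrier x -> ideal_carrier y -> ideal_carrier (x - y);
  ideal_setM : forall a x, ideal_carrier x -> ideal_carrier (a * x) }.

Definition ideal_set_mem (A : ideal_set) : R -> bool := fun x => `[< A x >].

Lemma ideal_set_mem_zmod A : zmod_closed (ideal_set_mem A).
Proof.
split=> [|x y /asboolP Ax /asboolP Ay]; apply/asboolP; first exact: ideal_set0.
exact: ideal_setB.
Qed.

Lemma ideal_set_mem_absorb A a :
  {in ideal_set_mem A, forall u, a * u \in ideal_set_mem A}.
Proof. by move=> u /asboolP Au; apply/asboolP; apply: ideal_setM. Qed.

HB.instance Definition _ A :=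
  GRing.isZmodClosed.Build R (ideal_set_mem A) (ideal_set_mem_zmod A).
HB.instance Definition _ A :=
  isAbsorbing.Build R (ideal_set_mem A) (@ideal_set_mem_absorb A).

Definition ideal_of_set (A : ideal_set) : ideal R :=
  Ideal.clone R (ideal_set_mem A) _.

Lemma ideal_of_setP (A : ideal_set) x : x \in ideal_of_set A <-> A x.
Proof. by split=> [/asboolP|Ax] //; apply/asboolP. Qed.

Lemma generated_ideal_sub (A : set R) (J : ideal R) x :
  (forall y, A y -> y \in J) -> x \in generated_ideal A -> x \in J.
Proof. by move=> AJ /asboolP; apply. Qed.

Lemma generated_ideal_mem (A : set R) x : A x -> x \in generated_ideal A.
Proof. by move=> Ax; apply/asboolP => J; apply. Qed.

Lemma generated_ideal_seqP (s : seq R) x :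
  x \in generated_ideal [set` s] <->
  exists g : nat -> R, x = \sum_(i < size s) g i * s`_i.
Proof.
split; last first.
  move=> [g ->]; apply: rpred_sum => i _; apply: idealMl.
  by apply: generated_ideal_mem => /=; apply: mem_nth.
pose A := [set x | exists g : nat -> R, x = \sum_(i < size s) g i * s`_i].
have A0 : A 0 by exists (fun=> 0); rewrite big1 // => i _; rewrite mul0r.
have AB y z : A y -> A z -> A (y - z).
  move=> [g ->] [h ->]; exists (fun i => g i - h i).
  by rewrite -sumrB; apply: eq_bigr => i _; rewrite mulrBl.
have AM a y : A y -> A (a * y).
  move=> [g ->]; exists (fun i => a * g i).
  by rewrite mulr_sumr; apply: eq_bigr => i _; rewrite mulrA.
move=> xs; apply/(ideal_of_setP (IdealSet A0 AB AM)).
apply: generated_ideal_sub xs => y ys; apply/ideal_of_setP.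
have ys' : (index y s < size s)%N by rewrite index_mem.
exists (fun i => (i == index y s)%:R).
rewrite (bigD1 (Ordinal ys')) //= eqxx mul1r nth_index // big1 ?addr0 // => i.
by rewrite -val_eqE /= => /negPf->; rewrite mul0r.
Qed.

End IdealsAsSets.

Section MonomialIdealMembership.
Variables (k : fieldType) (n : nat).
Local Notation S := {mpoly k[n]}.
Implicit Types (p : S) (u v w : 'X_{1..n}) (F : {set 'I_n}).

Section UpwardClosed.
Variable Up : set 'X_{1..n}.
Hypothesis UpD : forall u v, Up u -> Up (v + u)%MM.

Let span p : Prop := forall u, u \in msupp p -> Up u.

Let span0 : span 0.
Proof. by move=> u; rewrite msupp0. Qed.
Let spanB p q : span p -> span q -> span (p - q).
Proof.
by move=> hp hq u /msuppB_le; rewrite mem_cat => /orP[/hp|/hq].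
Qed.
Let spanM p q : span q -> span (p * q).
Proof. by move=> hq u /msuppM_le/allpairsP[[v w] /= [_ /hq ? ->]]; apply: UpD. Qed.

Definition monomial_span : ideal S := ideal_of_set (IdealSet span0 spanB spanM).

Lemma monomial_spanP p :
  p \in monomial_span <-> forall u, u \in msupp p -> Up u.
Proof. exact: ideal_of_setP. Qed.

End UpwardClosed.

Lemma ideal_scale (I : ideal S) c p : p \in I -> c *: p \in I.
Proof. by rewrite -mul_mpolyC; apply: idealMl. Qed.

Lemma ideal_mpolyXD (I : ideal S) u v : 'X_[u] \in I -> 'X_[v + u] \in I.
Proof. by rewrite mpolyXD; apply: idealMl. Qed.

Lemma ideal_lepm (I : ideal S) u v : (u <= v)%MM -> 'X_[u] \in I -> 'X_[v] \in I.
Proof. by move=> /submK <-; apply: ideal_mpolyXD. Qed.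

Lemma monomial_idealP (I : ideal S) p : monomial_ideal I ->
  p \in I <-> forall u, u \in msupp p -> 'X_[u] \in I.
Proof.
move=> [A IA]; split; last first.
  move=> h; rewrite [p]mpolyE big_seq; apply: rpred_sum => u up.
  by apply: ideal_scale; apply: h.
pose UpD u v := @ideal_mpolyXD I u v.
rewrite IA => pA; apply/(monomial_spanP UpD).
apply: generated_ideal_sub pA => q [u Au <-].
apply/monomial_spanP => v; rewrite msuppX inE => /eqP->.
by rewrite IA; apply: generated_ideal_mem; exists u.
Qed.

Definition mnm_support u : {set 'I_n} := [set j | u j != 0%N].

Lemma mnm_supportD u v : mnm_support (u + v)%MM = mnm_support u :|: mnm_support v.
Proof. by apply/setP => j; rewrite !inE mnmDE addn_eq0 negb_and. Qed.

Lemma mnm_support_mesym1 F : mnm_support (mesym1 F) = F.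
Proof. by apply/setP => j; rewrite inE mnmE; case: (j \in F). Qed.

Lemma xprod_mesym1 F : xprod (fun j => 'X_j : S) F = 'X_[mesym1 F].
Proof.
rewrite mpolyXE_id /xprod big_mkcond /=; apply: eq_bigr => i _.
by rewrite mnmE; case: (i \in F); rewrite ?expr1 ?expr0.
Qed.

Section StanleyReisner.
Variable D : set {set 'I_n}.
Hypothesis Ddown : forall F F', F \subset F' -> D F' -> D F.

Lemma SR_monomial : monomial_ideal (stanley_reisner_ideal k D).
Proof.
exists [set mesym1 F | F in ~` D] => p; rewrite /stanley_reisner_ideal.
by congr (p \in generated_ideal _); apply/seteqP; split=> [q [F DF <-]|q [u [F DF <-] <-]];
  [exists (mesym1 F) => //; [exists F|rewrite xprod_mesym1]
  |exists F => //; rewrite xprod_mesym1].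
Qed.

Lemma SR_mpolyX u : 'X_[u] \in stanley_reisner_ideal k D <-> ~ D (mnm_support u).
Proof.
split=> [uD|Du]; last first.
  have /ideal_lepm : (mesym1 (mnm_support u) <= u)%MM.
    by apply/mnm_lepP => j; rewrite mnmE inE; case: (u j).
  apply; apply: generated_ideal_mem; exists (mnm_support u) => //.
  exact: xprod_mesym1.
have UpD u1 v : ~ D (mnm_support u1) -> ~ D (mnm_support (v + u1)%MM).
  move=> h; apply: contra_not h; apply: Ddown.
  by rewrite mnm_supportD; apply: finset.subsetUr.
suff /(monomial_spanP UpD) : 'X_[u] \in monomial_span UpD.
  by apply; rewrite msuppX inE.
apply: generated_ideal_sub uD => q [F DF <-]; apply/monomial_spanP => v.
by rewrite xprod_mesym1 msuppX inE => /eqP->; rewrite mnm_support_mesym1.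
Qed.

Lemma SR_idealP p : p \in stanley_reisner_ideal k D <->
  forall u, u \in msupp p -> ~ D (mnm_support u).
Proof.
rewrite (monomial_idealP _ SR_monomial).
by split=> h u /h hu; [apply: (SR_mpolyX u).1 | apply: (SR_mpolyX u).2].
Qed.

End StanleyReisner.

End MonomialIdealMembership.

Section QuotientMorphism.
Variables (R : comPzRingType) (I : ideal R).

Lemma qproj_is_zmod_morphism : zmod_morphism (@qproj R I).
Proof.
by move=> x y; apply/eqP; rewrite eq_sym subr_eq; apply/eqP; rewrite -qprojD subrK.
Qed.
Lemma qproj_is_monoid_morphism : monoid_morphism (@qproj R I).
Proof. by split=> // x y; apply: esym; apply: qmulE. Qed.
HB.instance Definition _ :=
  GRing.isZmodMorphism.Build R (ring_quot I) (@qproj R I) qproj_is_zmod_morphism.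
HB.instance Definition _ :=
  GRing.isMonoidMorphism.Build R (ring_quot I) (@qproj R I) qproj_is_monoid_morphism.

Lemma qproj_eq0 x : qproj I x = 0 <-> x \in I.
Proof. by rewrite -(rmorph0 (qproj I)) qproj_eq subr0. Qed.

Lemma qprojP (y : ring_quot I) : exists x, y = qproj I x.
Proof. by exists (repr (y : Quotient.quot I)); rewrite qproj_repr. Qed.

End QuotientMorphism.

Section SizeBounds.
Variables (k : fieldType) (n : nat).
Local Notation S := {mpoly k[n]}.

Lemma msizeM_leq a b (f g : S) : (msize f <= a.+1)%N -> (msize g <= b.+1)%N ->
  (msize (f * g) <= (a + b).+1)%N.
Proof.
have [->|f0] := eqVneq f 0; first by rewrite mul0r mmeasure0.
have [->|g0] := eqVneq g 0; first by rewrite mulr0 mmeasure0.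
move=> fa gb; suff : ((msize f + msize g).-1 <= (a + b).+1)%N.
  by apply: leq_trans; rewrite msizeM.
lia.
Qed.

Lemma msizeM_lt a b (f g : S) : (msize f <= a)%N -> (msize g <= b.+1)%N ->
  (msize (f * g) <= a + b)%N.
Proof.
case: a => [|a]; first by rewrite leqn0 msize_poly_eq0 => /eqP->; rewrite mul0r mmeasure0.
exact: msizeM_leq.
Qed.

Lemma msizeD_leq a (f g : S) : (msize f <= a)%N -> (msize g <= a)%N ->
  (msize (f + g) <= a)%N.
Proof. by move=> fa ga; apply: leq_trans (msizeD_le _ _) _; rewrite geq_max fa. Qed.

Lemma msize_sum_leq a (I : Type) (r : seq I) (P : pred I) (f : I -> S) :
  (forall i, P i -> (msize (f i) <= a)%N) -> (msize (\sum_(i <- r | P i) f i) <= a)%N.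
Proof.
by move=> H; elim/big_ind: _ => //; [rewrite mmeasure0|move=> *; apply: msizeD_leq].
Qed.

Lemma msizeXn j a : (msize ('X_j ^+ a : S) <= a.+1)%N.
Proof. by rewrite mpolyXn msizeX mdegMn mdeg1 mul1n. Qed.

End SizeBounds.

(** * Face rings *)

Section FaceRing.
Variables (k : fieldType) (n : nat) (D : set {set 'I_n}).
Hypothesis Ddown : forall F F' : {set 'I_n}, F \subset F' -> D F' -> D F.
Local Notation S := {mpoly k[n]}.
Local Notation Q := (stanley_reisner_ring k D).
Local Notation pr := (qproj (stanley_reisner_ideal k D)).
Implicit Types (u v : 'X_{1..n}) (F G : {set 'I_n}) (y : Q) (p : S).

Definition xvar (j : 'I_n) : Q := pr 'X_j.

(** Independent of the representative only when the support of u is a face, hence the hypothesis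
    [D (mnm_support u)] on the lemmas about it. *)
Definition coefQ u y : k := (repr (y : Quotient.quot (stanley_reisner_ideal k D)))@_u.

Lemma coefQ_proj u p : D (mnm_support u) -> coefQ u (pr p) = p@_u.
Proof.
move=> Du; apply/eqP; rewrite -subr_eq0 -mcoeffB; apply/eqP.
apply: memN_msupp_eq0; apply/negP => hu.
by have /(SR_idealP Ddown)/(_ _ hu) := repr_qproj (stanley_reisner_ideal k D) p; apply.
Qed.

Lemma coefQ_is_zmod_morphism u : D (mnm_support u) -> zmod_morphism (coefQ u).
Proof.
move=> Du y z; have [p ->] := qprojP y; have [q ->] := qprojP z.
by rewrite -rmorphB !coefQ_proj // mcoeffB.
Qed.

Lemma coefQB u y z : D (mnm_support u) -> coefQ u (y - z) = coefQ u y - coefQ u z.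
Proof. by move=> Du; rewrite coefQ_is_zmod_morphism. Qed.

Lemma coefQ0 u : D (mnm_support u) -> coefQ u 0 = 0.
Proof. by move=> Du; rewrite -[0](rmorph0 pr) coefQ_proj // mcoeff0. Qed.

Lemma coefQD u y z : D (mnm_support u) -> coefQ u (y + z) = coefQ u y + coefQ u z.
Proof.
by move=> Du; rewrite -[z in LHS]opprK coefQB // -[- z]sub0r coefQB // coefQ0 // sub0r opprK.
Qed.

Lemma coefQ_sum u (I : finType) (P : pred I) (f : I -> Q) : D (mnm_support u) ->
  coefQ u (\sum_(i | P i) f i) = \sum_(i | P i) coefQ u (f i).
Proof.
by move=> Du; apply: big_morph => [y z|]; [apply: coefQD|apply: coefQ0].
Qed.

Lemma mcoeffXM j p u :
  ('X_j * p)@_u = if u j == 0%N then 0 else p@_(u - U_(j))%MM.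
Proof.
case: ifPn => uj; last first.
  have {1}-> : u = (U_(j) + (u - U_(j)))%MM by rewrite addmC submK // lep1mP.
  by rewrite mulrC mcoeffMX.
rewrite mulrC; apply: memN_msupp_eq0; apply/negP => /msuppM_le/allpairsP[[v w] /=].
by rewrite msuppX inE => -[_ /eqP-> e]; move: uj; rewrite e mnmDE mnm1E eqxx addn1.
Qed.

Lemma coefQ_xvar j y u : D (mnm_support u) ->
  coefQ u (xvar j * y) = if u j == 0%N then 0 else coefQ (u - U_(j))%MM y.
Proof.
move=> Du; have [p ->] := qprojP y; rewrite -rmorphM [LHS]coefQ_proj // mcoeffXM.
case: ifPn => // uj; rewrite coefQ_proj //; apply: Ddown Du.
by apply/fintype.subsetP => i; rewrite !inE mnmBE; lia.
Qed.

Lemma coefQ_kd c F u : D (mnm_support u) ->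
  coefQ u (kd xvar c F) = \sum_(j in F) ksign k j F *
    (if u j == 0%N then 0 else coefQ (u - U_(j))%MM (c (F :\ j))).
Proof.
move=> Du; rewrite coefQ_sum //; apply: eq_bigr => j _.
rewrite -mulrA -coefQ_xvar // /ksign -signr_odd -[in RHS]signr_odd.
case: odd; rewrite ?expr0 ?mul1r // !expr1 !mulN1r.
by rewrite -sub0r coefQB // coefQ0 // sub0r.
Qed.

(** Degree less than M, tested on face monomials. All other monomials are zero in the face ring, so
    a representative of that size exists ([degQP]). *)
Definition degQ (M : nat) : set Q :=
  [set y | forall u, D (mnm_support u) -> (M <= mdeg u)%N -> coefQ u y = 0].

Lemma degQP M y : degQ M y <-> exists2 p, y = pr p & (msize p <= M)%N.
Proof.
split=> [yM|[p -> pM] u Du Mu]; last first.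
  rewrite coefQ_proj //; apply: memN_msupp_eq0; apply: msize_mdeg_ge.
  exact: leq_trans Mu.
have [q eq_y] := qprojP y.
pose p := \sum_(u <- msupp q | (mdeg u < M)%N) q@_u *: 'X_[u].
exists p; last first.
  apply: leq_trans (mmeasure_sum _ _ _ _) _; apply/bigmax_leqP_seq => u _ uM.
  by apply: leq_trans (msizeZ_le _ _) _; rewrite msizeX.
apply/eqP; rewrite eq_y -subr_eq0 -rmorphB; apply/eqP/qproj_eq0.
have -> : q - p = \sum_(u <- msupp q | (M <= mdeg u)%N) q@_u *: 'X_[u].
  rewrite {1}[q]mpolyE (bigID (fun u => (mdeg u < M)%N)) /= -/p addrC addrK.
  by apply: eq_bigl => u; rewrite -leqNgt.
rewrite big_seq_cond; apply: rpred_sum => u /andP[uq Mu].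
apply: ideal_scale; apply/(SR_mpolyX _ Ddown) => Du.
by move: uq; rewrite mcoeff_msupp -coefQ_proj // -eq_y yM // eqxx.
Qed.

Lemma degQ0 M : degQ M 0.
Proof. by move=> u Du _; apply: coefQ0. Qed.

Lemma degQB M y z : degQ M y -> degQ M z -> degQ M (y - z).
Proof. by move=> yM zM u Du Mu; rewrite coefQB // yM // zM // subr0. Qed.

Lemma degQ_le M N y : (M <= N)%N -> degQ M y -> degQ N y.
Proof. by move=> MN yM u Du Nu; apply: yM => //; apply: leq_trans MN Nu. Qed.

Lemma degQ_mul M p e y : (msize p <= e.+1)%N -> degQ M y ->
  degQ (if M is 0 then 0 else M + e)%N (pr p * y).
Proof.
move=> pe /degQP[q -> qM]; rewrite -rmorphM; apply/degQP; exists (p * q) => //.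
have [->|p0] := eqVneq p 0; first by rewrite mul0r mmeasure0.
have [->|q0] := eqVneq q 0; first by rewrite mulr0 mmeasure0.
have p1 : (0 < msize p)%N by rewrite lt0n msize_poly_eq0.
have q1 : (0 < msize q)%N by rewrite lt0n msize_poly_eq0.
suff : ((msize p + msize q).-1 <= if M is 0 then 0 else M + e)%N.
  by apply: leq_trans; rewrite msizeM.
by move: qM; case: M => [|M]; lia.
Qed.

Lemma degQ_zero y : degQ 0 y -> y = 0.
Proof.
move=> /degQP[p ->]; rewrite leqn0 msize_poly_eq0 => /eqP->; exact: rmorph0.
Qed.

Lemma ksignQ j F p : ksign Q j F * pr p = pr (ksign k j F *: p).
Proof.
rewrite /ksign -signr_odd -[in RHS]signr_odd; case: odd.
  by rewrite !expr1 mulN1r scaleN1r rmorphN.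
by rewrite !expr0 mul1r scale1r.
Qed.

(** This isolates the multidegree that is -1 on G and 0 elsewhere: a cochain g above G becomes the
    family g F x^(F \ G), and a primitive is read back by taking the coefficients of these
    monomials. *)
Lemma koszul_to_restriction r :
  (forall i, (i < r)%N -> kvan xvar [set: 'I_n] (fun=> setT) (fun=> [set 0]) i) ->
  restriction_vanishing (@off k n D) r.
Proof.
move=> H G i hi; pose m := (i + #|G|)%N.
(* The link of G in this complex is the restriction of D to the complement of G; [kvan_above] then
   explains the shift of the degree by #|G|. *)
pose DG F := D (F :\: G).
have DGdown F F' : F \subset F' -> DG F' -> DG F.
  by move=> FF'; apply: Ddown; apply: finset.setSD.
have eDG F : F \subset ~: G -> shift_fam G (@off k n DG) F = @off k n D F.
  move=> FG; rewrite /shift_fam /off /DG finset.setDUl finset.setDv finset.set0U.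
  have -> // : F :\: G = F.
  apply/setP => l; rewrite inE; have [lF|] := boolP (l \in F); rewrite ?andbF //.
  by have := fintype.subsetP FG _ lF; rewrite inE => ->.
apply: kvan_ext (_ : kvan _ _ _ (shift_fam G (@off k n DG)) i) => //.
apply/kvan_above; first exact: mono_fam_off.
rewrite -/m => g Ug Jg.
have g0 F : #|F| = m -> ~~ (G \subset F) -> g F = 0.
  by move=> eF GF; have [|h //] := Ug F (finset.subsetT _) eF; rewrite (negPf GF).
pose c F : Q := pr (g F *: 'X_[mesym1 (F :\: G)]).
have Dsupp F : DG F -> D (mnm_support (mesym1 (F :\: G))).
  by rewrite mnm_support_mesym1.
have mesymD1 j F : j \in F -> j \notin G ->
    mesym1 (F :\: G) = (mesym1 ((F :\ j) :\: G) + U_(j))%MM.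
  move=> jF jG; apply/mnmP => l; rewrite mnmDE !mnmE !inE.
  by case: (eqVneq l j) => [->|]; rewrite ?jF ?jG ?addn0 ?andbT.
have kdc F : #|F| = m.+1 ->
    kd xvar c F = pr (kd (fun=> 1) g F *: 'X_[mesym1 (F :\: G)]).
  move=> eF; rewrite scaler_suml rmorph_sum; apply: eq_bigr => j jF.
  have eFj : #|F :\ j| = m by move: eF; rewrite (cardsD1 j) jF => -[].
  rewrite mulr1; have [GF|GF] := boolP (G \subset F :\ j); last first.
    by rewrite /c g0 // !(mulr0, scale0r, rmorph0).
  have jG : j \notin G.
    by apply: contraTN GF => jG; apply/negP => /fintype.subsetP/(_ _ jG); rewrite !inE eqxx.
  rewrite (mesymD1 j) // mpolyXD -scalerA /= -ksignQ -mulrA.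
  by congr (_ * _); rewrite /c -rmorphM mulrC -scalerAl.
have [F _ _|F _ eF|b [_ Jb]] := H m hi c => //.
  rewrite /= kdc //; apply/qproj_eq0.
  have [DF|nDF] := pselect (DG F).
    by rewrite (Jg F (finset.subsetT _) eF DF) scale0r rpred0.
  by apply: ideal_scale; apply/(SR_mpolyX _ Ddown); rewrite mnm_support_mesym1.
exists (fun F => if G \subset F then coefQ (mesym1 (F :\: G)) (b F) else 0).
split=> F _ eF; first by case: ifP => GF; [left|right].
move=> DF; have Du := Dsupp F DF; apply/eqP; rewrite subr_eq0; apply/eqP.
have [GF|GF] := boolP (G \subset F); last first.
  rewrite g0 // /kd big1 // => j jF; case: ifPn => [GFj|]; last by rewrite mulr0.
  by rewrite (fintype.subset_trans GFj (finset.subsetDl _ _)) in GF.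
have /eqP := Jb F (finset.subsetT _) eF; rewrite subr_eq0 => /eqP eb.
have -> : g F = coefQ (mesym1 (F :\: G)) (c F).
  by rewrite /c coefQ_proj // mcoeffZ mcoeffX eqxx mulr1.
rewrite eb coefQ_kd //; apply: eq_bigr => j jF; rewrite mulr1.
congr (_ * _); rewrite mnmE !inE jF andbT.
have [jG|jG] /= := boolP (j \in G).
  rewrite ifF //; apply/negP => /fintype.subsetP/(_ _ jG).
  by rewrite !inE eqxx.
rewrite (mesymD1 j) // addmK ifT //.
apply/fintype.subsetP => l lG; rewrite !inE (fintype.subsetP GF) // andbT.
by apply: contraNneq jG => <-.
Qed.

(** Level N holds the monomials x^u in position F with mdeg u + #|~: F| < N. Passing from F :\ j to
    F multiplies by one variable and shrinks the complement by one, so the differential preserves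
    levels. *)
Definition face_level N F : set Q := degQ (N - #|~: F|).

Lemma restriction_to_graded r : restriction_vanishing (@off k n D) r ->
  forall N i, (i < r)%N ->
  kvan xvar [set: 'I_n] (face_level N.+1) (face_level N) i.
Proof.
move=> H N i hi c Uc Jc.
(* Multidegrees are translated by one in every coordinate to stay in the natural numbers: x^u in
   position F belongs to v = u + mesym1 (~: F). Then [sh v F] recovers u, which exists only if F
   contains [Z v]. *)
pose Z v : {set 'I_n} := [set j | v j == 0%N]%SET.
pose sh v F := (v - mesym1 (~: F))%MM.
pose Dv v F := D (mnm_support (sh v F)).
have Dvdown v F F' : F \subset F' -> Dv v F' -> Dv v F.
  move=> FF'; apply: Ddown; apply/fintype.subsetP => j.
  rewrite !inE !mnmBE !mnmE !inE; have := fintype.subsetP FF' j.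
  by case: (j \in F); case: (j \in F') => // h; rewrite ?h //; lia.
have mDv v := @mono_fam_off k n _ (Dvdown v).
have vanish v : kvan (fun=> 1) [set: 'I_n] (above (Z v)) (@off k n (Dv v)) i.
  have [ltiZ|leZi] := ltnP i #|Z v|; first exact: kvan_above_lt.
  rewrite -(subnK leZi) kvan_above //.
  (* A coordinate with v j > 1 stays in the support of [sh v F] for every F and is a cone point.
     Without such a coordinate the support of [sh v (Z v :|: F)] is F, which gives the restriction
     of D to the complement of [Z v]. *)
  pose W : {set 'I_n} := [set j | (1 < v j)%N]%SET.
  have [W0|[j jW]] := set_0Vmem W.
    have hr : (i - #|Z v| + #|Z v| < r)%N by rewrite subnK.
    apply: kvan_ext (H _ _ hr) => // F FZ; rewrite /shift_fam /off /Dv.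
    suff -> : mnm_support (sh v (Z v :|: F)) = F by [].
    apply/setP => l; have : l \in W = false by rewrite W0 inE.
    have := fintype.subsetP FZ l; rewrite !inE mnmBE mnmE !inE.
    by case: (l \in F) => [/(_ isT)|_]; case: (v l) => [|[|x]].
  have jZ : j \in ~: Z v by move: jW; rewrite !inE; case: (v j).
  rewrite -(finset.setD1K jZ); apply: kvan_acyclic => //.
  - by rewrite !inE eqxx.
  - by apply: mono_fam_stable; apply: mono_fam_shift.
  move=> F _; rewrite /shift_fam /off /Dv.
  suff -> : mnm_support (sh v (Z v :|: (j |: F))) = mnm_support (sh v (Z v :|: F)) by [].
  apply/setP => l; rewrite !inE !mnmBE !mnmE !inE.
  case: (eqVneq l j) => [->|] //=; move: jW; rewrite inE.
  by case: (v j) => [|[|x]] //; rewrite ?orbT; case: (_ || _).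
pose g v F := if Z v \subset F then coefQ (sh v F) (c F) else 0.
have shU v F j : j \in F -> (sh v F - U_(j))%MM = sh v (F :\ j).
  move=> jF; apply/mnmP => l; rewrite !mnmBE mnm1E !mnmE !inE.
  by case: (eqVneq l j) => [->|ne] /=; rewrite ?jF ?eqxx ?(eq_sym j l) ?(negPf ne) ?subn0.
have sh0 v F j : j \in F -> (sh v F j == 0%N) = (j \in Z v).
  by move=> jF; rewrite mnmBE mnmE !inE jF subn0.
have shdeg v F : Z v \subset F -> (mdeg (sh v F) + #|~: F|)%N = mdeg v.
  move=> ZF; rewrite -mdeg_mesym1 -mdegD submK //; apply/mnm_lepP => j.
  rewrite mnmE inE; have := fintype.subsetP ZF j; rewrite inE.
  by case: (j \in F) => //=; case: (v j) => // /(_ isT).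
have kdg v F : Z v \subset F -> Dv v F ->
    kd (fun=> 1) (g v) F = coefQ (sh v F) (kd xvar c F).
  move=> ZF DF; rewrite coefQ_kd //; apply: eq_bigr => j jF; rewrite mulr1.
  congr (_ * _); rewrite sh0 // shU // /g finset.subsetD1 ZF /=.
  by case: (j \in Z v).
have /choice [B HB] : forall v, exists b, mdeg v = N ->
  (forall F, (#|F|.+1 = i)%N -> above (Z v) F (b F)) /\
  (forall F, #|F| = i -> @off k n (Dv v) F (g v F - kd (fun=> 1) b F)).
  move=> v; have [vN|vN] := pselect (mdeg v = N); last by exists (fun=> 0).
  have [F _ eF|F _ eF|b [Ub Jb]] := vanish v (g v).
  - by rewrite /g; case: ifP => ZF; [left|right].
  - move=> DF; have [ZF|ZF] := boolP (Z v \subset F); last first.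
      rewrite /kd big1 // => j jF; rewrite /g finset.subsetD1 (negPf ZF) /=.
      by rewrite mulr0.
    rewrite kdg //; apply: Jc => //.
    by rewrite -vN -(shdeg _ _ ZF) addnK.
  by exists b => _; split=> F; [apply: Ub|apply: Jb].
(* The primitives found in the separate multidegrees v of total degree N are collected into one
   polynomial per position. *)
pose E F u := if (mdeg u + #|~: F|)%N == N then B (u + mesym1 (~: F))%MM F else 0.
pose b F : Q := pr (\sum_(u : 'X_{1..n < N.+1}) E F u *: 'X_[u]).
have coefb F u : D (mnm_support u) -> coefQ u (b F) = E F u.
  move=> Du; rewrite coefQ_proj //; have [uN|uN] := ltnP (mdeg u) N.+1.
    exact: mcoeff_mpoly.
  have -> : E F u = 0 by rewrite /E ifF //; apply/negP => /eqP; lia.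
  rewrite raddf_sum big1 // => w _ /=; rewrite mcoeffZ mcoeffX.
  case: eqP => [e|]; last by rewrite mulr0.
  by have := bmdeg w; rewrite e ltnNge uN.
exists b; split=> F _ eF u Du uN.
  rewrite coefb // /E; case: eqP => // e; lia.
rewrite coefQB // coefQ_kd //.
pose v := (u + mesym1 (~: F))%MM.
have dv : mdeg v = (mdeg u + #|~: F|)%N by rewrite mdegD mdeg_mesym1.
have shv : sh v F = u by rewrite /sh /v addmK.
have [e|ne] := eqVneq (mdeg v) N; last first.
  rewrite (Uc F) //; last by move: uN ne; rewrite dv; lia.
  rewrite sub0r big1 ?oppr0 // => j jF; case: ifPn => uj; first by rewrite mulr0.
  rewrite coefb; last first.
    by apply: Ddown Du; apply/fintype.subsetP => l; rewrite !inE mnmBE; lia.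
  rewrite /E ifF ?mulr0 //; apply/negP => /eqP e; move/eqP: ne; apply.
  have : (#|~: (F :\ j)| = #|~: F|.+1)%N.
    have -> : ~: (F :\ j) = j |: ~: F.
      by apply/setP => l; rewrite !inE negb_and negbK.
    by rewrite cardsU1 !inE jF.
  rewrite -e dv => ->; rewrite addnS -addSn; congr (_ + _)%N.
  by rewrite -{1}(submK (m := U_(j)) (m' := u)) ?lep1mP // mdegD mdeg1 addn1.
have [Ub Jb] := HB v e.
have ZF : Z v \subset F.
  apply/fintype.subsetP => j; rewrite inE mnmDE mnmE inE.
  by case: (j \in F) => //; rewrite addn1.
have := Jb F eF; rewrite /off /= /Dv shv => /(_ Du).
rewrite /g ZF shv => h; rewrite -[RHS]h; congr (_ - _); apply: eq_bigr => j jF; rewrite mulr1.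
congr (_ * _).
have ujZ : (u j == 0%N) = (j \in Z v) by rewrite -(sh0 v F) // shv.
case: ifPn => uj.
  have eFj : (#|F :\ j|.+1 = i)%N by rewrite -eF (cardsD1 j F) jF.
  have [] := Ub _ eFj; last by [].
  by rewrite finset.subsetD1 -ujZ uj andbF.
rewrite coefb; last first.
  by apply: Ddown Du; apply/fintype.subsetP => l; rewrite !inE mnmBE; lia.
have eC : mesym1 (~: (F :\ j)) = (mesym1 (~: F) + U_(j))%MM.
  apply/mnmP => l; rewrite mnmDE mnm1E !mnmE !inE.
  by case: (eqVneq l j) => [->|ne] /=; rewrite ?jF ?eqxx ?(eq_sym j l) ?(negPf ne) ?addn0.
have eu : (u - U_(j) + mesym1 (~: (F :\ j)))%MM = v.
  by rewrite eC addmC -addmA [X in (_ + X)%MM]addmC submK ?lep1mP // addmC.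
rewrite /E eu -mdeg_mesym1 -mdegD eu e eqxx //.
Qed.

End FaceRing.

(** * Filtered Koszul complexes *)

Section FilteredKoszul.
Variables (R : comPzRingType) (m : nat) (z : 'I_m -> R) (e : 'I_m -> nat).
Variable B : nat -> set R.
Implicit Types (A F : {set 'I_m}) (j l : 'I_m) (M N i r : nat) (x y g : R).

(** Level 0 is the zero module and must not be shifted; a level M > 0 stands for degrees at most M -
    1. *)
Definition raise M a : nat := if M is 0 then 0 else (M + a)%N.

Definition filt_deg a g : Prop := forall M y, B M y -> B (raise M a) (g * y).

Hypothesis B0 : forall M, B M 0.
Hypothesis BB : forall M x y, B M x -> B M y -> B M (x - y).
Hypothesis Ble : forall M N y, (M <= N)%N -> B M y -> B N y.
Hypothesis Bz : forall j, filt_deg (e j) (z j).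
Hypothesis Bzero : forall y, B 0 y -> y = 0.
Hypothesis Bex : forall y, exists M, B M y.

Definition weight A : nat := (\sum_(j in A) e j)%N.

(* The truncated subtraction gives the zero module when N < weight (~: F). *)
Definition klevel N F : set R := B (N - weight (~: F)).

Lemma weightC_U1 j F : j \notin F ->
  weight (~: F) = (e j + weight (~: (j |: F)))%N.
Proof.
move=> jF; rewrite /weight (bigD1 j) ?inE //=; congr (_ + _)%N.
by apply: eq_bigl => l; rewrite !inE negb_or andbC.
Qed.

(** Hence the family U' of the cone sequence is again a level of the same complex, and [z j] acts on
    graded cohomology with degree [e j]. *)
Lemma klevelU1 N j F : j \notin F -> klevel N (j |: F) = klevel (N + e j) F.
Proof.
by move=> jF; rewrite /klevel (weightC_U1 jF); congr B; rewrite [(N + _)%N]addnC subnDl.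
Qed.

Lemma klevel_stable N : kstable z (klevel N).
Proof.
split=> [F|F x y|j F x jF]; [exact: B0|exact: BB|].
rewrite klevelU1 // /klevel => /(Bz j) h; apply: Ble h; rewrite /raise; move: (weight _) => w.
case eM: (N - w)%N => //; lia.
Qed.

Lemma klevel_mul N F a g y : filt_deg a g -> klevel N F y -> klevel (N + a) F (g * y).
Proof.
rewrite /klevel => ga /ga h; apply: Ble h; rewrite /raise; move: (weight _) => w.
by case eM: (N - w)%N => //; lia.
Qed.

Definition graded_vanishing A i : Prop :=
  forall N, kvan z A (klevel N.+1) (klevel N) i.

Lemma notin_subset j A F : j \notin A -> F \subset A -> j \notin F.
Proof. by move=> jA FA; apply: contraNN jA; apply: fintype.subsetP. Qed.

Lemma kvan_klevelU1 j A i N : j \notin A ->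
  kvan z A (fun F => klevel N.+1 (j |: F)) (fun F => klevel N (j |: F)) i <->
  kvan z A (klevel (N + e j).+1) (klevel (N + e j)) i.
Proof.
move=> jA; split; apply: kvan_ext => F FA;
  by rewrite klevelU1 ?(notin_subset jA) // addSn.
Qed.

Lemma graded_vanishing_add j A r : j \notin A ->
  (forall i, (i < r)%N -> graded_vanishing A i) ->
  forall i, (i < r)%N -> graded_vanishing (j |: A) i.
Proof.
move=> jA H [|i] hi N.
  by apply: kvan_cone0 => //; apply: H.
apply: kvan_cone => //; try exact: klevel_stable; first exact: H.
by apply/kvan_klevelU1 => //; apply: H; apply: ltnW.
Qed.

(** Each [z l] with l in [A] is null-homotopic on the complex over [A], and h lowers the degree, so
    [z j ^+ K] acts as zero on the graded cohomology. Vanishing over [j |: A] makes [z j] injective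
    there, so that cohomology is zero. *)
Lemma graded_vanishing_remove j A r K (g : 'I_m -> R) (h : R) : j \notin A ->
  z j ^+ K = \sum_(l in A) g l * z l + h ->
  (forall l, l \in A -> g l = 0 \/ (e l <= K * e j)%N /\ filt_deg (K * e j - e l) (g l)) ->
  (forall M y, B M.+1 y -> B (M + K * e j) (h * y)) ->
  (forall i, (i < r)%N -> graded_vanishing (j |: A) i) ->
  forall i, (i < r)%N -> graded_vanishing A i.
Proof.
move=> jA ezK Hg Hh H i hi N u Uu Ju.
(* If [z j ^+ s] times the cocycle is a boundary s * e j degrees higher, cancelling one factor at a
   time by injectivity makes the cocycle itself a boundary. *)
have descent s : forall b,
    (forall F, F \subset A -> #|F|.+1 = i -> klevel (N + s * e j).+1 F (b F)) ->
    (forall F, F \subset A -> #|F| = i ->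
       klevel (N + s * e j) F (z j ^+ s * u F - kd z b F)) ->
  exists b, (forall F, F \subset A -> #|F|.+1 = i -> klevel N.+1 F (b F)) /\
    (forall F, F \subset A -> #|F| = i -> klevel N F (u F - kd z b F)).
  elim: s => [|s IH] b Ub Jb.
    exists b; split=> F FA eF; first by have := Ub F FA eF; rewrite mul0n addn0.
    by have := Jb F FA eF; rewrite mul0n addn0 expr0 mul1r.
  have zs : filt_deg (s * e j) (z j ^+ s).
    elim: s {IH Ub Jb} => [|s IH] M y By; first by rewrite expr0 mul1r; apply: Ble By; rewrite /raise; case: (M) => // M'; lia.
    by rewrite exprS -mulrA; apply: Ble (Bz j (IH _ _ By)); rewrite /raise; case: (M) => //= M'; lia.
  have [||||b' [Ub' Jb']] := @kvan_cone_inj _ _ z A j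
      (klevel (N + s * e j).+1) (klevel (N + s * e j)) jA (klevel_stable _) (klevel_stable _) i
      (H i hi _) (fun F => z j ^+ s * u F) b; last exact: IH b' Ub' Jb'.
  - by move=> F FA eF; rewrite -addSn; apply: klevel_mul => //; apply: Uu.
  - by move=> F FA eF; rewrite kdZ; apply: klevel_mul => //; apply: Ju.
  - move=> F FA eF; rewrite klevelU1 ?(notin_subset jA) //.
    by have := Ub F FA eF; rewrite mulSnr addnA.
  - move=> F FA eF; rewrite klevelU1 ?(notin_subset jA) //.
    by have := Jb F FA eF; rewrite mulSnr addnA mulrA exprS.
(* The null-homotopies of the [z l], combined with the coefficients g l, give the primitive of
   [z j ^+ K] times the cocycle. *)
have /choice [c Hc] := kd_contract z ^~ u.
apply: (descent K (fun F => \sum_(l in A) g l * c l F)) => F FA eF.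
  apply: (kstable_sum (klevel_stable _)) => l lA.
  have [c0 [cs _]] := Hc l; have [lF|lF] := boolP (l \in F).
    by rewrite c0 // mulr0; apply: B0.
  rewrite cs //; case: (Hg l lA) => [->|[le ga]]; first by rewrite mul0r; apply: B0.
  have : klevel (N.+1 + e l) F (kslice l u F).
    rewrite -klevelU1 //; apply: kstable_sign (klevel_stable _) _; apply: Uu.
      by rewrite finset.subUset finset.sub1set lA.
    by rewrite cardsU1 lF.
  by move/(klevel_mul ga); rewrite -addnA subnKC // addSn.
have -> : kd z (fun F => \sum_(l in A) g l * c l F) F = \sum_(l in A) g l * kd z (c l) F.
  rewrite /kd (eq_bigr _ (fun l _ => mulr_sumr _ _ _ _)) exchange_big /=.
  by apply: eq_bigr => l _; rewrite mulr_sumr; apply: eq_bigr => t _; ring.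
rewrite ezK mulrDl mulr_suml addrAC -sumrB.
apply: kstableD (klevel_stable _) _ _; last first.
  have := Uu F FA eF; rewrite /klevel; move: (weight _) => w.
  case ew: (N.+1 - w)%N => [|M]; first by move=> /Bzero->; rewrite mulr0.
  by move/Hh => hh; apply: Ble hh; lia.
apply: (kstable_sum (klevel_stable _)) => l lA.
rewrite -mulrA -mulrBr; have [_ [_ ->]] := Hc l.
case: ifPn => lF; first by rewrite mulr0; apply: B0.
case: (Hg l lA) => [->|[le ga]]; first by rewrite mul0r; apply: B0.
have : klevel (N + e l) F (ksign R l F * kd z u (l |: F)).
  rewrite -klevelU1 //; apply: kstable_sign (klevel_stable _) _; apply: Ju.
    by rewrite finset.subUset finset.sub1set lA.
  by rewrite cardsU1 lF eF.
by move/(klevel_mul ga); rewrite -addnA subnKC.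
Qed.

(* Graded Nakayama: z j acts surjectively on a cohomology graded in degrees
   bounded below, while raising the degree. *)
Lemma graded_vanishing_nakayama j A i : j \notin A -> (0 < e j)%N ->
  graded_vanishing (j |: A) i.+1 -> graded_vanishing A i.
Proof.
move=> jA ej H N; have [r] := ubnP N; elim: r N => // r IH N ltN.
have [leN|ltej] := leqP N.+1 (e j).
  apply: kvan_trivial; try exact: klevel_stable.
  move=> F FA _ y; rewrite /klevel (weightC_U1 (notin_subset jA FA)).
  suff -> : (N.+1 - (e j + weight (~: (j |: F))))%N = 0%N by move/Bzero->; apply: B0.
  by apply/eqP; rewrite subn_eq0; apply: leq_trans leN (leq_addr _ _).
rewrite -(subnK (_ : e j <= N)%N) //; apply/kvan_klevelU1 => //.
apply: kvan_fiber => //; try exact: klevel_stable.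
by apply: IH; lia.
Qed.

(** The filtration is exhaustive and starts at zero, so a cocycle lies in some level and is pushed
    down one level at a time by subtracting coboundaries. *)
Lemma graded_vanishing_exact A i : graded_vanishing A i ->
  kvan z A (fun=> setT) (fun=> [set 0]) i.
Proof.
move=> H c _ zc.
have [N HN] : exists N, forall F, klevel N F (c F).
  have /choice [M HM] := fun F => Bex (c F).
  exists (\sum_F (M F + weight (~: F)))%N => F; apply: Ble (HM F).
  by rewrite leq_subRL (bigD1 F) //=; lia.
suff [b hb] : exists b, forall F, F \subset A -> #|F| = i -> c F - kd z b F = 0.
  by exists b.
have {HN} HN F : F \subset A -> #|F| = i -> klevel N F (c F) by [].
elim: N c zc HN => [|N IH] c zc HN.
  exists (fun=> 0) => F FA eF; rewrite kd0 subr0.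
  by apply: Bzero; have := HN F FA eF; rewrite /klevel sub0n.
have [F FA eF|F FA eF|b [_ Jb]] := H N c; first exact: HN.
  by rewrite (zc F FA eF); apply: B0.
have [F FA eF|F FA eF|b' Hb'] := IH (fun F => c F - kd z b F).
- by rewrite kdB kd_kd subr0; apply: zc.
- exact: Jb.
by exists (fun F => b F + b' F) => F FA eF; rewrite kdD opprD addrA Hb'.
Qed.

End FilteredKoszul.

(** * From Koszul exactness to regular elements *)

Section KoszulRegular.
Variables (R : comPzRingType) (m : nat) (z : 'I_m -> R).
Implicit Types (A F : {set 'I_m}) (j l : 'I_m).

(** A relation expressing z j * y through the other z l is a cocycle in degree #|A|, with value y on
    [A]; a primitive evaluated at [A] writes y as a combination of those z l. *)
Lemma kvan_regular j A (y : R) (g : 'I_m -> R) : j \notin A ->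
  kvan z (j |: A) (fun=> setT) (fun=> [set 0]) #|A| ->
  z j * y = \sum_(l in A) g l * z l ->
  exists h : 'I_m -> R, y = \sum_(l in A) h l * z l.
Proof.
move=> jA H ey.
(* The value on A :\ l is g l with the sign that cancels in the differential, so that kd v A is the
   given combination. *)
pose v F := \sum_(l in A | F == A :\ l) ksign R l A * g l.
have [F _ _|F FA eF|b [_ /(_ A)]] := H (kglue j (fun=> y) v) => //.
  have -> : F = j |: A.
    by apply/eqP; rewrite eqEcard FA eF cardsU1 jA add1n leqnn.
  rewrite /= kd_glueU1 // ey /kd -sumrB big1 ?mulr0 // => l lA.
  rewrite /v (big_pred1 l) => [|t].
    transitivity (g l * z l * (1 - ksign R l A * ksign R l A)); first by ring.
    by rewrite ksign_sq subrr mulr0.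
  rewrite inE; apply/andP/eqP => [[tA /eqP/setP/(_ t)]|->] //.
  by rewrite !inE eqxx tA andbT => /negbFE/eqP.
rewrite finset.subsetUr => /(_ isT erefl) /eqP; rewrite subr_eq0 /kglue (negPf jA).
move/eqP=> ->; exists (fun l => ksign R l A * b (A :\ l)).
by apply: eq_bigr => l _; ring.
Qed.

(** The reindexing has to preserve the order, since the signs of the differential count smaller
    indices. *)
Lemma kvan_transfer m' (t : 'I_m' -> 'I_m) (U J : {set 'I_m} -> set R) i :
  (forall a b, (t a < t b)%N = (a < b)%N) ->
  kvan (z \o t) [set: 'I_m'] (fun G => U (t @: G)) (fun G => J (t @: G)) i ->
  kvan z (t @: [set: 'I_m']%SET) U J i.
Proof.
move=> tlt H c Uc Jc.
have tI : injective t.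
  by move=> a b eab; apply: ord_inj; case: (ltngtP a b) => //; rewrite -tlt eab ltnn.
have im F : F \subset t @: [set: 'I_m']%SET -> t @: (t @^-1: F) = F.
  move=> /fintype.subsetP FT; apply/setP => x; apply/imsetP/idP => [[a]|xF].
    by rewrite inE => aF ->.
  by have /imsetP[a _ xa] := FT _ xF; exists a; rewrite // inE -xa.
have card F : F \subset t @: [set: 'I_m']%SET -> #|t @^-1: F| = #|F|.
  by move=> /im {2}<-; rewrite card_imset.
have kdE c' (H' : {set 'I_m'}) :
      kd (z \o t) (fun G => c' (t @: G)) H' = kd z c' (t @: H').
  rewrite /kd big_imset /=; last by move=> a b _ _; apply: tI.
  apply: eq_bigr => a aH; congr (_ * _ * c' _).
    rewrite /ksign; congr (_ ^+ _); rewrite -[LHS](card_imset _ tI).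
    congr #|pred_of_set _|; apply/setP => x; rewrite inE; apply/imsetP/andP.
      by move=> [b]; rewrite inE => /andP[bH ba] ->; rewrite mem_imset ?tlt.
    by move=> [/imsetP[b bH ->]]; rewrite tlt => ba; exists b; rewrite ?inE ?bH.
  apply/setP => x; rewrite !inE; apply/imsetP/andP.
    move=> [b]; rewrite !inE => /andP[ba bH] ->.
    by rewrite (inj_eq tI) ba mem_imset.
  move=> [xa /imsetP[b bH ex]]; exists b => //; rewrite !inE bH andbT.
  by apply: contraNneq xa => <-; rewrite ex.
have sub (G : {set 'I_m'}) : t @: G \subset t @: [set: 'I_m']%SET by apply: imsetS; apply/fintype.subsetP => x _; rewrite inE.
have [F _ eF|F _ eF|b [Ub Jb]] := H (fun G => c (t @: G)).
- by apply: Uc; rewrite ?card_imset.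
- by rewrite kdE; apply: Jc; rewrite ?card_imset.
exists (fun F => b (t @^-1: F)); split=> F FT eF.
  by rewrite -{1}(im F FT); apply: Ub; rewrite ?finset.subsetT ?card.
have := Jb (t @^-1: F) (finset.subsetT _); rewrite card // im // => /(_ eF).
suff -> : kd z (fun F => b (t @^-1: F)) F = kd (z \o t) b (t @^-1: F) by [].
rewrite -{1}(im F FT) -kdE; apply: kd_ext => a _; congr b; apply/setP => x.
by rewrite inE mem_imset.
Qed.

End KoszulRegular.

Section GradedVanishingSets.
Variables (R : comPzRingType) (m : nat) (z : 'I_m -> R) (e : 'I_m -> nat).
Variable B : nat -> set R.
Hypothesis B0 : forall M, B M 0.
Hypothesis BB : forall M x y, B M x -> B M y -> B M (x - y).
Hypothesis Ble : forall M N y, (M <= N)%N -> B M y -> B N y.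
Hypothesis Bz : forall j, filt_deg B (e j) (z j).

Lemma graded_vanishing_superset (A C : {set 'I_m}) r : A \subset C ->
  (forall i, (i < r)%N -> graded_vanishing z e B A i) ->
  forall i, (i < r)%N -> graded_vanishing z e B C i.
Proof.
have [s] := ubnP #|C :\: A|; elim: s A => // s IH A ltCA AC H.
have [CA|[j]] := set_0Vmem (C :\: A).
  suff -> : C = A by [].
  by apply/eqP; rewrite finset.eqEsubset AC -finset.setD_eq0 CA eqxx.
rewrite inE => /andP[jA jC]; apply: (IH (j |: A)).
- move: ltCA; rewrite (cardsD1 j) inE jA jC add1n ltnS; apply: leq_trans.
  rewrite ltnS; apply: subset_leq_card; apply/fintype.subsetP => l.
  by rewrite !inE negb_or andbA.
- by rewrite finset.subUset finset.sub1set jC.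
- exact: graded_vanishing_add.
Qed.

End GradedVanishingSets.

(** * Symmetric functions as a regular sequence *)

Section RegularSequenceOfParameters.
Variables (k : fieldType) (n : nat) (D : set {set 'I_n}).
Hypothesis Ddown : forall F F' : {set 'I_n}, F \subset F' -> D F' -> D F.
Variable d : nat.
Hypothesis Dd : forall F, D F -> (#|F| <= d)%N.
Hypothesis Dvan : restriction_vanishing (@off k n D) d.
Local Notation S := {mpoly k[n]}.
Local Notation Q := (stanley_reisner_ring k D).
Local Notation pr := (qproj (stanley_reisner_ideal k D)).
Variables (p : 'I_n -> S) (q : nat).
Hypotheses (q0 : (0 < q)%N) (pq : forall j, (msize (p j - 'X_j ^+ q) <= q)%N).

Lemma msize_p j : (msize (p j) <= q.+1)%N.
Proof.
rewrite -[p j](subrK ('X_j ^+ q)); apply: msizeD_leq; last exact: msizeXn.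
exact: leq_trans (pq j) (leqnSn _).
Qed.

Lemma msize_prodB (s : seq 'I_n) :
  (msize (\prod_(l <- s) p l) <= (q * size s).+1)%N /\
  (msize (\prod_(l <- s) 'X_l ^+ q - \prod_(l <- s) p l) <= q * size s)%N.
Proof.
elim: s => [|j s [IH1 IH2]]; first by rewrite !big_nil subrr mmeasure0 msize1.
rewrite !big_cons /= mulnS; split; first exact: msizeM_leq (msize_p j) IH1.
have -> : 'X_j ^+ q * \prod_(l <- s) 'X_l ^+ q - p j * \prod_(l <- s) p l =
    'X_j ^+ q * (\prod_(l <- s) 'X_l ^+ q - \prod_(l <- s) p l)
    - (p j - 'X_j ^+ q) * \prod_(l <- s) p l by ring.
apply: msizeD_leq; first by rewrite mulrC addnC; apply: msizeM_lt IH2 (msizeXn _ _ _).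
by rewrite mmeasureN; apply: msizeM_lt (pq j) IH1.
Qed.

(** The elementary symmetric polynomial of degree i + 1: parameters are numbered from 0. *)
Definition esymS (v : 'I_n -> S) (i : nat) : S :=
  \sum_(J : {set 'I_n} | #|J| == i.+1) \prod_(l in J) v l.
Definition param (i : nat) : Q := pr (esymS p i).

Lemma msize_esymS i : (msize (esymS p i) <= (q * i.+1).+1)%N.
Proof.
apply: msize_sum_leq => J /eqP cJ; rewrite -big_enum /=.
by apply: leq_trans (msize_prodB _).1 _; rewrite -cardE cJ.
Qed.

Lemma msize_esymSB i :
  (msize (esymS (fun l => 'X_l ^+ q)%R i - esymS p i) <= q * i.+1)%N.
Proof.
rewrite -sumrB; apply: msize_sum_leq => J /eqP cJ; rewrite -!big_enum /=.
by apply: leq_trans (msize_prodB _).2 _; rewrite -cardE cJ.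
Qed.

Lemma esymS_big i : (d <= i)%N -> pr (esymS (fun l => 'X_l ^+ q) i) = 0.
Proof.
move=> di; rewrite rmorph_sum big1 // => J /eqP cJ; apply/qproj_eq0.
have -> : \prod_(l in J) 'X_l ^+ q = 'X_[mesym1 J *+ q] :> S.
  by rewrite prodrXl -mpolyXn -xprod_mesym1.
apply/(SR_mpolyX _ Ddown) => DJ.
have /Dd : D J.
  apply: Ddown DJ; apply/fintype.subsetP => l lJ.
  by rewrite inE mulmnE mnmE lJ mul1n -lt0n.
by rewrite cJ leqNgt ltnS di.
Qed.

(* The polynomial with roots x_l^q vanishes at x_j^q. *)
Lemma xvar_pow j : xvar k D j ^+ (q * n) =
  \sum_(i < d) (if (i < n)%N then (-1) ^+ i * xvar k D j ^+ (q * (n - i.+1)) else 0)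
     * pr (esymS (fun l => 'X_l ^+ q) i).
Proof.
have : \prod_(l : 'I_n) ('X_j ^+ q - 'X_l ^+ q) = 0 :> S.
  by rewrite (bigD1 j) //= subrr mul0r.
under eq_bigr do rewrite addrC.
rewrite bigA_distr (eq_bigr (fun J : {set 'I_n} => (-1) ^+ #|J| *
   ((\prod_(l in J) 'X_l ^+ q) * 'X_j ^+ (q * (n - #|J|))))); last first.
  move=> J _; rewrite (bigID (mem J)) /= mulrA.
  rewrite (eq_bigr (fun l => - 'X_l ^+ q)) => [|l ->] //; rewrite prodrN.
  congr (_ * _); rewrite (eq_bigr (fun=> 'X_j ^+ q)) => [|l /negPf->] //.
  rewrite prodr_const -exprM; congr (_ ^+ (_ * _)).
  by have := cardC (mem J); rewrite card_ord => /(congr1 (subn^~ #|J|)) <-; rewrite addKn.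
rewrite (bigD1 finset.set0) //= cards0 expr0 mul1r big_set0 mul1r subn0.
move/eqP; rewrite addr_eq0 => /eqP eX.
rewrite /xvar -rmorphXn eX -sumrN.
rewrite (eq_bigr (fun J : {set 'I_n} => (-1) ^+ #|J|.-1 *
   ((\prod_(l in J) 'X_l ^+ q) * 'X_j ^+ (q * (n - #|J|))))); last first.
  move=> J; rewrite -cards_eq0; case: #|J| => // a _.
  by rewrite exprS mulN1r mulNr opprK.
rewrite (eq_bigr (fun J : {set 'I_n} => \sum_(i < n | #|J| == i.+1) (-1) ^+ #|J|.-1 *
   ((\prod_(l in J) 'X_l ^+ q) * 'X_j ^+ (q * (n - #|J|))))); last first.
  move=> J; rewrite -cards_eq0; case cJ: #|J| => [//|a] _.
  have an : (a < n)%N by rewrite -cJ; have := max_card (mem J); rewrite card_ord.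
  by rewrite [RHS](big_pred1 (Ordinal an)) // => i; rewrite eqSS -val_eqE eq_sym.
rewrite (exchange_big_dep predT) //= rmorph_sum.
pose T i := pr ((-1) ^+ i * (esymS (fun l => 'X_l ^+ q) i * 'X_j ^+ (q * (n - i.+1)))).
transitivity (\sum_(i < n) T i).
  apply: eq_bigr => i _; congr pr; rewrite /esymS mulr_suml mulr_sumr.
  apply: congr_big => // [J|J /andP[_ /eqP->]] //.
  by rewrite -cards_eq0; case: eqP => [->|]; rewrite ?andbF.
pose T' i := (if (i < n)%N then (-1) ^+ i * xvar k D j ^+ (q * (n - i.+1)) else 0)
     * pr (esymS (fun l => 'X_l ^+ q) i).
rewrite -[RHS]/(\sum_(i < d) T' i).
(* No inequality between n and d is available, so both sums are widened to n + d. Terms with i >= d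
   vanish by [esymS_big], and those with i >= n have coefficient 0 by definition. *)
rewrite (big_ord_widen (n + d)%N T) ?leq_addr // (big_ord_widen (n + d)%N T') ?leq_addl //.
rewrite big_mkcond [RHS]big_mkcond; apply: eq_bigr => i _; rewrite /T /T'.
case: ifPn => _; last by rewrite mul0r; case: ifP.
case: ifPn => id.
  by rewrite !rmorphM !rmorphXn rmorphN1 /= /xvar; ring.
by rewrite !rmorphM /= esymS_big ?mul0r ?mulr0 // leqNgt.
Qed.

Let z (t : 'I_(n + d)) : Q :=
  match split t with inl j => xvar k D j | inr i => param i end.
Let e (t : 'I_(n + d)) : nat :=
  match split t with inl j => 1 | inr i => (q * i.+1)%N end.

Let zl j : z (lshift d j) = xvar k D j.
Proof. by rewrite /z (unsplitK (inl j)). Qed.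
Let zr i : z (rshift n i) = param i.
Proof. by rewrite /z (unsplitK (inr i)). Qed.
Let el j : e (lshift d j) = 1%N.
Proof. by rewrite /e (unsplitK (inl j)). Qed.
Let er i : e (rshift n i) = (q * i.+1)%N.
Proof. by rewrite /e (unsplitK (inr i)). Qed.

Let B := @degQ k n D.
Let B0 M : B M 0. Proof. exact: degQ0. Qed.
Let BB M x y : B M x -> B M y -> B M (x - y). Proof. exact: degQB. Qed.
Let Ble M N y : (M <= N)%N -> B M y -> B N y. Proof. exact: degQ_le. Qed.
Let Bzero y : B 0 y -> y = 0. Proof. exact: degQ_zero. Qed.
Let Bex y : exists M, B M y.
Proof.
by have [f ->] := qprojP y; exists (msize f); apply/(degQP Ddown); exists f.
Qed.

Let filt_pr a (f : S) : (msize f <= a.+1)%N -> filt_deg B a (pr f).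
Proof. by move=> fa M y; apply: degQ_mul. Qed.

Let Bz t : filt_deg B (e t) (z t).
Proof.
rewrite -(splitK t); case: (split t) => [j|i] /=.
  by rewrite zl el; apply: filt_pr; rewrite msizeX mdeg1.
by rewrite zr er; apply: filt_pr; apply: msize_esymS.
Qed.

Let Ax : {set 'I_(n + d)} := (@lshift n d) @: [set: 'I_n]%SET.
Let Af : {set 'I_(n + d)} := (@rshift n d) @: [set: 'I_d]%SET.
Let GV := graded_vanishing z e B.

Let GVx i : (i < d)%N -> GV Ax i.
Proof.
(* The complement of a set of variables always contains all parameter indices; their total weight C
   shifts the levels, and below C every term is zero. *)
move=> hi N; pose C := (\sum_(i < d) e (rshift n i))%N.
have wE (F : {set 'I_n}) : weight e (~: ((@lshift n d) @: F)) = (#|~: F| + C)%N.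
  rewrite /weight big_mkcond big_split_ord /=; congr (_ + _)%N.
    rewrite -sum1_card [RHS]big_mkcond; apply: eq_bigr => j _.
    by rewrite !inE mem_imset ?el //; apply: lshift_inj.
  apply: eq_bigr => i' _; rewrite inE ifT //; apply/imsetP => -[j _ /eqP].
  by rewrite eq_rlshift.
have [CN|NC] := leqP C N; last first.
  apply: kvan_trivial => [|F|]; try exact: klevel_stable.
  move=> FA _ y; rewrite /klevel.
  have -> : F = (@lshift n d) @: ((@lshift n d) @^-1: F).
    apply/setP => t; apply/idP/imsetP => [tF|[j]]; last by rewrite inE => jF ->.
    have /imsetP[j _ et] := fintype.subsetP FA _ tF.
    by exists j; rewrite ?inE -?et.
  rewrite wE; set w := #|_|.
  suff -> : (N.+1 - (w + C))%N = 0%N by move/Bzero->.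
  by lia.
apply: kvan_transfer => //.
have -> : z \o @lshift n d = xvar k D by apply/funext => j; rewrite /= zl.
apply: kvan_ext (restriction_to_graded Ddown Dvan (N := (N - C)%N) hi) => F _; last first.
  by rewrite /klevel /face_level wE; congr degQ; lia.
by rewrite /klevel /face_level wE; congr degQ; lia.
Qed.

Let GVT i : (i < d)%N -> GV [set: 'I_(n + d)] i.
Proof.
exact: (graded_vanishing_superset B0 BB Ble Bz (finset.subsetT Ax) GVx).
Qed.

Let GV_remove (A : {set 'I_(n + d)}) i : Af \subset A -> (i < d)%N -> GV A i.
Proof.
have [s] := ubnP #|~: A|; elim: s A i => // s IH A i ltA AfA hi.
have [A0|[t]] := set_0Vmem (~: A).
  suff -> : A = [set: 'I_(n + d)]%SET by apply: GVT.
  by rewrite -[A]finset.setCK A0 finset.setC0.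
rewrite inE => tA.
have [j ej] : exists j, t = lshift d j.
  case: (splitP t) => [j ej|i' ei]; first by exists j; apply: ord_inj.
  have et : t = rshift n i' by apply: ord_inj.
  by rewrite (fintype.subsetP AfA) // et imset_f ?inE in tA.
(* The coefficients of [xvar_pow], applied to the actual parameters instead of the functions of the
   x_l^q. The resulting error [h] has degree less than q * n because the two kinds of symmetric
   functions share their leading forms. *)
pose g (t' : 'I_(n + d)) : Q := match split t' with
  | inl _ => 0
  | inr i => if (i < n)%N then (-1) ^+ i * xvar k D j ^+ (q * (n - i.+1)) else 0
  end.
have gr i' : g (rshift n i') =
    if (i' < n)%N then (-1) ^+ i' * xvar k D j ^+ (q * (n - i'.+1)) else 0.
  by rewrite /g (unsplitK (inr i')).
have gl j' : g (lshift d j') = 0 by rewrite /g (unsplitK (inl j')).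
have n0 : (0 < n)%N by apply: leq_trans (ltn_ord j).
pose h := xvar k D j ^+ (q * n) - \sum_(t' in A) g t' * z t'.
have sumA : \sum_(t' in A) g t' * z t' = \sum_(i < d) g (rshift n i) * param i.
  rewrite big_mkcond big_split_ord /= big1 ?add0r => [|j' _]; last first.
    by rewrite gl mul0r; case: ifP.
  by apply: eq_bigr => i' _; rewrite zr (fintype.subsetP AfA) // imset_f ?inE.
have hE : exists2 f, h = pr f & (msize f <= q * n)%N.
  exists (\sum_(i < d | (i < n)%N) ((-1) ^+ i * 'X_j ^+ (q * (n - i.+1))) *
      (esymS (fun l => 'X_l ^+ q)%R i - esymS p i)).
    rewrite /h sumA xvar_pow -sumrB rmorph_sum [RHS]big_mkcond /=.
    apply: eq_bigr => i' _; rewrite gr; case: ifP => _; last by rewrite !mul0r subr0.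
    by rewrite -mulrBr !rmorphM !rmorphXn rmorphN1 rmorphB.
  apply: msize_sum_leq => i' i'n; rewrite mulrC.
  have -> : (q * n = q * i'.+1 + q * (n - i'.+1))%N by rewrite -mulnDr subnKC.
  apply: msizeM_lt (msize_esymSB _) _; rewrite -signr_odd; case: odd.
    by rewrite expr1 mulN1r mmeasureN; apply: msizeXn.
  by rewrite expr0 mul1r; apply: msizeXn.
have jA : lshift d j \notin A by rewrite -ej.
apply: (@graded_vanishing_remove _ _ z e B B0 BB Ble Bz Bzero (lshift d j) A d
  (q * n)%N g h) => //.
- by rewrite zl /h addrC subrK.
- move=> t' _; rewrite el muln1 -(splitK t'); case: (split t') => [j'|i'] /=.
    by left; rewrite gl.
  rewrite gr er; case: ifP => i'n; last by left.
  right; split; first by rewrite leq_mul2l i'n orbT.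
  rewrite -mulnBr /xvar -rmorphXn -(rmorphN1 pr) -rmorphXn -rmorphM.
  apply: filt_pr; rewrite -signr_odd; case: odd.
    by rewrite expr1 mulN1r mmeasureN; apply: msizeXn.
  by rewrite expr0 mul1r; apply: msizeXn.
- move=> M y By; have [f -> fq] := hE; rewrite el muln1.
  have := @degQ_mul k n D Ddown M.+1 f (q * n).-1 y; rewrite prednK ?muln_gt0 ?q0 //.
  move=> /(_ fq By); congr degQ => /=.
  have : (0 < q * n)%N by rewrite muln_gt0 q0.
  by lia.
move=> i' hi'; apply: IH => //; last first.
  by apply: fintype.subset_trans AfA _; apply: finset.subsetUr.
move: ltA; rewrite (cardsD1 t) inE tA add1n ltnS; apply: leq_trans.
rewrite ltnS ej; apply: subset_leq_card; apply/fintype.subsetP => l.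
by rewrite !inE negb_or.
Qed.

Let As s : {set 'I_(n + d)} := [set t : 'I_(n + d) | (n <= t < n + s)%N]%SET.

Let As_sum (V : nmodType) s (G : 'I_(n + d) -> V) (sd : (s <= d)%N) :
  \sum_(t in As s) G t = \sum_(i < s) G (rshift n (widen_ord sd i)).
Proof.
rewrite big_mkcond big_split_ord /= big1 ?add0r => [|j _]; last first.
  by rewrite inE /= leqNgt ltn_ord.
rewrite -big_mkcond /= -[RHS](big_ord_narrow (F := fun i => G (rshift n i)) sd).
by apply: eq_bigl => i; rewrite inE /= leq_addr ltn_add2l.
Qed.

Let As_card s : (s <= d)%N -> #|As s| = s.
Proof.
by move=> sd; rewrite -sum1_card (As_sum (fun=> 1%N) sd) sum1_card card_ord.
Qed.

Let AsS s (sd : (s < d)%N) :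
  As s.+1 = rshift n (Ordinal sd) |: As s /\ rshift n (Ordinal sd) \notin As s.
Proof.
split; last by rewrite inE /= ltnn andbF.
by apply/setP => t; rewrite !inE -val_eqE /=; lia.
Qed.

(** Descending from all d parameters, each removal by the Nakayama step costs one degree, which
    leaves vanishing below s for s parameters. *)
Let GVs s i : (s <= d)%N -> (i < s)%N -> GV (As s) i.
Proof.
move=> sd; rewrite -(subKn sd); move: (d - s)%N => r; elim: r i => [|r IH] i.
  rewrite subn0 => hi; apply: GV_remove => //; apply/fintype.subsetP => t.
  by case/imsetP => i' _ ->; rewrite inE /= leq_addr ltn_add2l ltn_ord.
move=> hi; have rd : (d - r.+1 < d)%N by lia.
have [eA tA] := AsS rd.
apply: (@graded_vanishing_nakayama _ _ z e B B0 BB Ble Bz Bzero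
  (rshift n (Ordinal rd))) => //.
  by rewrite er muln_gt0 q0.
rewrite -eA; have -> : (d - r.+1).+1 = (d - r)%N by lia.
by apply: IH; lia.
Qed.

Lemma param_regular s (y : Q) (g : nat -> Q) : (s < d)%N ->
  param s * y = \sum_(i < s) g i * param i ->
  exists h : nat -> Q, y = \sum_(i < s) h i * param i.
Proof.
move=> sd ey; have [eA tA] := AsS sd.
have sd' := ltnW sd.
have G : GV (As s.+1) s by apply: GVs.
have K : kvan z (rshift n (Ordinal sd) |: As s) (fun=> setT) (fun=> [set 0]) #|As s|.
  by rewrite As_card // -eA; exact: (graded_vanishing_exact B0 Ble Bzero Bex G).
have [|h ->] := @kvan_regular _ _ z _ _ y (fun t => g (t - n)%N) tA K.
  rewrite zr ey (As_sum _ sd'); apply: eq_bigr => i _.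
  by rewrite zr /= addKn.
pose h' i := if insub i is Some i' then h (rshift n (i' : 'I_d)) else 0.
exists h'; rewrite (As_sum _ sd'); apply: eq_bigr => i _; rewrite zr /h'.
have id : (i < d)%N by apply: leq_trans (ltn_ord i) sd'.
by rewrite insubT /=; congr (h (rshift n _) * _); apply: val_inj.
Qed.

End RegularSequenceOfParameters.

(** * Regular sequences and chains of primes *)

Section RegularSequences.
Variable R : comPzRingType.
Implicit Types (s : seq R) (t : nat) (y : R).

Lemma generated_ideal_take_sub t s y :
  y \in generated_ideal [set` take t s] -> y \in generated_ideal [set` take t.+1 s].
Proof.
apply: generated_ideal_sub => x /= xs; apply: generated_ideal_mem => /=.
have [ts|st] := ltnP t (size s); last by move: xs; rewrite !take_oversize // ltnW.
by rewrite (take_nth 0 ts) mem_rcons inE xs orbT.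
Qed.

Lemma generated_ideal_takeS t s y : (t < size s)%N ->
  y \in generated_ideal [set` take t.+1 s] ->
  exists a, y - a * s`_t \in generated_ideal [set` take t s].
Proof.
move=> ts; rewrite (take_nth 0 ts) => /generated_ideal_seqP[g ->].
rewrite size_rcons big_ord_recr /= nth_rcons ltnn eqxx.
exists (g (size (take t s))); rewrite addrK; apply/generated_ideal_seqP; exists g.
by apply: eq_bigr => i _; rewrite nth_rcons ltn_ord.
Qed.

(** The induction proves vanishing modulo the first t elements of s, in as many degrees as elements
    remain. The next element y is null-homotopic, so y times a cocycle is a coboundary; correcting
    the primitive modulo y and cancelling y by regularity finishes. *)
Lemma regular_koszul n (x : 'I_n -> R) s : regular_sequence s ->
  (forall y, y \in s -> exists g : 'I_n -> R, y = \sum_j g j * x j) ->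
  forall i, (i < size s)%N ->
  kvan x [set: 'I_n] (fun=> setT) (fun=> [set 0]) i.
Proof.
move=> [_ reg] sx.
pose J t : set R := [set y | y \in generated_ideal [set` take t s]].
have J0 t : J t 0 by apply: rpred0.
have JB t a b : J t a -> J t b -> J t (a - b) by apply: rpredB.
have JM t a b : J t b -> J t (a * b) by move=> /= h; apply: idealMl.
have kJ t : kstable x (fun=> J t).
  by split=> // [F a b|j F a _]; [apply: JB|apply: JM].
suff main r : forall t i, (t + r <= size s)%N -> (i < r)%N ->
    kvan x [set: 'I_n] (fun=> setT) (fun=> J t) i.
  move=> i hi; apply: kvan_ext (main _ 0%N i (leqnn _) hi) => // F _.
  apply/seteqP; split=> y /=; last by move->; apply: J0.
  by rewrite /J /= take0 => /generated_ideal_seqP[g ->]; rewrite big_ord0.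
elim: r => // r IH t i tr hi c _ Jc.
have ts : (t < size s)%N by apply: leq_trans tr; rewrite addnS ltnS leq_addr.
set y := s`_t.
have [g ey] := sx y (mem_nth _ ts).
have /choice [bb Hbb] := kd_contract x ^~ c.
pose b (F : {set 'I_n}) := \sum_j g j * bb j F.
have kb (F : {set 'I_n}) : #|F| = i -> J t (y * c F - kd x b F).
  move=> eF; have -> : kd x b F = \sum_j g j * kd x (bb j) F.
    rewrite /kd (eq_bigr _ (fun l _ => mulr_sumr _ _ _ _)) exchange_big /=.
    by apply: eq_bigr => l _; rewrite mulr_sumr; apply: eq_bigr => u _; ring.
  rewrite ey mulr_suml -sumrB; apply: (kstable_sum (F := F) (kJ t)) => j _.
  rewrite -mulrA -mulrBr; apply: JM; have [_ [_ ->]] := Hbb j.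
  case: ifPn => jF; first exact: J0.
  apply: (kstable_sign (F := F) j F (kJ t)); apply: Jc; first exact: finset.subsetT.
  by rewrite cardsU1 jF eF.
case: i hi Jc kb => [|i] hi Jc kb.
  exists (fun=> 0); split=> // F _ eF; rewrite kd0 subr0.
  apply: (reg _ ts); have := kb F eF.
  by rewrite /kd (cards0_eq eF) big_set0 subr0.
have JS a : J t a -> J t.+1 a by apply: generated_ideal_take_sub.
(* Modulo y the primitive b is itself a cocycle, one degree lower, so the induction hypothesis for t
   + 1 applies to it. *)
have [|//|F _ eF|e [_ He]] := IH t.+1 i _ hi b; first by rewrite addSn -addnS.
  have -> : kd x b F = y * c F - (y * c F - kd x b F) by ring.
  apply: JB; last by apply: JS; apply: kb.
  rewrite mulrC; apply: JM; apply: generated_ideal_mem => /=.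
  by rewrite (take_nth 0 ts) mem_rcons inE eqxx.
have /choice [b' Hb'] : forall F : {set 'I_n}, exists a, #|F| = i -> J t (b F - kd x e F - a * y).
  move=> F; have [eF|] := pselect (#|F| = i); last by exists 0.
  have [a Ha] := generated_ideal_takeS ts (He F (finset.subsetT _) eF).
  by exists a.
exists b'; split=> // F _ eF; apply: (reg _ ts).
have -> : y * (c F - kd x b' F) = (y * c F - kd x b F) +
    (kd x (fun G => b G - kd x e G - b' G * y) F).
  have -> : kd x (fun G => b G - kd x e G - b' G * y) F =
      kd x b F - kd x (kd x e) F - kd x (fun G => y * b' G) F.
    by rewrite -!kdB; apply: kd_ext => j _; rewrite [b' _ * y]mulrC.
  by rewrite kd_kd kdZ; ring.
apply: (kstableD (F := F) (kJ t)); first exact: kb.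
apply: (kstable_kd (kJ t)) => j jF; apply: Hb'.
by move: eF; rewrite (cardsD1 j) jF => -[].
Qed.

End RegularSequences.

(** * Prime avoidance and an elementary form of Krull dimension *)

Section PrimeChains.
Variable R : comPzRingType.
Implicit Types (T : set R) (s : seq R) (x y v : R) (J P : ideal R).

Definition monoid_set T : Prop := T 1 /\ forall x y, T x -> T y -> T (x * y).

(* The elements y0^a0 (y1^a1 (... (ym^am (u + ym rm) ...) + y1 r1) + y0 r0) with
   u in T.  This monoid contains 0 exactly when there is no chain of primes
   P0 < ... < P(m+1) with yi in P(i+1) but not in Pi, and P(m+1) disjoint from T. *)
Fixpoint nested_monoid T s : set R :=
  if s is y :: s' then
    [set x | exists a r v, nested_monoid T s' v /\ x = y ^+ a * (v + y * r)]
  else T.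

Lemma nested_monoidP T s : monoid_set T -> monoid_set (nested_monoid T s).
Proof.
move=> mT; elim: s => //= y s [IH1 IHM]; split.
  by exists 0%N, 0, 1; split=> //; rewrite expr0 mul1r mulr0 addr0.
move=> _ _ [a [r [v [Tv ->]]]] [b [t [w [Tw ->]]]].
exists (a + b)%N, (r * w + v * t + y * r * t), (v * w); split; first exact: IHM.
by rewrite exprD; ring.
Qed.

(** Krull's argument: an ideal maximal among those containing J and disjoint from T is prime. *)
Lemma prime_ideal_avoiding T J : monoid_set T -> (forall x, T x -> x \notin J) ->
  exists P, [/\ prime_ideal P, {subset J <= P} & forall x, T x -> x \notin P].
Proof.
move=> [T1 TM] TJ.
pose good (A : ideal_set R) := (forall x, x \in J -> A x) /\ (forall x, T x -> ~ A x).
pose PX (A : set R) := exists2 B : ideal_set R, good B & A = B.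
pose X := {A : set R | PX A}.
have JA : exists2 B : ideal_set R, good B & [set x | x \in J] = B.
  unshelve eexists (@IdealSet R [set x | x \in J] _ _ _) => //=.
  - exact: rpred0.
  - by move=> x y; apply: rpredB.
  - by move=> a x hx; apply: idealMl.
  - by split=> // x Tx /= xJ; have := TJ x Tx; rewrite xJ.
pose le (A B : X) : bool := `[< sval A `<=` sval B >].
have [A Amax] : exists A : X, forall B, le A B -> B = A.
  apply: Zorn => [A|A B C|A B|F Ftot].
  - exact/asboolP.
  - by move=> /asboolP AB /asboolP BC; apply/asboolP; apply: subset_trans BC.
  - case: A B => [A HA] [B HB] /asboolP /= AB /asboolP /= BA.
    have eAB : A = B by apply/seteqP.
    by rewrite eAB in HA *; rewrite (Prop_irrelevance HA HB).
  have [[A0 FA0]|F0] := pselect (exists A0, F A0); last first.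
    exists (exist PX _ JA) => A FA; case: F0; by exists A.
  pose U := [set x | exists2 A, F A & sval A x].
  have UX : PX U.
    have FX A : F A -> PX (sval A) by move=> _; apply: svalP.
    have U0 : U 0 by exists A0 => //; have [B _ ->] := FX _ FA0; apply: ideal_set0.
    have UB x y : U x -> U y -> U (x - y).
      move=> [A FA Ax] [B FB By]; have [/asboolP AB|/asboolP BA] := Ftot A B FA FB.
        by exists B => //; move: (AB _ Ax) By; have [C _ ->] := FX _ FB; apply: ideal_setB.
      by exists A => //; move: Ax (BA _ By); have [C _ ->] := FX _ FA; apply: ideal_setB.
    have UM a x : U x -> U (a * x).
      by move=> [A FA Ax]; exists A => //; move: Ax; have [C _ ->] := FX _ FA; apply: ideal_setM.
    exists (IdealSet U0 UB UM) => //; split=> x /=.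
      move=> xJ; exists A0 => //; have [B [JB _] ->] := FX _ FA0; exact: JB.
    by move=> Tx [A FA]; have [B [_ TB] ->] := FX _ FA; apply: TB.
  exists (exist PX _ UX) => A FA; apply/asboolP => x Ax; by exists A.
case: A Amax => A AX; have [B [JB TB] eA] := AX => Amax.
have maxB x : ~ B x -> exists b r, B b /\ T (b + r * x).
  move=> nBx; pose U := [set y | exists b r, B b /\ y = b + r * x].
  have U0 : U 0 by exists 0, 0; rewrite mul0r addr0; split=> //; apply: ideal_set0.
  have UB y w : U y -> U w -> U (y - w).
    move=> [b [r [Bb ->]]] [c [t [Bc ->]]]; exists (b - c), (r - t).
    by split; [exact: ideal_setB|ring].
  have UM a y : U y -> U (a * y).
    move=> [b [r [Bb ->]]]; exists (a * b), (a * r).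
    by split; [exact: ideal_setM|ring].
  apply: contrapT => nT; apply: nBx.
  have UX : PX U.
    exists (IdealSet U0 UB UM) => //; split=> y /=.
      by move=> yJ; exists y, 0; rewrite mul0r addr0; split=> //; apply: JB.
    by move=> Ty [b [r [Bb ey]]]; apply: nT; exists b, r; rewrite -ey.
  have /Amax/(congr1 sval) /= eU : le (exist PX _ AX) (exist PX _ UX).
    apply/asboolP => y /=; rewrite eA => By; exists y, 0.
    by rewrite mul0r addr0.
  rewrite -eA -eU; exists 0, 1; rewrite mul1r add0r; split=> //.
  exact: ideal_set0.
exists (ideal_of_set B); split.
- split=> [|x y]; first by apply/negP => /ideal_of_setP; apply: TB.
  move=> /ideal_of_setP Bxy; apply: contrapT => /not_orP[nx ny].
  have [b [r [Bb Tx]]] := maxB x (contra_not (@ideal_of_setP R B x).2 nx).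
  have [c [t [Bc Ty]]] := maxB y (contra_not (@ideal_of_setP R B y).2 ny).
  apply: (TB _ (TM _ _ Tx Ty)).
  have -> : (b + r * x) * (c + t * y) =
    (c + t * y) * b - ((- (r * x)) * c - (r * t) * (x * y)) by ring.
  apply: ideal_setB; first exact: ideal_setM.
  by apply: ideal_setB; apply: ideal_setM.
- by move=> x xJ; apply/ideal_of_setP; apply: JB.
- by move=> x Tx; apply/negP => /ideal_of_setP; apply: TB.
Qed.

(** The chain is built upwards. A prime P avoiding the whole monoid omits y, and P + (y) avoids the
    monoid of the tail: if x = b + y r lies in that monoid, then b = x - y r lies in the larger one,
    so b is not in P. *)
Lemma prime_chain_of_nested T s J : monoid_set T ->
  (forall x, nested_monoid T s x -> x \notin J) ->
  exists C, [/\ prime_chain C (size s), {subset J <= C 0%N} &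
                forall x, T x -> x \notin C (size s)].
Proof.
move=> mT; elim: s J => [|y s IH] J HJ.
  have [P [prP JP TP]] := prime_ideal_avoiding mT HJ.
  by exists (fun=> P); split=> //; split.
have mT' := nested_monoidP (y :: s) mT.
have [P [prP JP TP]] := prime_ideal_avoiding mT' HJ.
pose U := [set w | exists b r, b \in P /\ w = b + y * r].
have U0 : U 0 by exists 0, 0; rewrite mulr0 addr0 rpred0.
have UB v w : U v -> U w -> U (v - w).
  move=> [b [r [Bb ->]]] [c [t [Bc ->]]]; exists (b - c), (r - t).
  by split; [exact: rpredB|ring].
have UM a w : U w -> U (a * w).
  move=> [b [r [Bb ->]]]; exists (a * b), (a * r).
  by split; [exact: idealMl|ring].
have [|C [[prC incC] UC TC]] := IH (ideal_of_set (IdealSet U0 UB UM)).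
  move=> x Tx; apply/negP => /ideal_of_setP[b [r [bP ex]]].
  suff /TP : nested_monoid T (y :: s) b by rewrite bP.
  by exists 0%N, (- r), x; split=> //; rewrite ex; ring.
have PC x : x \in P -> x \in C 0%N.
  by move=> xP; apply: UC; apply/ideal_of_setP; exists x, 0; rewrite mulr0 addr0.
exists (fun i => if i is i'.+1 then C i' else P); split=> //; split.
  by case=> [|i] // hi; apply: prC.
case=> [_|i hi]; last exact: incC.
split; first exact: PC; exists y.
  by apply: UC; apply/ideal_of_setP; exists 0, 1; rewrite mulr1 add0r rpred0.
apply: TP; exists 1%N, 0, 1; rewrite mulr0 addr0 mulr1 expr1; split=> //.
by have [] := nested_monoidP s mT.
Qed.

Lemma prime_chain_of_nested0 T s : monoid_set T -> ~ nested_monoid T s 0 ->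
  exists C, prime_chain C (size s) /\ forall x, T x -> x \notin C (size s).
Proof.
move=> mT nT0; pose Z := [set x : R | x = 0].
have Z0 : Z 0 by [].
have ZB x y : Z x -> Z y -> Z (x - y) by rewrite /Z /= => -> ->; rewrite subr0.
have ZM a x : Z x -> Z (a * x) by rewrite /Z /= => ->; rewrite mulr0.
have [|C [chC _ TC]] := @prime_chain_of_nested T s (ideal_of_set (IdealSet Z0 ZB ZM)) mT.
  by move=> x Tx; apply/negP => /ideal_of_setP x0; apply: nT0; rewrite -x0.
by exists C.
Qed.

Lemma prime_chain_below P s : prime_ideal P ->
  ~ nested_monoid [set x | x \notin P] s 0 ->
  exists C, prime_chain C (size s) /\ C (size s) =i P.
Proof.
move=> prP nP0.
have mT : monoid_set [set x | x \notin P].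
  split; first by case: prP.
  move=> x y /= xP yP; apply/negP => xyP.
  by have [_ /(_ _ _ xyP)[]] := prP; apply/negP.
have [C [[prC incC] TC]] := prime_chain_of_nested0 mT nP0.
have CP x : x \in C (size s) -> x \in P.
  by move=> xC; apply: contrapT => /negP /TC; rewrite xC.
(* The top prime avoids the complement of P, hence is contained in P and may be replaced by P. *)
exists (fun i => if i == size s then P else C i); rewrite eqxx; split=> //.
split=> i hi; first by case: eqP => // _; apply: prC.
rewrite (ltn_eqF hi); have [inc [x xC xnC]] := incC i hi.
case: eqP => [e|_]; last by split=> //; exists x.
rewrite e in inc xC; split; first by move=> y /inc; apply: CP.
by exists x => //; apply: CP.
Qed.

(** Regularity cancels each factor y^a, so membership of 0 would propagate through the sequence and
    end with an element of T in the ideal of s. *)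
Lemma regular_nested T s : monoid_set T -> regular_sequence s ->
  (forall x, T x -> x \notin generated_ideal [set` s]) -> ~ nested_monoid T s 0.
Proof.
move=> mT [_ reg] Ts T0.
suff main r : forall t v, (t + r)%N = size s -> nested_monoid T (drop t s) v ->
    v \in generated_ideal [set` take t s] -> False.
  apply: (main (size s) 0%N 0 (add0n _)); first by rewrite drop0.
  exact: rpred0.
elim: r => [|r IH] t v tr.
  rewrite addn0 in tr; rewrite drop_oversize ?tr // take_oversize ?tr //.
  by move=> /Ts /negP.
have ts : (t < size s)%N by rewrite -tr addnS ltnS leq_addr.
rewrite (drop_nth 0 ts) => -[a [u [w [Tw ->]]]] hv.
apply: (IH t.+1 w) => //; first by rewrite addSn -addnS.
have : w + s`_t * u \in generated_ideal [set` take t s].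
  elim: a hv => [|a IHa]; first by rewrite expr0 mul1r.
  by rewrite exprS -mulrA => /(reg _ ts)/IHa.
move=> /generated_ideal_take_sub hw.
have -> : w = (w + s`_t * u) - u * s`_t by ring.
apply: rpredB => //; apply: idealMl; apply: generated_ideal_mem => /=.
by rewrite (take_nth 0 ts) mem_rcons inE eqxx.
Qed.

(* For T the units, an elementary form of: Krull dimension at most d. *)
Definition krull_le (T : set R) (d : nat) : Prop :=
  forall s, size s = d.+1 -> nested_monoid T s 0.

Definition units : set R := [set u | exists w, w * u = 1].

Lemma unit_notin J x : 1 \notin J -> units x -> x \notin J.
Proof.
by move=> J1 [w wx]; apply: contra J1 => xJ; rewrite -wx; apply: idealMl.
Qed.

Lemma monoid_units : monoid_set units.
Proof.
split; first by exists 1; rewrite mulr1.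
by move=> x y [w wx] [v vy]; exists (w * v); rewrite mulrACA wx vy mulr1.
Qed.

(** For y i in C (i + 1) but not in C i, primality keeps every element of the nested monoid from
    position t on outside C t; a chain longer than d would make 0 such an element. *)
Lemma krull_le_chain d (C : nat -> ideal R) l : krull_le units d -> prime_chain C l -> (l <= d)%N.
Proof.
move=> kd [prC incC]; rewrite leqNgt; apply/negP => dl.
have /choice [y Hy] : forall i, exists x, (i < l)%N -> x \in C i.+1 /\ x \notin C i.
  move=> i; have [il|il] := boolP (i < l)%N; last by exists 0.
  by have [_ [x xS xC]] := incC i il; exists x.
suff main r : forall t v, (t + r)%N = d.+1 ->
    nested_monoid units [seq y i | i <- iota t r] v -> v \notin C t.
  have sz : size [seq y i | i <- iota 0 d.+1] = d.+1 by rewrite size_map size_iota.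
  by have := main _ 0%N 0 (add0n _) (kd _ sz); rewrite rpred0.
elim: r => [|r IH] t v tr /=.
  rewrite addn0 in tr; apply: unit_notin; rewrite tr.
  by have [] := prC d.+1 dl.
have tl : (t < l)%N by lia.
move=> [a [u [w [Uw ->]]]]; have [yS yC] := Hy t tl.
have [inc _] := incC t tl; have [P1 PM] := prC t (ltnW tl).
apply/negP => hv.
have /inc : w + y t * u \in C t.
  elim: a hv => [|a IHa]; first by rewrite expr0 mul1r.
  rewrite exprS -mulrA => /PM[h|/IHa //]; by rewrite h in yC.
move=> hw; have := IH t.+1 w; rewrite addSn -addnS tr => /(_ erefl Uw)/negP; apply.
have -> : w = (w + y t * u) - u * y t by ring.
by apply: rpredB => //; apply: idealMl.
Qed.

Lemma krull_le_regular d s : krull_le units d -> regular_sequence s ->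
  (size s <= d)%N.
Proof.
move=> kd regs; rewrite leqNgt; apply/negP => ds.
have [s1 reg] := regs.
have sub x : x \in generated_ideal [set` take d.+1 s] -> x \in generated_ideal [set` s].
  apply: generated_ideal_sub => y /= ys; apply: generated_ideal_mem => /=.
  exact: mem_take ys.
apply: (@regular_nested units (take d.+1 s) monoid_units); last first.
- by apply: kd; rewrite size_takel.
- move=> x Ux; apply: unit_notin Ux; apply/negP => /sub; exact/negP.
split; first by apply/negP => /sub; apply/negP.
move=> i; rewrite size_takel // => id y; rewrite nth_take // take_takel ?(ltnW id) //.
by apply: reg; apply: leq_trans id ds.
Qed.

End PrimeChains.

(** * Counting standard monomials *)

Section Dickson.

Lemma nat_seq_tail_min (h : nat -> nat) N :
  exists a, (N <= a)%N /\ forall b, (N <= b)%N -> (h a <= h b)%N.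
Proof.
have ex : exists v, `[< exists2 a, (N <= a)%N & h a = v >].
  by exists (h N); apply/asboolP; exists N.
case: (ex_minnP ex) => v /asboolP[a Na <-] vmin; exists a; split=> // b Nb.
by apply: vmin; apply/asboolP; exists b.
Qed.

Lemma nat_seq_nondecreasing (h : nat -> nat) :
  exists f : nat -> nat, (forall a, (f a < f a.+1)%N) /\
    forall a b, (a <= b)%N -> (h (f a) <= h (f b))%N.
Proof.
have /choice [c Hc] := nat_seq_tail_min h.
pose f := fix f i := if i is i'.+1 then c (f i').+1 else c 0%N.
have fS i : (f i < f i.+1)%N by have [] := Hc (f i).+1.
exists f; split=> // a b; elim: b => [|b IH]; first by rewrite leqn0 => /eqP->.
rewrite leq_eqVlt => /predU1P[->//|]; rewrite ltnS => /IH/leq_trans; apply.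
case: b {IH} => [|b] /=; last first.
  by have [_] := Hc (f b).+1; apply; have := fS b; have := fS b.+1; rewrite /=; lia.
by have [_] := Hc 0%N; apply.
Qed.

Lemma incr_ge (f : nat -> nat) : (forall a, (f a < f a.+1)%N) ->
  forall a, (a <= f a)%N.
Proof. by move=> fS; elim=> // a IH; apply: leq_ltn_trans (fS a). Qed.

Lemma incr_homo (f : nat -> nat) : (forall a, (f a < f a.+1)%N) ->
  forall a b, (a <= b)%N -> (f a <= f b)%N.
Proof.
by move=> fS a b /subnK <-; elim: (b - a)%N => // c /leq_trans; apply; apply: ltnW.
Qed.

Lemma dickson_subsequence n (g : nat -> 'I_n -> nat) :
  exists f : nat -> nat, (forall a, (f a < f a.+1)%N) /\
    forall j a b, (a <= b)%N -> (g (f a) j <= g (f b) j)%N.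
Proof.
suff [f [fS H]] : exists f : nat -> nat, (forall a, (f a < f a.+1)%N) /\
    forall j, j \in enum 'I_n -> forall a b, (a <= b)%N -> (g (f a) j <= g (f b) j)%N.
  by exists f; split=> // j; apply: H; rewrite mem_enum.
elim: (enum 'I_n) => [|j s [f [fS IH]]]; first by exists id.
have [f' [fS' H]] := nat_seq_nondecreasing (fun a => g (f a) j).
exists (f \o f'); split=> [a|l] /=.
  by apply: leq_trans (fS _) _; apply: incr_homo fS _ _ (fS' a).
rewrite inE => /predU1P[->|ls] a b ab; first exact: H.
by apply: IH => //; apply: incr_homo.
Qed.

Definition mnm_trunc n (B : nat) (u : 'X_{1..n}) : 'X_{1..n} :=
  [multinom minn (u j) B | j < n].

(** Dickson's lemma in the form used below: membership in an upward-closed set depends only on the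
    exponents cut at B. *)
Lemma dickson_bound n (Up : set 'X_{1..n}) :
  (forall u v, (u <= v)%MM -> Up u -> Up v) ->
  exists B, forall u, Up u -> Up (mnm_trunc B u).
Proof.
move=> UpM; apply: contrapT => nB.
have /choice [g Hg] : forall B, exists u, Up u /\ ~ Up (mnm_trunc B u).
  move=> B; apply: contrapT => h; apply: nB; exists B => u Uu.
  by apply: contrapT => nU; apply: h; exists u.
have [f [fS fm]] := dickson_subsequence (fun B j => g B j).
(* Cutting at f a >= a does not touch exponents bounded by a, so the truncated counterexample still
   dominates the first element of the monotone subsequence. *)
pose a := mdeg (g (f 0%N)).
have [_] := Hg (f a); apply; apply: UpM (Hg (f 0%N)).1.
apply/mnm_lepP => j; rewrite mnmE leq_min fm //=.
apply: leq_trans (incr_ge fS a); rewrite /a mdegE (bigD1 j) //=; exact: leq_addr.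
Qed.

End Dickson.

Section StandardMonomials.
Variables (n : nat) (Up : set 'X_{1..n}) (B delta : nat).
Hypothesis UpM : forall u v, (u <= v)%MM -> Up u -> Up v.
Hypothesis UpB : forall u, Up u -> Up (mnm_trunc B u).

(* For Up the exponents of monomials in I: the translate u + N^F lies in Lambda_I. *)
Definition standard_flat (u : 'X_{1..n}) (F : {set 'I_n}) : Prop :=
  forall w : 'X_{1..n}, (forall j, j \notin F -> w j = u j) -> ~ Up w.

Hypothesis Udelta : forall u F, standard_flat u F -> (#|F| <= delta)%N.

Lemma standard_flat_trunc u : ~ Up u ->
  standard_flat u [set j : 'I_n | (B <= u j)%N]%SET.
Proof.
move=> nU w wu Uw; apply/nU/UpM/(UpB Uw); apply/mnm_lepP => j; rewrite mnmE.
have [Buj|ujB] := leqP B (u j); first by rewrite geq_min Buj orbT.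
by rewrite wu ?geq_minl // inE -ltnNge.
Qed.

Definition ffun_mnm M (u : {ffun 'I_n -> 'I_M}) : 'X_{1..n} := [multinom u j : nat | j < n].

(** A standard exponent in the box is determined by its truncation at B and by its large entries.
    The large positions span a standard translate, so there are at most delta of them. *)
Lemma card_standard M :
  (#|[set u : {ffun 'I_n -> 'I_M.+1} | `[< ~ Up (ffun_mnm u) >]]%SET|
    <= B.+1 ^ n * M.+1 ^ delta)%N.
Proof.
have minE a b : minn a B = minn b B -> (B <= a)%N = (B <= b)%N.
  by move=> e; apply/idP/idP => ?; lia.
pose big (u : {ffun 'I_n -> 'I_M.+1}) : {set 'I_n} :=
  [set j : 'I_n | (B <= ffun_mnm u j)%N]%SET.
pose code (u : {ffun 'I_n -> 'I_M.+1}) :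
    {ffun 'I_n -> 'I_B.+1} * {ffun 'I_delta -> 'I_M.+1} :=
  ([ffun j => inord (minn (u j) B)],
   [ffun i : 'I_delta => nth ord0 [seq u j | j <- enum (big u)] i]).
have codeK : {in [set u : {ffun 'I_n -> 'I_M.+1} | `[< ~ Up (ffun_mnm u) >]]%SET &,
    injective code}.
  move=> u v; rewrite !inE => /asboolP/asboolP nu /asboolP/asboolP nv [/ffunP e1 /ffunP e2].
  have e1' j : minn (u j) B = minn (v j) B.
    by have := congr1 val (e1 j); rewrite !ffunE /= !inordK // ltnS geq_minr.
  have ebig : big u = big v.
    by apply/setP => j; rewrite !inE !mnmE; apply: minE; apply: e1'.
  apply/ffunP => j; apply: val_inj => /=.
  have [ju|ju] := boolP (j \in big u); last first.
    have := ju; rewrite inE mnmE -ltnNge => uj.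
    have := ju; rewrite ebig inE mnmE -ltnNge => vj.
    by have := e1' j; rewrite (minn_idPl (ltnW uj)) (minn_idPl (ltnW vj)).
  have jF : j \in enum (big u) by rewrite mem_enum.
  have jd : (index j (enum (big u)) < delta)%N.
    have hi : (index j (enum (big u)) < #|big u|)%N by rewrite cardE index_mem.
    exact: (leq_trans hi (Udelta (standard_flat_trunc nu))).
  have := e2 (Ordinal jd); rewrite !ffunE /= -ebig.
  by rewrite !(nth_map j) ?index_mem // !nth_index // => ->.
rewrite -(card_in_imset codeK); apply: leq_trans (max_card _) _.
by rewrite card_prod !card_ffun !card_ord.
Qed.

End StandardMonomials.

(** * Algebraic dependence in the quotient ring *)

Section AlgebraicDependence.
Variables (k : fieldType) (n : nat) (I : ideal {mpoly k[n]}).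
Local Notation S := {mpoly k[n]}.
Local Notation pr := (qproj I).
Implicit Types (c : k) (y : ring_quot I).

Lemma big_tuple_cons (V : nmodType) r t (G : r.+1.-tuple 'I_t -> V) :
  \sum_m G m = \sum_(a < t) \sum_(m : r.-tuple 'I_t) G [tuple of a :: m].
Proof.
rewrite pair_big /= (reindex (fun am : 'I_t * r.-tuple 'I_t => [tuple of am.1 :: am.2])) //=.
exists (fun m : r.+1.-tuple 'I_t => (thead m, [tuple of behead m])).
  by case=> a m _; rewrite theadE; congr (_, _); apply: val_inj.
by move=> m _ /=; rewrite -tuple_eta.
Qed.

Definition tuple_monomial r t (ys : r.-tuple (ring_quot I)) (m : r.-tuple 'I_t) :
    ring_quot I :=
  \prod_(i < r) tnth ys i ^+ tnth m i.

Definition combination r t (ys : r.-tuple (ring_quot I)) (c : r.-tuple 'I_t -> k) :=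
  \sum_m pr (c m)%:MP * tuple_monomial ys m.

(* Factor out the smallest exponent of the first element, recursively. *)
Lemma combination_nested r t (ys : r.-tuple (ring_quot I)) (c : r.-tuple 'I_t -> k) m0 :
  c m0 != 0 -> nested_monoid (@units _) ys (combination ys c).
Proof.
elim: r ys c m0 => [|r IH] ys c m0 cm0.
  have -> : tval ys = [::] by apply: size0nil; rewrite size_tuple.
  rewrite /= /combination (big_pred1 m0) => [|m]; last by rewrite [m]tuple0 [m0]tuple0 /= eqxx.
  rewrite /tuple_monomial big_ord0 mulr1; exists (pr (c m0)^-1%:MP).
  by rewrite -rmorphM -mpolyCM mulVf // mpolyC1 rmorph1.
pose y := thead ys; pose ys' := [tuple of behead ys].
pose E (a : 'I_t) := combination ys' (fun m : r.-tuple 'I_t => c [tuple of a :: m]).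
have eE : combination ys c = \sum_(a < t) y ^+ a * E a.
  rewrite /combination big_tuple_cons; apply: eq_bigr => a _.
  rewrite mulr_sumr; apply: eq_bigr => m _; rewrite /tuple_monomial big_ord_recl.
  rewrite [RHS]mulrCA; congr (_ * _); rewrite -/(thead ys) -/y; congr (_ * _).
  apply: eq_bigr => i _; congr (_ ^+ _); last by rewrite !(tnth_nth a).
  by rewrite !(tnth_nth 0) /= nth_behead.
have ex : exists a, [exists a' : 'I_t, (a' == a :> nat) &&
    [exists m : r.-tuple 'I_t, c [tuple of a' :: m] != 0]].
  exists (thead m0); apply/existsP; exists (thead m0); rewrite eqxx.
  apply/existsP; exists [tuple of behead m0]; by rewrite -tuple_eta.
case: (ex_minnP ex) => a0 /existsP[a /andP[/eqP ea /existsP[m cam]]] amin.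
have E0 (a' : 'I_t) : (a' < a)%N -> E a' = 0.
  move=> lt_a; rewrite /E /combination big1 // => m' _.
  suff -> : c [tuple of a' :: m'] = 0 by rewrite mpolyC0 rmorph0 mul0r.
  apply/eqP; apply: contraTT lt_a => ca; rewrite -leqNgt ea; apply: amin.
  by apply/existsP; exists a'; rewrite eqxx; apply/existsP; exists m'.
rewrite eE [tval ys](_ : _ = y :: ys'); last first.
  by rewrite [ys in LHS]tuple_eta.
exists a, (\sum_(a' < t | (a < a')%N) y ^+ (a' - a.+1) * E a'), (E a); split.
  exact: IH cam.
rewrite (bigID (fun a' : 'I_t => (a' < a)%N)) /= big1 => [|a' lta]; last first.
  by rewrite E0 ?mulr0.
rewrite add0r (bigD1 a) /= ?ltnn // mulrDr !mulr_sumr; congr (_ + _).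
apply: eq_big => [a'|a']; rewrite -leqNgt.
  by rewrite [RHS]ltn_neqAle andbC eq_sym -val_eqE.
case/andP=> le_a ne_a; have lta : (a < a')%N.
  by rewrite ltn_neqAle le_a andbT eq_sym.
rewrite {1}(_ : a' = (a + (1 + (a' - a.+1)))%N :> nat); last by lia.
by rewrite !exprD expr1 -!mulrA.
Qed.

Lemma exists_linear_relation (T U : finType) (v : T -> U -> k) :
  (#|U| < #|T|)%N -> exists c : T -> k,
    (exists t, c t != 0) /\ forall u, \sum_t c t * v t u = 0.
Proof.
move=> UT; pose A : 'M[k]_(#|T|, #|U|) := \matrix_(i, j) v (enum_val i) (enum_val j).
have : kermx A != 0.
  rewrite -mxrank_eq0 mxrank_ker -lt0n subn_gt0.
  by apply: leq_ltn_trans UT; apply: rank_leq_col.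
move=> /rowV0Pn[w /sub_kermxP wA w0].
exists (fun t => w 0 (enum_rank t)); split.
  apply: contrapT => h; case/eqP: w0; apply/rowP => i; rewrite mxE.
  apply/eqP; apply/negPn/negP => wi; apply: h.
  by exists (enum_val i); rewrite enum_valK.
move=> u; have /rowP/(_ (enum_rank u)) := wA; rewrite !mxE => h.
rewrite -[RHS]h [LHS](reindex (@enum_val T predT)) /=; last first.
  by exists enum_rank => x _; rewrite ?enum_valK ?enum_rankK.
by apply: eq_bigr => i _; rewrite enum_valK mxE enum_rankK.
Qed.

Variables (B delta : nat).
Hypothesis Imon : monomial_ideal I.
Let Up : set 'X_{1..n} := [set u | 'X_[u] \in I].
Hypothesis UpB : forall u, Up u -> Up (mnm_trunc B u).
Hypothesis Udelta : forall u F, standard_flat Up u F -> (#|F| <= delta)%N.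

Lemma msizeX_leq a e (f : S) : (msize f <= a.+1)%N -> (msize (f ^+ e) <= (a * e).+1)%N.
Proof.
move=> fa; elim: e => [|e IH]; first by rewrite expr0 msize1.
by rewrite exprS mulnS; apply: msizeM_leq.
Qed.

Lemma msize_prod_leq a (J : Type) (r : seq J) (P : pred J) (f : J -> S) (b : J -> nat) :
  (forall j, (msize (f j) <= (b j).+1)%N) -> (\sum_(j <- r | P j) b j <= a)%N ->
  (msize (\prod_(j <- r | P j) f j) <= a.+1)%N.
Proof.
move=> fb; move=> h; suff : (msize (\prod_(j <- r | P j) f j) <= (\sum_(j <- r | P j) b j).+1)%N.
  by move/leq_trans; apply.
elim/big_rec2: _ => [|j x y _ IH]; first by rewrite msize1.
exact: msizeM_leq.
Qed.

(** Any delta + 1 elements have more bounded monomials than there are standard monomials to expand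
    them in, which forces a nontrivial relation; [combination_nested] reads it as the required
    identity. *)
Lemma quotient_krull_le : krull_le (@units (ring_quot I)) delta.
Proof.
move=> s ss; have sz : size s == delta.+1 by rewrite ss.
pose ys := Tuple sz; rewrite -[s]/(tval ys).
have /choice [f Hf] : forall i, exists p, tnth ys i = pr p by move=> i; apply: qprojP.
pose Dg := (\sum_i msize (f i))%N.
have fD i : (msize (f i) <= Dg.+1)%N.
  by apply: leqW; rewrite /Dg (bigD1 i) //= leq_addr.
(* With exponents at most C, products have degree at most M, and M + 1 <= (delta.+1 * Dg + 1) * (C +
   1). Hence at most C * (C + 1)^delta standard monomials face (C + 1)^(delta + 1) products. *)
pose C := (B.+1 ^ n * (delta.+1 * Dg + 1) ^ delta)%N.
pose t := C.+1; pose M := (delta.+1 * Dg * C)%N.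
pose mono (m : delta.+1.-tuple 'I_t) := \prod_(i < delta.+1) f i ^+ tnth m i.
have monoM m : (msize (mono m) <= M.+1)%N.
  apply: (@msize_prod_leq _ _ _ _ _ (fun=> Dg * C)%N) => [i|]; last first.
    by rewrite sum_nat_const card_ord mulnA.
  apply: leq_trans (msizeX_leq _ (fD i)) _; rewrite ltnS leq_mul2l -ltnS.
  by rewrite ltn_ord orbT.
pose U : finType := {u : {ffun 'I_n -> 'I_M.+1} | `[< ~ Up (ffun_mnm u) >]}.
have UpM u v : (u <= v)%MM -> Up u -> Up v by apply: ideal_lepm.
have cU : (#|U| < #|{: delta.+1.-tuple 'I_t}|)%N.
  rewrite card_sig card_tuple card_ord.
  have := card_standard UpM UpB Udelta M; rewrite cardsE => /leq_ltn_trans; apply.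
  rewrite expnS /t mulSn; apply: leq_ltn_trans (_ : (C * C.+1 ^ delta < _)%N).
    rewrite {1}/C -mulnA -expnMn leq_mul2l; apply/orP; right.
    have expn_mono a b e : (a <= b)%N -> (a ^ e <= b ^ e)%N.
      by case: e => // e ab; rewrite leq_exp2r.
    by apply: expn_mono; rewrite /M mulnDl mulnS; lia.
  by rewrite -addn1 addnC leq_add2r expn_gt0.
have [c [[m0 cm0] Hc]] := exists_linear_relation
  (fun m (u : U) => (mono m)@_(ffun_mnm (val u))) cU.
have -> : 0 = combination ys c; last exact: combination_nested cm0.
have -> : combination ys c = pr (\sum_m c m *: mono m).
  rewrite rmorph_sum; apply: eq_bigr => m _; rewrite -mul_mpolyC rmorphM; congr (_ * _).
  by rewrite rmorph_prod; apply: eq_bigr => i _; rewrite rmorphXn Hf.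
apply: esym; apply/qproj_eq0/(monomial_idealP _ Imon) => u.
rewrite mcoeff_msupp => cu; apply: contrapT => nu.
have uM : (mdeg u < M.+1)%N.
  rewrite ltnNge; apply: contra cu => uM; rewrite mcoeff_eq0; apply: msize_mdeg_ge.
  apply: leq_trans uM; apply: msize_sum_leq => m _.
  by apply: leq_trans (msizeZ_le _ _) (monoM m).
have uj j : (u j < M.+1)%N.
  by apply: leq_ltn_trans uM; rewrite mdegE (bigD1 j) //= leq_addr.
pose w : {ffun 'I_n -> 'I_M.+1} := [ffun j => inord (u j)].
have wu : ffun_mnm w = u.
  by apply/mnmP => j; rewrite mnmE ffunE inordK.
have wU : `[< ~ Up (ffun_mnm w) >] by apply/asboolP; rewrite wu.
case/eqP: cu; rewrite raddf_sum -[RHS](Hc (exist _ w wU)).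
by apply: eq_bigr => m _; rewrite /= mcoeffZ wu.
Qed.

End AlgebraicDependence.

(** * Zariski's lemma *)

Section IndependentVariables.
Variables (k : fieldType) (n : nat) (I : ideal {mpoly k[n]}).
Local Notation S := {mpoly k[n]}.
Local Notation pr := (qproj I).
Hypothesis Imon : monomial_ideal I.
Implicit Types (u w : 'X_{1..n}) (F : {set 'I_n}).

Lemma mcoeffXM_eq0 j (p : S) u : u j = 0%N -> ('X_j * p)@_u = 0.
Proof.
move=> uj; rewrite mulrC; apply: memN_msupp_eq0; apply/negP => /msuppM_le/allpairsP[[v w] /=].
by rewrite msuppX inE => -[_ /eqP-> e]; move: uj; rewrite e mnmDE mnm1E eqxx addn1.
Qed.

(** A multiple of x_j cannot cancel a coefficient at a monomial free of x_j, so a monomial in the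
    variables of s survives at each stage. *)
Lemma nested_variables (s : seq 'I_n) (v : S) : uniq s ->
  nested_monoid [set p : S | p@_0%MM != 0] [seq 'X_j | j <- s] v ->
  exists u, v@_u != 0 /\ forall j, j \notin s -> u j = 0%N.
Proof.
elim: s v => [|j s IH] v /=.
  by move=> _ v0; exists 0%MM; split=> // j _; rewrite mnm0E.
move=> /andP[js us] [a [r [w [/(IH _ us)[u [wu us0]] ->]]]].
exists (U_(j) *+ a + u)%MM; split.
  by rewrite mulrC mpolyXn mcoeffMX mcoeffD mcoeffXM_eq0 ?addr0 // us0.
move=> l; rewrite inE negb_or => /andP[lj ls].
by rewrite mnmDE mulmnE mnm1E eq_sym (negPf lj) us0.
Qed.

Lemma nested_lift (T : set (ring_quot I)) (T' : set S) (s : seq S) v :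
  (forall x, T x -> exists2 p, T' p & x = pr p) ->
  nested_monoid T [seq pr p | p <- s] v ->
  exists2 p, nested_monoid T' s p & v = pr p.
Proof.
move=> TT'; elim: s v => [|y s IH] v /=; first exact: TT'.
move=> [a [r [w [/IH[p Tp ->] ->]]]]; have [q ->] := qprojP r.
exists (y ^+ a * (p + y * q)); first by exists a, q, p.
by rewrite rmorphM rmorphXn rmorphD rmorphM.
Qed.

Lemma variables_independent (T : set (ring_quot I)) u F :
  standard_flat [set u | 'X_[u] \in I] u F ->
  (forall x, T x -> exists2 p : S, p@_0%MM != 0 & x = pr p) ->
  ~ nested_monoid T [seq pr 'X_j | j <- enum F] 0.
Proof.
move=> uF TT; rewrite (map_comp pr (fun j => 'X_j)).
move=> /(nested_lift TT)[p /nested_variables]; rewrite enum_uniq => /(_ isT)[w [pw wF]].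
move=> /esym/qproj_eq0/(monomial_idealP _ Imon)/(_ w).
rewrite mcoeff_msupp pw => /(_ isT) wI.
apply: (uF [multinom if j \in F then w j else u j | j < n]) => [j jF|].
  by rewrite mnmE (negPf jF).
apply: ideal_lepm wI; apply/mnm_lepP => j; rewrite mnmE.
by case: ifPn => // jF; rewrite wF // mem_enum.
Qed.

(** The variables of F are independent modulo I, which yields a chain of primes of length #|F|. *)
Lemma flat_card_le u F d : krull_dim (ring_quot I) d ->
  standard_flat [set u | 'X_[u] \in I] u F -> (#|F| <= d)%N.
Proof.
move=> [_ dmax] uF; pose T : set (ring_quot I) := [set x | x = 1].
have mT : monoid_set T by split=> // x y -> ->; rewrite mulr1.
have [|C [chC _]] := @prime_chain_of_nested0 _ T [seq pr 'X_j | j <- enum F] mT.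
  apply: variables_independent uF _ => x ->; exists 1; last by rewrite rmorph1.
  by rewrite mcoeff1 eqxx oner_neq0.
by have := dmax _ _ chC; rewrite size_map -cardE.
Qed.

End IndependentVariables.

(** * Noether normalization and integrality of residue rings *)

Section NoetherNormalization.
Variables (k : fieldType) (K : comNzRingType) (iota : {rmorphism k -> K}).

Definition ev n (x : 'I_n -> K) : {mpoly k[n]} -> K := mmap iota x.
HB.instance Definition _ n x := GRing.RMorphism.on (@ev n x).

Lemma evX n (x : 'I_n -> K) j : ev x 'X_j = x j.
Proof. by rewrite /ev mmapX mmap1U. Qed.

Lemma evC n (x : 'I_n -> K) c : ev x c%:MP = iota c.
Proof. by rewrite /ev mmapC. Qed.

Lemma ev_integral (R : comNzRingType) (RtoK : {rmorphism R -> K}) n (x : 'I_n -> K) p :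
  (forall c, integralOver RtoK (iota c)) ->
  (forall j, integralOver RtoK (x j)) -> integralOver RtoK (ev x p).
Proof.
move=> kint xint; rewrite /ev /mmap; elim/big_rec: _ => [|u y _ yint].
  exact: integral0.
apply: integral_add => //; apply: integral_mul => //; rewrite /mmap1.
elim/big_rec: _ => [|j z _ zint]; first exact: integral1.
apply: integral_mul => //; elim: (u j) => [|a IH]; first exact: integral1.
by rewrite exprS; apply: integral_mul.
Qed.

Lemma base_expansion_inj e n (u v : 'I_n -> nat) :
  (forall j, u j < e)%N -> (forall j, v j < e)%N ->
  (\sum_j u j * e ^ j = \sum_j v j * e ^ j)%N -> u =1 v.
Proof.
elim: n u v => [|n IH] u v ue ve; first by move=> _ [].
rewrite !big_ord_recl !expn0 !muln1.
have sh (w : 'I_n.+1 -> nat) : (\sum_(j < n) w (lift ord0 j) * e ^ lift ord0 j =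
    (\sum_(j < n) w (lift ord0 j) * e ^ j) * e)%N.
  by rewrite big_distrl /=; apply: eq_bigr => j _; rewrite /bump add1n expnSr mulnA.
rewrite !sh => E.
have u0 : u ord0 = v ord0.
  by have := congr1 (modn^~ e) E; rewrite /= ![(_ + _ * e)%N]addnC !modnMDl !modn_small.
have e0 : (0 < e)%N by apply: leq_ltn_trans (ue ord0).
move: E; rewrite u0 => /addnI/eqP; rewrite eqn_pmul2r // => /eqP/IH H.
move=> j; case: (unliftP ord0 j) => [i ->|-> //].
by apply: H => i'.
Qed.

Lemma monic_size_mul (A : comNzRingType) (p q : {poly A}) a b :
  p \is monic /\ size p = a.+1 -> q \is monic /\ size q = b.+1 ->
  p * q \is monic /\ size (p * q) = (a + b).+1.
Proof.
move=> [pm ps] [qm qs]; rewrite monicMl // qm size_Mmonic ?monic_neq0 // ps qs.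
by rewrite addnS.
Qed.

Lemma monic_size_exp (A : comNzRingType) (p : {poly A}) a b :
  p \is monic /\ size p = a.+1 -> p ^+ b \is monic /\ size (p ^+ b) = (b * a).+1.
Proof.
move=> pa; elim: b => [|b IH]; first by rewrite expr0 monic1 size_poly1 mul0n.
by rewrite exprS mulSn; apply: monic_size_mul.
Qed.

(** Nagata's substitution of T for x_0 and of x_j + T^(e^j) for the others. Exponents below e are
    the base e digits of their weight, so one monomial alone attains the top degree in T; c inverts
    its coefficient. *)
Lemma nagata_monic n (p : {mpoly k[n.+1]}) : p != 0 -> exists e,
  let h (j : 'I_n.+1) : {poly {mpoly k[n]}} :=
    if unlift ord0 j is Some i then ('X_i)%:P + 'X^(e ^ j) else 'X in
  exists c, c%:MP%:P * mmap (polyC \o @mpolyC n k) h p \is monic.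
Proof.
move=> p0; pose e := (msize p).+1; exists e => h.
pose wt (u : 'X_{1..n.+1}) := (\sum_j u j * e ^ j)%N.
have ue u j : u \in msupp p -> (u j < e)%N.
  move=> /msize_mdeg_lt; rewrite mdegE (bigD1 j) //= => lt_u.
  by apply: leqW; apply: leq_ltn_trans (leq_addr _ _) lt_u.
have wtI u v : u \in msupp p -> v \in msupp p -> wt u = wt v -> u = v.
  move=> up vp /base_expansion_inj E; apply/mnmP => j.
  by apply: E => i; apply: ue.
have h_monic j : h j \is monic /\ size (h j) = (e ^ j).+1.
  rewrite /h; case: unliftP => [i ->|->]; last by rewrite monicX size_polyX expn0.
  have lt_s : (size ('X_i : {mpoly k[n]})%:P < size ('X^(e ^ lift ord0 i) : {poly {mpoly k[n]}}))%N.
    rewrite size_polyXn ltnS; apply: leq_trans (size_polyC_leq1 _) _.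
    by rewrite expn_gt0.
  by rewrite addrC monicE lead_coefDl // -monicE monicXn size_polyDl // size_polyXn.
have m_monic u : mmap1 h u \is monic /\ size (mmap1 h u) = (wt u).+1.
  rewrite /mmap1 /wt; elim/big_rec2: _ => [|j a q _ IH].
    by rewrite monic1 size_poly1.
  by apply: monic_size_mul IH; apply: monic_size_exp.
have [u0 u0p umax] : exists2 u0, u0 \in msupp p &
    forall u, u \in msupp p -> (wt u <= wt u0)%N.
  have : msupp p != [::] by rewrite msupp_eq0.
  elim: (msupp p) => // u s IH _; have [s0|s0] := eqVneq s [::].
    by exists u; rewrite ?mem_head // s0 => v; rewrite inE => /eqP->.
  have [v vs vmax] := IH s0; have [uv|vu] := leqP (wt u) (wt v).
    exists v; first by rewrite inE vs orbT.
    by move=> w; rewrite inE => /predU1P[->//|/vmax].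
  exists u; first exact: mem_head.
  move=> w; rewrite inE => /predU1P[->//|/vmax/leq_trans]; apply; exact: ltnW.
have pu0 : p@_u0 != 0 by rewrite -mcoeff_msupp.
exists (p@_u0)^-1; rewrite /mmap (big_rem u0) //= mulrDr.
have -> : (p@_u0)^-1%:MP%:P * ((p@_u0)%:MP%:P * mmap1 h u0) = mmap1 h u0.
  by rewrite mulrA -polyCM -mpolyCM mulVf // mpolyC1 mul1r.
have [um us] := m_monic u0.
rewrite monicE lead_coefDl -?monicE // us ltnS.
rewrite mul_polyC; apply: leq_trans (size_scale_leq _ _) _.
apply: leq_trans (size_sum _ _ _) _; apply/bigmax_leqP_seq => u.
rewrite mem_rem_uniq ?msupp_uniq // inE => /andP[ne_u up] _.
rewrite mul_polyC; apply: leq_trans (size_scale_leq _ _) _.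
rewrite (m_monic u).2 ltn_neqAle umax // andbT.
by apply: contra ne_u => /eqP/wtI->.
Qed.

(** Given a relation, Nagata's substitution makes x_0 integral over the n elements x_j - x_0^(e^j),
    to which the induction applies. *)
Lemma noether_normalization n (x : 'I_n -> K) :
  exists r (y : 'I_r -> K), injective (ev y) /\ forall j, integralOver (ev y) (x j).
Proof.
elim: n x => [|n IH] x.
  exists 0%N, x; split=> [p q|[]//]; rewrite [p]nvar0_mpolyC [q]nvar0_mpolyC !evC.
  by move/(fmorph_inj iota) ->.
have [inj|ninj] := pselect (injective (ev x)).
  by exists n.+1, x; split=> // j; rewrite -(evX x); apply: integral_id.
have [p p0 xp] : exists2 p, p != 0 & ev x p = 0.
  apply: contrapT => h; apply: ninj => p q pq; apply/eqP; rewrite -subr_eq0.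
  apply/negPn/negP => pq0; apply: h; exists (p - q) => //.
  by rewrite rmorphB /= pq subrr.
have [e [c]] := nagata_monic p0; set h := (X in mmap _ X _) => cm.
pose x' (i : 'I_n) := x (lift ord0 i) - x ord0 ^+ (e ^ lift ord0 i).
have [r [y [yinj yint]]] := IH x'.
exists r, y; split=> //.
have kint a : integralOver (ev y) (iota a) by rewrite -(evC y); apply: integral_id.
have x0 : integralOver (ev y) (x ord0).
  pose q := map_poly (ev x') (c%:MP%:P * mmap (polyC \o @mpolyC n k) h p).
  apply: (@integral_root_monic _ _ _ _ q).
  - exact: monic_map.
  - rewrite /root /q rmorphM hornerM /= /mmap rmorph_sum horner_sum.
    rewrite [X in _ * X](_ : _ = ev x p); first by rewrite xp mulr0.
    rewrite /ev /mmap; apply: eq_bigr => u _; rewrite rmorphM hornerM /=.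
    rewrite map_polyC hornerC /= -/(ev x' _) evC; congr (_ * _).
    rewrite /mmap1 rmorph_prod horner_prod; apply: eq_bigr => j _.
    rewrite rmorphXn horner_exp; congr (_ ^+ _); rewrite /h.
    case: unliftP => [i ->|->]; last by rewrite /= map_polyX hornerX.
    rewrite rmorphD /= map_polyC map_polyXn !hornerE /= -/(ev x' _) evX /x'.
    by rewrite subrK.
  - move=> a /(nthP 0)[i _ <-]; rewrite coef_map; apply: ev_integral => j.
      exact: kint.
    exact: yint.
move=> j; case: (unliftP ord0 j) => [i ->|-> //].
rewrite -[x _](subrK (x ord0 ^+ (e ^ lift ord0 i))).
apply: integral_add; first exact: yint.
by elim: (e ^ _)%N => [|a IHa]; [exact: integral1|rewrite exprS; apply: integral_mul].
Qed.

(** If the normalization had a variable, its inverse z in K would be integral over the polynomial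
    ring, which is impossible. Hence K is integral over k. *)
Lemma zariski_lemma n (x : 'I_n -> K) : (forall z : K, exists p, z = ev x p) ->
  (forall z : K, z != 0 -> exists w, z * w = 1) ->
  forall j, exists q : {poly k}, q \is monic /\ root (map_poly iota q) (x j).
Proof.
move=> xgen Kfield j; have [r [y [yinj yint]]] := noether_normalization x.
case: r y yinj yint => [|r] y yinj yint.
  have [q qm qx] := yint j; exists (map_poly (mcoeff 0%MM) q); split.
    have l1 : (lead_coef q)@_0%MM = 1 by rewrite (monicP qm) mcoeff1 eqxx.
    by rewrite monicE lead_coef_map_eq /= l1 ?oner_neq0.
  rewrite -map_poly_comp_id0 ?rmorph0 //.
  suff -> : map_poly (iota \o mcoeff 0%MM) q = map_poly (ev y) q by [].
  by apply: eq_map_poly => p /=; rewrite {2}[p]nvar0_mpolyC evC.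
have y0 : ev y 'X_ord0 != 0.
  apply/eqP => e0; have /yinj : ev y 'X_ord0 = ev y 0 by rewrite rmorph0.
  by move=> /(congr1 (mcoeff U_(ord0))); rewrite mcoeffX eqxx mcoeff0 => /eqP; rewrite oner_eq0.
have [z yz] := Kfield _ y0.
have [q qm qz] : integralOver (ev y) z.
  have [p ->] := xgen z; apply: ev_integral => [c|//].
  by rewrite -(evC y); apply: integral_id.
pose m := (size q).-1.
have sq : size q = m.+1 by rewrite prednK // size_poly_gt0 monic_neq0.
(* The equation of z multiplied by the m-th power of the variable. By injectivity it is a polynomial
   identity, whose constant term is the leading coefficient 1. *)
have : ev y (\sum_(i < size q) q`_i * 'X_ord0 ^+ (m - i)) = 0.
  have <- : (ev y 'X_ord0) ^+ m * (map_poly (ev y) q).[z] = 0.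
    by move/eqP: qz => ->; rewrite mulr0.
  rewrite rmorph_sum horner_coef size_map_poly_id0; last first.
    by rewrite (monicP qm) rmorph1 oner_neq0.
  rewrite mulr_sumr; apply: eq_bigr => i _; rewrite coef_map rmorphM rmorphXn /=.
  have im : (i <= m)%N by rewrite -ltnS -sq.
  rewrite -{2}(subnK im) exprD mulrCA -mulrA; congr (_ * _).
  by rewrite -exprMn yz expr1n mulr1.
rewrite -(rmorph0 (ev y)) => /yinj /(congr1 (mcoeff 0%MM)).
rewrite sq big_ord_recr /= subnn expr0 mulr1 mcoeffD mcoeff0 raddf_sum big1 => [|i _].
  have -> : q`_m = 1 by have /monicP := qm; rewrite /lead_coef sq.
  by rewrite add0r mcoeff1 eqxx => /eqP; rewrite oner_eq0.
rewrite /=; have : (0 < m - i)%N by rewrite subn_gt0.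
by case: (m - i)%N => // a _; rewrite exprS mulrCA mcoeffXM_eq0 // mnm0E.
Qed.

End NoetherNormalization.

(** * Reisner's criterion *)

Section MaximalIdeals.
Variable R : comPzRingType.
Implicit Types (P : ideal R) (x y : R).

Lemma maximal_ideal_inv P x : maximal_ideal P -> x \notin P ->
  exists r, 1 - r * x \in P.
Proof.
move=> [P1 Pmax] xP; pose U := [set w | exists b r, b \in P /\ w = b + r * x].
have U0 : U 0 by exists 0, 0; rewrite mul0r addr0 rpred0.
have UB v w : U v -> U w -> U (v - w).
  move=> [b [r [Bb ->]]] [c [t [Bc ->]]]; exists (b - c), (r - t).
  by split; [exact: rpredB|ring].
have UM a w : U w -> U (a * w).
  move=> [b [r [Bb ->]]]; exists (a * b), (a * r).
  by split; [exact: idealMl|ring].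
pose J := ideal_of_set (IdealSet U0 UB UM).
have [J1|J1] := boolP (1 \in J).
  have /ideal_of_setP[b [r [bP e]]] := J1.
  by exists r; rewrite e addrK.
have JP : {subset J <= P}.
  apply: Pmax => // y yP; apply/ideal_of_setP.
  by exists y, 0; rewrite mul0r addr0.
case/negP: xP; apply: JP; apply/ideal_of_setP.
by exists 0, 1; rewrite mul1r add0r rpred0.
Qed.

Lemma maximal_prime P : maximal_ideal P -> prime_ideal P.
Proof.
move=> mP; split=> [|x y xyP]; first by case: mP.
have [xP|xP] := boolP (x \in P); [by left|right].
have [r rP] := maximal_ideal_inv mP xP.
have -> : y = y * (1 - r * x) + r * (x * y) by ring.
by apply: rpredD; apply: idealMl.
Qed.

Lemma prime_complement_monoid P : prime_ideal P -> monoid_set [set x | x \notin P].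
Proof.
move=> [P1 PM]; split=> // x y /= xP yP; apply/negP => /PM[h|h].
  by rewrite h in xP.
by rewrite h in yP.
Qed.

(* ring_quot P is only a comPzRingType; this copy carries the proof that 1 != 0. *)
Definition residue_ring P (_ : 1 \notin P) : Type := ring_quot P.
HB.instance Definition _ P (P1 : 1 \notin P) := GRing.ComPzRing.on (residue_ring P1).

Lemma residue_oner_neq0 P (P1 : 1 \notin P) : (1 : residue_ring P1) != 0.
Proof.
apply/eqP => e; have : qproj P 1 = 0 by [].
by move/qproj_eq0; apply/negP.
Qed.
HB.instance Definition _ P (P1 : 1 \notin P) :=
  GRing.PzSemiRing_isNonZero.Build (residue_ring P1) (residue_oner_neq0 P1).

Definition residue P (P1 : 1 \notin P) : R -> residue_ring P1 := qproj P.

Lemma residue_is_zmod_morphism P (P1 : 1 \notin P) : zmod_morphism (residue P1).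
Proof. exact: qproj_is_zmod_morphism. Qed.
Lemma residue_is_monoid_morphism P (P1 : 1 \notin P) : monoid_morphism (residue P1).
Proof. exact: qproj_is_monoid_morphism. Qed.
HB.instance Definition _ P (P1 : 1 \notin P) :=
  GRing.isZmodMorphism.Build R (residue_ring P1) (residue P1)
    (residue_is_zmod_morphism P1).
HB.instance Definition _ P (P1 : 1 \notin P) :=
  GRing.isMonoidMorphism.Build R (residue_ring P1) (residue P1)
    (residue_is_monoid_morphism P1).

Lemma residue_eq0 P (P1 : 1 \notin P) x : residue P1 x = 0 <-> x \in P.
Proof. exact: qproj_eq0. Qed.

Lemma residueP P (P1 : 1 \notin P) (z : residue_ring P1) : exists x, z = residue P1 x.
Proof. exact: qprojP. Qed.

End MaximalIdeals.

Section PowersInMaximalIdeals.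
Variables (k : fieldType) (n : nat) (I : ideal {mpoly k[n]}).
Local Notation S := {mpoly k[n]}.
Local Notation pr := (qproj I).

Lemma maximal_ideal_monic (P : ideal (ring_quot I)) : maximal_ideal P ->
  exists (p : 'I_n -> S) q, [/\ (0 < q)%N, forall j, pr (p j) \in P &
    forall j, (msize (p j - 'X_j ^+ q) <= q)%N].
Proof.
move=> mP; have [P1 _] := mP.
pose iota := residue P1 \o pr \o @mpolyC n k.
pose iotaM : {rmorphism k -> residue_ring P1} := iota.
pose x j := residue P1 (pr 'X_j).
have evE p : ev iotaM x p = residue P1 (pr p).
  rewrite {2}[p]mpolyE !rmorph_sum; apply: eq_bigr => u _.
  rewrite -mul_mpolyC !rmorphM mpolyXE_id !rmorph_prod; congr (_ * _).
  by apply: eq_bigr => j _; rewrite !rmorphXn.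
have H j : exists f : {poly k}, f \is monic /\ root (map_poly iotaM f) (x j).
  apply: zariski_lemma => z.
    have [y ->] := residueP z; have [p ->] := qprojP y.
    by exists p; rewrite evE.
  have [y ->] := residueP z => y0.
  have yP : y \notin P by apply: contra y0 => /residue_eq0 ->.
  have [r rP] := maximal_ideal_inv mP yP; exists (residue P1 r).
  have /(residue_eq0 P1)/eqP := rP.
  by rewrite rmorphB rmorph1 rmorphM subr_eq0 mulrC => /eqP.
have /choice [f Hf] := H.
pose N := (\sum_j size (f j)).+1.
pose g j := \sum_(i < size (f j)) (f j)`_i *: 'X_j ^+ i : S.
pose m j := (size (f j)).-1.
have sf j : size (f j) = (m j).+1.
  by have [fm _] := Hf j; rewrite prednK // size_poly_gt0 monic_neq0.
have mN j : (m j <= N)%N.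
  by rewrite /N (bigD1 j) //= sf; lia.
(* Powers of the variables bring the equations to the common degree N, which the successor keeps
   positive. *)
exists (fun j => g j * 'X_j ^+ (N - m j)), N; split=> // j.
  rewrite rmorphM mulrC; apply: idealMl; apply/(residue_eq0 P1).
  have [_ /eqP] := Hf j; rewrite horner_coef size_map_poly_id0; last first.
    by have [/monicP -> _] := Hf j; rewrite rmorph1 oner_neq0.
  move=> e; rewrite -[RHS]e !rmorph_sum; apply: eq_bigr => i _.
  by rewrite coef_map -mul_mpolyC !rmorphM !rmorphXn.
have -> : g j * 'X_j ^+ (N - m j) - 'X_j ^+ N = (g j - 'X_j ^+ m j) * 'X_j ^+ (N - m j).
  by rewrite mulrBl -exprD subnKC.
rewrite -{2}(subnKC (mN j)); apply: msizeM_lt (msizeXn _ _ _).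
rewrite /g sf big_ord_recr /=.
have -> : (f j)`_(m j) = 1 by have [/monicP] := Hf j; rewrite /lead_coef.
rewrite scale1r addrK; apply: msize_sum_leq => i _.
by apply: leq_trans (msizeZ_le _ _) _; apply: leq_trans (msizeXn _ _ _) _.
Qed.

End PowersInMaximalIdeals.

Section Reisner.
Variables (k : fieldType) (n : nat) (D : set {set 'I_n}).
Hypothesis Ddown : forall F F' : {set 'I_n}, F \subset F' -> D F' -> D F.
Local Notation S := {mpoly k[n]}.
Local Notation Q := (stanley_reisner_ring k D).
Local Notation I := (stanley_reisner_ideal k D).
Local Notation pr := (qproj (stanley_reisner_ideal k D)).

Lemma SR_standard_flat u F :
  standard_flat [set u | 'X_[u] \in I] u F -> D F.
Proof.
move=> uF; apply: contrapT => nF.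
apply: (uF [multinom if j \in F then 1%N else u j | j < n]) => [j jF|].
  by rewrite mnmE (negPf jF).
apply/(SR_mpolyX _ Ddown) => h; apply: nF; apply: Ddown h.
by apply/fintype.subsetP => j jF; rewrite inE mnmE jF.
Qed.

Lemma SR_krull_le d : (forall F, D F -> (#|F| <= d)%N) -> krull_le (@units Q) d.
Proof.
move=> Dd; have [B HB] := @dickson_bound n [set u | 'X_[u] \in I] (@ideal_lepm _ _ _).
apply: (quotient_krull_le (SR_monomial k D) HB) => u F /SR_standard_flat; exact: Dd.
Qed.

Lemma SR_regular_sequence d (P : ideal Q) : (forall F, D F -> (#|F| <= d)%N) ->
  link_vanishing (@off k n D) d -> maximal_ideal P ->
  exists s, [/\ regular_sequence s, {subset s <= P} & size s = d].
Proof.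
move=> Dd Dlv mP; have [p [q [q0 pP pq]]] := maximal_ideal_monic mP.
have Drv := link_to_restriction (@mono_fam_off k n D Ddown) Dlv.
pose s := mkseq (param D p) d.
have sP : {subset s <= P}.
  move=> y ys; have [i _ ->] := elimT (@mapP _ _ _ _ _) ys.
  rewrite /param rmorph_sum; apply: rpred_sum => J /eqP cJ.
  have [e|[j jJ]] := set_0Vmem J; first by rewrite e cards0 in cJ.
  by rewrite rmorph_prod (bigD1 j) //= mulrC; apply: idealMl; apply: pP.
exists s; rewrite size_mkseq; split=> //; split.
  have [P1 _] := mP; apply: contra P1; apply: generated_ideal_sub => y.
  exact: sP.
rewrite size_mkseq => i id y.
have ts : take i s = mkseq (param D p) i.
  by rewrite /s /mkseq -map_take take_iota (minn_idPl (ltnW id)).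
rewrite nth_mkseq // ts => /generated_ideal_seqP[g eg].
apply/generated_ideal_seqP; rewrite size_mkseq in eg *.
have [|h ->] := @param_regular k n D Ddown d Dd Drv p q q0 pq i y g id.
  by rewrite eg; apply: eq_bigr => j _; rewrite nth_mkseq.
by exists h; apply: eq_bigr => j _; rewrite nth_mkseq.
Qed.

Definition irrelevant_set : set Q := [set y | coefQ 0%MM y = 0].

Hypothesis D0 : D finset.set0.

Let D0' : D (mnm_support (0%MM : 'X_{1..n})).
Proof. by apply: Ddown D0; apply/fintype.subsetP => j; rewrite !inE mnm0E. Qed.

Lemma irrelevant_setM a y : irrelevant_set y -> irrelevant_set (a * y).
Proof.
have [p ->] := qprojP a; have [q ->] := qprojP y.
rewrite /irrelevant_set /= -rmorphM !coefQ_proj //.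
by move=> q0; rewrite (rmorphM (mcoeff 0%MM)) /= q0 mulr0.
Qed.

Lemma irrelevant_ideal_exists : exists M : ideal Q,
  maximal_ideal M /\ forall y, y \in M <-> coefQ 0%MM y = 0.
Proof.
have I0 : irrelevant_set 0 by apply: coefQ0.
have IB x y : irrelevant_set x -> irrelevant_set y -> irrelevant_set (x - y).
  by rewrite /irrelevant_set /= => x0 y0; rewrite coefQB // x0 y0 subr0.
pose M := ideal_of_set (IdealSet I0 IB irrelevant_setM).
have MP y : y \in M <-> coefQ 0%MM y = 0 by apply: ideal_of_setP.
exists M; split=> //; split.
  apply/negP => /MP; rewrite -(rmorph1 pr) coefQ_proj // mcoeff1 eqxx => /eqP.
  by rewrite oner_eq0.
move=> J MJ J1 y yJ; have [p ep] := qprojP y; apply/MP; rewrite ep coefQ_proj //.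
apply/eqP/negPn/negP => p0; case/negP: J1.
have h : pr (p - (p@_0%MM)%:MP) \in J.
  by apply: MJ; apply/MP; rewrite coefQ_proj // mcoeffB mcoeffC eqxx mulr1 subrr.
have : pr (p@_0%MM)%:MP \in J.
  have -> : pr (p@_0%MM)%:MP = y - pr (p - (p@_0%MM)%:MP).
    by rewrite rmorphB ep opprB addrC subrK.
  exact: rpredB.
move=> /(idealMl (pr (p@_0%MM)^-1%:MP)).
by rewrite -rmorphM -mpolyCM mulVf // mpolyC1 rmorph1.
Qed.

Lemma irrelevant_span y : coefQ 0%MM y = 0 ->
  exists g : 'I_n -> Q, y = \sum_j g j * xvar k D j.
Proof.
have [p ->] := qprojP y; rewrite coefQ_proj // => p0.
rewrite [p]mpolyE rmorph_sum big_seq.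
elim/big_ind: _ => [|a b [g ->] [h ->]|u up].
- by exists (fun=> 0); rewrite big1 // => j _; rewrite mul0r.
- by exists (fun j => g j + h j); rewrite -big_split; apply: eq_bigr => j _; rewrite mulrDl.
have [j uj] : exists j, u j != 0%N.
  apply: contrapT => h; move: up; rewrite mcoeff_msupp.
  have -> : u = 0%MM.
    apply/mnmP => j; rewrite mnm0E; apply/eqP/negPn/negP => uj.
    by apply: h; exists j.
  by rewrite p0 eqxx.
exists (fun l => if l == j then pr (p@_u *: 'X_[u - U_(j)]) else 0).
rewrite (bigD1 j) //= eqxx big1 => [|l /negPf->]; last by rewrite mul0r.
rewrite addr0 /xvar -rmorphM -scalerAl -mpolyXD submK // lep1mP //.
Qed.

(** From vanishing, every maximal ideal contains a regular sequence of length d, which bounds both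
    its depth and its height from below; [SR_krull_le] bounds them from above. The converse uses the
    irrelevant ideal only. *)
Lemma reisner d : (forall F, D F -> (#|F| <= d)%N) ->
  link_vanishing (@off k n D) d <-> CM_complex k D /\ krull_dim Q d.
Proof.
move=> Dd; have kd := SR_krull_le Dd.
have [M [mM MP]] := irrelevant_ideal_exists.
split=> [Dlv|[cm [[C chC] _]]].
  split.
    move=> P mP; have [s [regs sP ss]] := SR_regular_sequence Dd Dlv mP.
    have prP := maximal_prime mP.
    exists d; split.
      split; last by move=> C l chC _; apply: krull_le_chain kd chC.
      have [|C] := @prime_chain_below _ P s prP; last by rewrite ss; exists C.
      apply: regular_nested (prime_complement_monoid prP) regs _ => x xP.
      by apply: contra xP; apply: generated_ideal_sub => y; apply: sP.
    split; first by exists s.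
    by move=> s' regs' _; apply: krull_le_regular kd regs'.
  split; last by move=> C l; apply: krull_le_chain.
  have [s [regs sM ss]] := SR_regular_sequence Dd Dlv mM.
  have mT := prime_complement_monoid (maximal_prime mM).
  have [|C [chC _]] := @prime_chain_of_nested0 _ _ s mT.
    apply: regular_nested regs _ => // x xM.
    by apply: contra xM; apply: generated_ideal_sub => y; apply: sM.
  by exists C; rewrite -ss.
have [h [[_ hmax] [[s [regs sM ss]] _]]] := cm M mM.
(* Otherwise all faces have at most d - 1 vertices and no chain of length d exists. The variables of
   such a face then show that the irrelevant ideal has height at least d. *)
have [F DF dF] : exists2 F, D F & (d <= #|F|)%N.
  case: (posnP d) => [->|d0]; first by exists finset.set0.
  apply: contrapT => nF; have : krull_le (@units Q) d.-1.
    apply: SR_krull_le => F DF; rewrite -ltnS prednK // ltnNge.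
    by apply/negP => dF; apply: nF; exists F.
  by move=> /krull_le_chain/(_ chC); case: d d0 {Dd kd chC nF} => // d _; rewrite ltnn.
have dh : (d <= h)%N.
  apply: leq_trans dF _.
  have [|C' [chC' C'M]] := @prime_chain_below _ M [seq pr 'X_j | j <- enum F] (maximal_prime mM).
    apply: (@variables_independent k n I (SR_monomial k D) _ 0%MM F).
      move=> w wF /(SR_mpolyX _ Ddown); apply; apply: Ddown DF.
      apply/fintype.subsetP => j.
      by rewrite inE; apply: contraR => /wF ->; rewrite mnm0E.
    move=> x /= xM; have [p ep] := qprojP x; exists p => //.
    by apply: contra xM => /eqP p0; apply/MP; rewrite ep coefQ_proj.
  by have := hmax _ _ chC' C'M; rewrite size_map -cardE.
suff H : link_vanishing (@off k n D) h.
  by move=> L i hi; apply: H; apply: leq_trans hi dh.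
apply: restriction_to_link; first exact: mono_fam_off.
apply: koszul_to_restriction => // i hi; rewrite -ss in hi.
apply: regular_koszul regs _ i hi => y /sM /MP; exact: irrelevant_span.
Qed.

End Reisner.

(** * Zariski closures *)

Section ZariskiFlats.
Variables (K : numFieldType) (n : nat).
Implicit Types (p v x y : 'I_n -> K) (F : {set 'I_n}) (A X : set ('I_n -> K)).

Definition flat p F : set ('I_n -> K) := [set v | forall j, j \notin F -> v j = p j].

Lemma closure_mono A X : A `<=` X -> zariski_closure A `<=` zariski_closure X.
Proof. by move=> AX v Av p pX; apply: Av => a /AX; apply: pX. Qed.

Lemma zariski_closedP A v : zariski_closed A -> ~ A v ->
  exists2 f : {mpoly K[n]}, (forall a, A a -> f.@[a] = 0) & f.@[v] != 0.
Proof.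
move=> cA nAv; apply: contrapT => h; apply: nAv; apply: cA => f fA.
by apply/eqP/negPn/negP => fv; apply: h; exists f.
Qed.

Lemma closed_flat p F : zariski_closed (flat p F).
Proof.
move=> v Fv j jF; apply/eqP; rewrite -subr_eq0; apply/eqP.
have fE a : ('X_j - (p j)%:MP : {mpoly K[n]}).@[a] = a j - p j.
  by rewrite mevalB mevalXU mevalC.
by rewrite -fE; apply: Fv => a Fa; rewrite fE Fa // subrr.
Qed.

Lemma closed_bigcup (T : finType) (P : T -> Prop) (A : T -> set ('I_n -> K)) :
  (forall t, zariski_closed (A t)) ->
  zariski_closed [set v | exists2 t, P t & A t v].
Proof.
move=> cA v Av; apply: contrapT => nAv.
have /choice [f Hf] : forall t, exists f : {mpoly K[n]},
    P t -> (forall a, A t a -> f.@[a] = 0) /\ f.@[v] != 0.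
  move=> t; have [Pt|] := pselect (P t); last by exists 0.
  have [|f fA fv] := @zariski_closedP (A t) v (cA t).
    by move=> Atv; apply: nAv; exists t.
  by exists f.
have /eqP : (\prod_(t | `[< P t >]) f t).@[v] = 0.
  apply: Av => a [t Pt Aa]; rewrite rmorph_prod (bigD1 t) /=; last exact/asboolP.
  by rewrite (Hf t Pt).1 // mul0r.
rewrite rmorph_prod; apply/negP/prodf_neq0 => t /asboolP Pt.
by have [] := Hf t Pt.
Qed.

Definition line_poly x y : {mpoly K[n]} -> {poly K} :=
  mmap (@polyC K) (fun j => (x j)%:P + (y j - x j)%:P * 'X).

Lemma horner_line f x y t :
  (line_poly x y f).[t] = f.@[fun j => x j + (y j - x j) * t].
Proof.
rewrite /line_poly /mmap mevalE horner_sum; apply: eq_bigr => u _.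
rewrite hornerM hornerC; congr (_ * _); rewrite /mmap1 horner_prod.
by apply: eq_bigr => j _; rewrite horner_exp !hornerE.
Qed.

Lemma poly_nat_zeros (f : {poly K}) (e : nat -> K) : injective e ->
  (forall m, f.[e m] = 0) -> f = 0.
Proof.
move=> eI fe; apply/eqP/negPn/negP => f0.
have := @max_poly_roots _ f [seq e i | i <- iota 0 (size f)] f0.
rewrite size_map size_iota ltnn => H; have : false; last by [].
apply: H; last by rewrite map_inj_uniq ?iota_uniq.
by apply/allP => _ /mapP[i _ ->]; apply/eqP.
Qed.

Lemma natr_inj : injective (fun m : nat => m%:R : K).
Proof. by move=> a b /eqP; rewrite eqr_nat => /eqP. Qed.

(** The line joining a point outside A to a point outside X stays in the flat. A product of two
    nonzero polynomials on it would vanish at infinitely many parameters. *)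
Lemma irreducible_flat p F : zariski_irreducible (flat p F).
Proof.
split; first by exists p.
move=> A X cA cX AX; apply: contrapT => /not_orP[nA nX].
have [x Fx nAx] : exists2 x, flat p F x & ~ A x.
  by apply: contrapT => h; apply: nA => x Fx; apply: contrapT => nAx; apply: h; exists x.
have [y Fy nXy] : exists2 y, flat p F y & ~ X y.
  by apply: contrapT => h; apply: nX => y Fy; apply: contrapT => nXy; apply: h; exists y.
have [f fA fx] := zariski_closedP cA nAx; have [g gX gy] := zariski_closedP cX nXy.
have : line_poly x y f * line_poly x y g = 0.
  apply: (poly_nat_zeros natr_inj) => m; rewrite hornerM !horner_line.
  set v := fun _ => _; have : flat p F v by move=> j jF; rewrite /v Fx // Fy // subrr mul0r addr0.
  by move/AX => [/fA|/gX] ->; rewrite ?mul0r ?mulr0.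
move/eqP; rewrite mulf_eq0 => /orP[] /eqP e.
  case/eqP: fx; have := horner_line f x y 0; rewrite e horner0 => ->.
  by apply: meval_eq => j; rewrite mulr0 addr0.
case/eqP: gy; have := horner_line g x y 1; rewrite e horner0 => ->.
by apply: meval_eq => j; rewrite mulr1 addrC subrK.
Qed.

Lemma irreducible_bigcup (T : finType) (P : T -> Prop) (A : T -> set ('I_n -> K)) X :
  (forall t, zariski_closed (A t)) -> zariski_irreducible X ->
  X `<=` [set v | exists2 t, P t & A t v] -> exists2 t, P t & X `<=` A t.
Proof.
move=> cA [[x0 Xx0] irrX] XA.
suff main (s : seq T) : X `<=` [set v | exists t, [/\ t \in s, P t & A t v]] ->
    exists2 t, P t & X `<=` A t.
  by apply: (main (enum T)) => v /XA[t Pt Av]; exists t; rewrite mem_enum.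
elim: s => [|t s IH] Xs; first by have [t []] := Xs x0 Xx0.
pose C1 := [set v | exists2 t', t' = t /\ P t & A t' v].
pose C2 := [set v | exists2 t', t' \in s /\ P t' & A t' v].
have [||v /Xs|h|h] := irrX C1 C2.
- exact: closed_bigcup.
- exact: closed_bigcup.
- move=> [t' []]; rewrite inE => /predU1P[->|t's] Pt' At'; first by left; exists t.
  by right; exists t'.
- have [_ [_ Pt] _] := h x0 Xx0; exists t => // v /h[_ [-> _]] //.
by apply: IH => v /h[t' [t's Pt'] At']; exists t'.
Qed.

Definition grid (e : nat -> K) p F : set ('I_n -> K) :=
  [set v | (forall j, j \notin F -> v j = p j) /\
           forall j, j \in F -> exists m, v j = e m].

(** Coordinates are freed one at a time, each running over an infinite set. The sequence e will be
    the natural numbers for the distracting arrangement and the negative integers for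
    quasidegrees. *)
Lemma closure_grid (e : nat -> K) p F : injective e ->
  flat p F `<=` zariski_closure (grid e p F).
Proof.
move=> eI v Fv f fG.
suff main (s : seq 'I_n) : forall w, flat p F w ->
    (forall j, j \in F -> j \notin s -> exists m, w j = e m) -> f.@[w] = 0.
  by apply: (main (enum 'I_n)) => // j _; rewrite mem_enum.
elim: s => [|j s IH] w Fw ew; first by apply: fG; split=> // j jF; apply: ew.
have [jF|jF] := boolP (j \in F); last first.
  apply: IH => // l lF ls; apply: ew => //; rewrite inE negb_or ls andbT.
  by apply: contraNneq jF => <-.
pose x l := if l == j then 0 else w l; pose y l := if l == j then 1 else w l.
have xyE t l : x l + (y l - x l) * t = if l == j then t else w l.
  by rewrite /x /y; case: eqP; rewrite ?subr0 ?mul1r ?add0r // subrr mul0r addr0.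
have : line_poly x y f = 0.
  apply: (poly_nat_zeros eI) => m; rewrite horner_line; apply: IH => l.
    move=> lF; rewrite xyE; case: eqP => [ej|_]; last exact: Fw.
    by rewrite ej jF in lF.
  move=> lF ls; rewrite xyE; case: eqP => [_|/eqP lj]; first by exists m.
  by apply: ew => //; rewrite inE negb_or lj.
move/(congr1 (horner^~ (w j))); rewrite horner0 horner_line => h; rewrite -[RHS]h.
by apply: meval_eq => l; rewrite xyE; case: eqP => [->|].
Qed.

Lemma flat_subset p p' F F' : flat p F `<=` flat p' F' ->
  F \subset F' /\ flat p' F' p.
Proof.
move=> H; have Hp := H p (fun _ _ => erefl); split=> //.
apply/fintype.subsetP => j jF; apply: contrapT => /negP jF'.
have /H/(_ j jF') : flat p F (fun l => if l == j then p j + 1 else p l).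
  by move=> l lF; case: eqP => // ej; rewrite ej jF in lF.
rewrite eqxx -(Hp j jF') => /eqP; rewrite -subr_eq0 addrC addKr.
by rewrite oner_eq0.
Qed.

Section ExponentComplex.
Variables (T : finType) (P : T -> Prop) (pt : T -> 'I_n -> K) (Ft : T -> {set 'I_n}).
Variable V : set ('I_n -> K).
Hypothesis VE : forall v, V v <-> exists2 t, P t & flat (pt t) (Ft t) v.

(** An irreducible subset of V lies in one of the listed flats, so a listed flat of largest
    dimension among those containing the given one is a component. *)
Lemma flat_in_component p F : flat p F `<=` V ->
  exists X, irreducible_component V X /\ flat p F `<=` X.
Proof.
move=> FV; have VT X : zariski_irreducible X -> X `<=` V ->
    exists2 t, P t & X `<=` flat (pt t) (Ft t).
  move=> irrX XV; apply: irreducible_bigcup irrX _ => [t|v /XV/VE //].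
  exact: closed_flat.
have [t0 Pt0 Ft0] := VT _ (irreducible_flat p F) FV.
pose good t := `[< P t /\ flat p F `<=` flat (pt t) (Ft t) >].
have g0 : good t0 by apply/asboolP.
case: (arg_maxnP (fun t => #|Ft t|) g0) => t /asboolP[Pt tF] tmax.
exists (flat (pt t) (Ft t)); split=> //; split.
- by move=> v Fv; apply/VE; exists t.
- exact: irreducible_flat.
move=> Y irrY tY YV; have [t' Pt' Yt'] := VT Y irrY YV.
have [FF' pp'] := flat_subset (subset_trans tY Yt').
have /tmax cF : good t' by apply/asboolP; split=> //; apply: subset_trans Yt'; apply: subset_trans tY.
have eF : Ft t = Ft t' by apply/eqP; rewrite eqEcard FF'.
move=> v /Yt' vt' j jF; rewrite vt' -?eF //; apply: esym.
by apply: pp'; rewrite -eF.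
Qed.

Lemma exponent_complexE alpha F : exponent_complex V alpha F <->
  exists2 t, P t & F \subset Ft t /\ flat (pt t) (Ft t) alpha.
Proof.
have transl v : flat alpha F v <-> exists2 w, coord_subspace F w & v = (fun j => alpha j + w j).
  split=> [Fv|[w Fw ->] j jF]; last by rewrite Fw ?addr0.
  exists (fun j => v j - alpha j) => [j jF|]; first by rewrite Fv // subrr.
  by apply/funext => j; rewrite addrC subrK.
split=> [EF|[t Pt [FF' ta]]].
  have : flat alpha F `<=` [set v | exists2 t, P t & flat (pt t) (Ft t) v].
    move=> v /transl[w Fw ->]; have [X [[XV _ _] _ Xv]] := EF w Fw.
    exact/VE/XV.
  case/(irreducible_bigcup _ (irreducible_flat alpha F)) => [t|t Pt /flat_subset[FF' ta]].
    exact: closed_flat.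
  by exists t.
have [|X [compX FX]] := @flat_in_component alpha F.
  move=> v Fv; apply/VE; exists t => // j jF; rewrite Fv ?ta //.
  by apply: contra jF; apply: fintype.subsetP.
move=> w Fw; exists X; split=> //; first by apply: FX.
by apply: FX; apply/transl; exists w.
Qed.

End ExponentComplex.

End ZariskiFlats.

(** * Local cohomology in a fixed degree *)

Section CechDegree.
Variables (k : fieldType) (n : nat) (I : ideal {mpoly k[n]}).
Hypothesis Imon : monomial_ideal I.
Variable a : 'I_n -> int.
Local Notation S := {mpoly k[n]}.
Local Notation M := (ring_quot I).
Local Notation pr := (qproj I).
Local Notation X := (fun j : 'I_n => 'X_j : S).
Local Notation frac := Defs.frac.
Local Notation loc F := (localization M (xprod X F)).
Implicit Types (F G : {set 'I_n}) (e : nat) (u w : 'X_{1..n}) (y : M).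

Definition neg_support : {set 'I_n} := [set j | (a j < 0)%R].
Definition degree_complex : set {set 'I_n} :=
  [set F : {set 'I_n} | forall w : 'X_{1..n},
     (forall j, j \notin F -> (w j)%:Z = a j) -> 'X_[w] \notin I].

Lemma degree_complex_down F F' : F \subset F' -> degree_complex F' -> degree_complex F.
Proof.
move=> FF' F'D w wa; apply: F'D => j jF'; apply: wa.
by apply: contra jF'; apply: fintype.subsetP.
Qed.

(** The degree of the numerator of a degree a fraction over x_F^e; [deg_ok] says that it is an
    exponent vector, and only then is [deg_mnm] meaningful. *)
Definition deg_shift F e : 'I_n -> int := fun j => a j + (if j \in F then e%:Z else 0).
Definition deg_ok F e : bool := [forall j, (0 <= deg_shift F e j)%R].
Definition deg_mnm F e : 'X_{1..n} := [multinom absz (deg_shift F e j) | j < n].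

Lemma deg_mnmE F e j : deg_ok F e -> (deg_mnm F e j)%:Z = deg_shift F e j.
Proof. by move=> /forallP/(_ j) h; rewrite mnmE gez0_abs. Qed.

Lemma deg_ok_neg F e : deg_ok F e -> neg_support \subset F.
Proof.
move=> /forallP h; apply/fintype.subsetP => j; rewrite inE => aj.
by have := h j; rewrite /deg_shift; case: (j \in F) => //; lia.
Qed.

(** A single denominator exponent that is large enough for every F containing [neg_support]. *)
Definition height_bound : nat := (\sum_j absz (a j))%N.

Lemma height_bound_ge j : (absz (a j) <= height_bound)%N.
Proof. by rewrite /height_bound (bigD1 j) //= leq_addr. Qed.

Lemma deg_ok_large F e : neg_support \subset F -> (height_bound <= e)%N -> deg_ok F e.
Proof.
move=> /fintype.subsetP NF he; apply/forallP => j; rewrite /deg_shift.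
have := NF j; rewrite inE; have := height_bound_ge j.
case: (j \in F) => hb NFj; first by lia.
by rewrite addr0; case: (a j) NFj => // m /(_ isT).
Qed.

Lemma deg_mnm_notin F e : degree_complex F -> deg_ok F e -> 'X_[deg_mnm F e] \notin I.
Proof.
by move=> DF ok; apply: DF => j jF; rewrite deg_mnmE // /deg_shift (negPf jF) addr0.
Qed.

Definition coefM u y : k := (repr (y : Quotient.quot I))@_u.

Lemma coefM_proj u p : 'X_[u] \notin I -> coefM u (pr p) = p@_u.
Proof.
move=> uI; apply/eqP; rewrite -subr_eq0 -mcoeffB; apply/eqP.
apply: memN_msupp_eq0; apply/negP => hu.
have /(monomial_idealP _ Imon)/(_ _ hu) := repr_qproj I p.
exact/negP.
Qed.

Lemma coefMB u y y' : 'X_[u] \notin I -> coefM u (y - y') = coefM u y - coefM u y'.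
Proof.
move=> uI; have [p ->] := qprojP y; have [q ->] := qprojP y'.
by rewrite -rmorphB !coefM_proj // mcoeffB.
Qed.

Lemma coefM0 u : 'X_[u] \notin I -> coefM u 0 = 0.
Proof. by move=> uI; rewrite -[0](rmorph0 pr) coefM_proj // mcoeff0. Qed.

Lemma xprodE F : xprod X F = 'X_[mesym1 F].
Proof. exact: xprod_mesym1. Qed.

Lemma coefM_shift F e u y : 'X_[u] \notin I ->
  coefM u (xprod X F ^+ e *: y) =
    if (mesym1 F *+ e <= u)%MM then coefM (u - mesym1 F *+ e)%MM y else 0.
Proof.
move=> uI; have [p ->] := qprojP y.
have -> : xprod X F ^+ e *: pr p = pr (p * 'X_[mesym1 F *+ e]).
  by rewrite xprodE mpolyXn mulrC; apply: qscaleE.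
rewrite [LHS]coefM_proj //; case: ifPn => eu.
  have uI' : 'X_[u - mesym1 F *+ e] \notin I.
    by apply: contra uI; apply: ideal_lepm; apply: lem_subr.
  by rewrite coefM_proj // -{1}(submK eu) addmC mcoeffMX.
apply: memN_msupp_eq0; apply: contra eu => /msuppM_le/allpairsP[[v w] /=].
by rewrite msuppX inE => -[_ /eqP-> ->]; apply: lem_addl.
Qed.

(* The coefficient of x^a in the fraction y / x_F^e. *)
Definition coef_pair F y e : k := if deg_ok F e then coefM (deg_mnm F e) y else 0.

Lemma coef_pair_res F G e y : F \subset G -> degree_complex G ->
  coef_pair G (xprod X (G :\: F) ^+ e *: y) e = coef_pair F y e.
Proof.
move=> FG DG; have DF := degree_complex_down FG DG.
rewrite /coef_pair; case: ifPn => okG; last first.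
  rewrite ifN //; apply: contra okG => /forallP ok; apply/forallP => j.
  have := ok j; rewrite /deg_shift; have := fintype.subsetP FG j.
  by case: (j \in F) => [/(_ isT) ->|_] //=; case: (j \in G) => /=; lia.
rewrite coefM_shift; last exact: deg_mnm_notin.
have shE j : j \in G :\: F -> deg_shift G e j = a j + e%:Z.
  by rewrite inE => /andP[_ jG]; rewrite /deg_shift jG.
case: (boolP (deg_ok F e)) => okF.
  have le : (mesym1 (G :\: F) *+ e <= deg_mnm G e)%MM.
    apply/mnm_lepP => j; rewrite mulmnE mnmE; case: (boolP (j \in _)) => // jGF.
    rewrite mul1n -lez_nat deg_mnmE // shE //.
    by move/forallP/(_ j): okF; move: jGF; rewrite inE /deg_shift => /andP[/negPf-> _]; lia.
  rewrite le; congr coefM; apply/mnmP => j; apply/eqP; rewrite -eqz_nat.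
  rewrite mnmBE -subzn ?(mnm_lepP le) // !deg_mnmE // mulmnE mnmE inE /deg_shift.
  have := fintype.subsetP FG j.
  by case: (j \in F) => [/(_ isT) ->|_] //=; case: (j \in G) => /=; lia.
rewrite ifN //; apply: contra okF => /mnm_lepP le; apply/forallP => j.
have := le j; rewrite mulmnE mnmE inE -lez_nat deg_mnmE //.
move/forallP/(_ j): okG; rewrite /deg_shift; have := fintype.subsetP FG j.
by case: (j \in F) => [/(_ isT) ->|_] //=; case: (j \in G) => /=; lia.
Qed.

Lemma coef_pair_expand F e L y : degree_complex F ->
  coef_pair F (xprod X F ^+ L *: y) (e + L) = coef_pair F y e.
Proof.
move=> DF; rewrite /coef_pair; case: ifPn => okL; last first.
  rewrite ifN //; apply: contra okL => /forallP ok; apply/forallP => j.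
  by have := ok j; rewrite /deg_shift; case: (j \in F); lia.
rewrite coefM_shift; last exact: deg_mnm_notin.
case: (boolP (deg_ok F e)) => ok.
  have le : (mesym1 F *+ L <= deg_mnm F (e + L))%MM.
    apply/mnm_lepP => j; rewrite mulmnE mnmE; case: (boolP (j \in _)) => // jF.
    rewrite mul1n -lez_nat deg_mnmE // /deg_shift jF.
    by move/forallP/(_ j): ok; rewrite /deg_shift jF; lia.
  rewrite le; congr coefM; apply/mnmP => j; apply/eqP; rewrite -eqz_nat.
  rewrite mnmBE -subzn ?(mnm_lepP le) // !deg_mnmE // mulmnE mnmE /deg_shift.
  by case: (j \in F); lia.
rewrite ifN //; apply: contra ok => /mnm_lepP le; apply/forallP => j.
have := le j; rewrite mulmnE mnmE -lez_nat deg_mnmE //.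
by move/forallP/(_ j): okL; rewrite /deg_shift; case: (j \in F); lia.
Qed.

Lemma coef_pairD F y y' e : degree_complex F ->
  coef_pair F (y + y') e = coef_pair F y e + coef_pair F y' e.
Proof.
move=> DF; rewrite /coef_pair; case: ifPn => ok; last by rewrite addr0.
have uI := deg_mnm_notin DF ok.
by rewrite -[in LHS](opprK y') coefMB // -(sub0r y') coefMB // coefM0 // sub0r opprK.
Qed.

Definition coef_loc F (v : loc F) : k := coef_pair F (repr v).1 (repr v).2.

(** Both representatives are expanded to a common denominator exponent; F must belong to the degree
    complex for coefficients to survive the passage to classes modulo I. *)
Lemma coef_locE F y e : degree_complex F ->
  coef_loc (frac (xprod X F) y e) = coef_pair F y e.
Proof.
move=> DF; have /frac_eq[N] := frac_repr (frac (xprod X F) y e).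
rewrite /coef_loc; move: (repr _) => [y' e'] /= eN.
rewrite -(coef_pair_expand e' (N + e) y' DF) eN -(coef_pair_expand e (N + e') y DF).
by congr coef_pair; lia.
Qed.

Lemma coef_loc0 F : degree_complex F -> coef_loc (0 : loc F) = 0.
Proof.
move=> DF; rewrite coef_locE // /coef_pair; case: ifPn => ok //.
by rewrite coefM0 // deg_mnm_notin.
Qed.

Lemma coef_locD F (v w : loc F) : degree_complex F ->
  coef_loc (v + w) = coef_loc v + coef_loc w.
Proof.
move=> DF; have [y [e ->]] := fracP v; have [y' [e' ->]] := fracP w.
rewrite [_ + _]loc_addE !coef_locE // coef_pairD //.
by rewrite coef_pair_expand // addnC coef_pair_expand.
Qed.

Lemma coef_locN F (v : loc F) : degree_complex F -> coef_loc (- v) = - coef_loc v.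
Proof.
move=> DF; apply/eqP; rewrite -addr_eq0 addrC; apply/eqP.
by rewrite -coef_locD // subrr coef_loc0.
Qed.

Lemma coef_loc_sum F (T : finType) (P : pred T) (v : T -> loc F) : degree_complex F ->
  coef_loc (\sum_(t | P t) v t) = \sum_(t | P t) coef_loc (v t).
Proof.
by move=> DF; apply: big_morph => [x y|]; [apply: coef_locD|apply: coef_loc0].
Qed.

Lemma coef_loc_sign F (v : loc F) m : degree_complex F ->
  coef_loc (v *~ (-1) ^+ m) = (-1) ^+ m * coef_loc v.
Proof.
move=> DF; rewrite -signr_odd -[in RHS]signr_odd; case: odd.
  by rewrite !expr1 mulrNz mulr1z mulN1r coef_locN.
by rewrite !expr0 mulr1z mul1r.
Qed.

Lemma coef_loc_res F G (v : loc F) : F \subset G -> degree_complex G ->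
  coef_loc (cech_res G v) = coef_loc v.
Proof.
move=> FG DG; have DF := degree_complex_down FG DG; have [y [e ->]] := fracP v.
by rewrite cech_resE // !coef_locE // coef_pair_res.
Qed.

Lemma coef_loc_d (c : cech_cochain M X) G : degree_complex G ->
  coef_loc (cech_d c G) = kd (fun=> 1) (fun F => coef_loc (c F)) G.
Proof.
move=> DG; rewrite /cech_d coef_loc_sum //; apply: eq_bigr => j jG.
by rewrite coef_loc_sign // coef_loc_res ?finset.subsetDl // mulr1.
Qed.

Lemma coef_loc_above F (v : loc F) : ~~ (neg_support \subset F) -> coef_loc v = 0.
Proof. by rewrite /coef_loc /coef_pair => NF; rewrite ifN //; apply: contra NF => /deg_ok_neg. Qed.

(** The fraction t x^a in a normal form with fixed denominator; 0 when x^a has a negative exponent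
    outside F. *)
Definition hom_elt F (t : k) : loc F :=
  if neg_support \subset F
  then frac (xprod X F) (pr (t *: 'X_[deg_mnm F height_bound])) height_bound else 0.

Lemma frac_scale F e L y :
  frac (xprod X F) (xprod X F ^+ L *: y) (e + L) = frac (xprod X F) y e.
Proof. by apply/frac_eq; exists 0%N; rewrite scalerA -exprD add0n. Qed.

Lemma frac0 F e : frac (xprod X F) (0 : M) e = 0.
Proof. by apply/frac_eq; exists 0%N; rewrite !scaler0. Qed.

Lemma hom_eltD F t t' : hom_elt F (t + t') = hom_elt F t + hom_elt F t'.
Proof.
rewrite /hom_elt; case: ifP => _; last by rewrite addr0.
rewrite [RHS]loc_addE -scalerDr frac_scale; congr frac.
by rewrite scalerDl rmorphD.
Qed.

Lemma hom_elt0 F : hom_elt F 0 = 0.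
Proof. by rewrite /hom_elt scale0r rmorph0 frac0; case: ifP. Qed.

Lemma hom_eltN F t : hom_elt F (- t) = - hom_elt F t.
Proof.
by apply/eqP; rewrite -addr_eq0 -hom_eltD addNr hom_elt0.
Qed.

Lemma hom_elt_sign F t m : hom_elt F ((-1) ^+ m * t) = hom_elt F t *~ (-1) ^+ m.
Proof.
rewrite -signr_odd -[in RHS]signr_odd; case: odd.
  by rewrite !expr1 mulrNz mulr1z mulN1r hom_eltN.
by rewrite !expr0 mulr1z mul1r.
Qed.

Lemma hom_elt_coef F t : degree_complex F -> neg_support \subset F ->
  coef_loc (hom_elt F t) = t.
Proof.
move=> DF NF; rewrite /hom_elt NF coef_locE // /coef_pair deg_ok_large //.
by rewrite coefM_proj ?deg_mnm_notin ?deg_ok_large // mcoeffZ mcoeffX eqxx mulr1.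
Qed.

Lemma scaleX_proj F L u t :
  xprod X F ^+ L *: pr (t *: 'X_[u]) = pr (t *: 'X_[mesym1 F *+ L + u]).
Proof.
rewrite xprodE mpolyXn; have -> : 'X_[mesym1 F *+ L] *: pr (t *: 'X_[u]) =
  pr ('X_[mesym1 F *+ L] * (t *: 'X_[u])) by apply: qscaleE.
by rewrite -scalerAr mpolyXD.
Qed.

Lemma deg_mnm_expand F e L : deg_ok F e ->
  (mesym1 F *+ L + deg_mnm F e)%MM = deg_mnm F (e + L).
Proof.
move=> ok; have ok' : deg_ok F (e + L).
  apply/forallP => j; move/forallP/(_ j): ok; rewrite /deg_shift.
  by case: (j \in F); lia.
apply/mnmP => j; apply/eqP; rewrite -eqz_nat mnmDE PoszD !deg_mnmE // mulmnE mnmE.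
by rewrite /deg_shift; case: (j \in F); lia.
Qed.

Lemma frac_hom F e t : deg_ok F e ->
  frac (xprod X F) (pr (t *: 'X_[deg_mnm F e])) e = hom_elt F t.
Proof.
move=> ok; rewrite /hom_elt (deg_ok_neg ok).
rewrite -(frac_scale F e height_bound) -(frac_scale F height_bound e) !scaleX_proj.
rewrite !deg_mnm_expand ?[(e + _)%N]addnC // deg_ok_large //.
exact: deg_ok_neg ok.
Qed.

Lemma hom_elt_res F G t : F \subset G -> neg_support \subset F ->
  cech_res G (hom_elt F t) = hom_elt G t.
Proof.
move=> FG NF; have NG := fintype.subset_trans NF FG.
rewrite /hom_elt NF NG cech_resE // scaleX_proj; congr (frac _ (pr (_ *: 'X_[_])) _).
have okF := deg_ok_large NF (leqnn _); have okG := deg_ok_large NG (leqnn _).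
apply/mnmP => j; apply/eqP; rewrite -eqz_nat mnmDE PoszD !deg_mnmE // mulmnE mnmE.
rewrite inE /deg_shift; have := fintype.subsetP FG j.
by case: (j \in F) => [/(_ isT) ->|_] //=; case: (j \in G) => /=; lia.
Qed.

Lemma cech_res0 F G : F \subset G -> cech_res G (0 : loc F) = 0.
Proof. by move=> FG; rewrite cech_resE // scaler0 frac0. Qed.

(** Some monomial of I agrees with x^a outside F, so a power of x_F carries the numerator into I. *)
Lemma hom_elt_offcomplex F t : ~ degree_complex F -> hom_elt F t = 0.
Proof.
move=> nD; rewrite /hom_elt; case: ifPn => // NF.
have [w wa wI] : exists2 w : 'X_{1..n},
      (forall j, j \notin F -> (w j)%:Z = a j) & 'X_[w] \in I.
  apply: contrapT => h; apply: nD => w wa; apply/negP => wI; apply: h.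
  by exists w.
rewrite -(frac_scale F _ (mdeg w)) scaleX_proj.
suff /qproj_eq0 -> : t *: 'X_[mesym1 F *+ mdeg w + deg_mnm F height_bound] \in I.
  exact: frac0.
apply: ideal_scale; apply: ideal_lepm wI; apply/mnm_lepP => j.
rewrite mnmDE mulmnE mnmE; have [jF|jF] := boolP (j \in F).
  by rewrite mul1n (leq_trans _ (leq_addr _ _)) // mdegE (bigD1 j) //= leq_addr.
rewrite mul0n -lez_nat wa // deg_mnmE ?deg_ok_large //.
by rewrite /deg_shift (negPf jF) addr0.
Qed.

Lemma cech_d_hom (g : {set 'I_n} -> k) (c : cech_cochain M X) G :
  (forall j, j \in G -> c (G :\ j) = hom_elt (G :\ j) (g (G :\ j))) ->
  (forall j, j \in G -> above neg_support (G :\ j) (g (G :\ j))) ->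
  cech_d c G = hom_elt G (kd (fun=> 1) g G).
Proof.
move=> cE gA; rewrite /cech_d /kd.
rewrite (big_morph (hom_elt G) (@hom_eltD G) (hom_elt0 G)).
apply: eq_bigr => j jG; rewrite mulr1 hom_elt_sign; congr (_ *~ _); rewrite cE //.
have [N|->] := gA j jG; first by rewrite hom_elt_res ?finset.subsetDl.
by rewrite !hom_elt0 cech_res0 ?finset.subsetDl.
Qed.

Lemma homogeneousE (c : cech_cochain M X) F :
  cech_homogeneous (quot_grading (I := I)) a c ->
  exists2 t, c F = hom_elt F t & above neg_support F t.
Proof.
move=> /(_ F)[y [e [[p [-> pm]] ->]]].
have pE u : u \in msupp p -> deg_ok F e /\ u = deg_mnm F e.
  move=> /pm h; have ok : deg_ok F e.
    by apply/forallP => j; rewrite /deg_shift -h.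
  by split=> //; apply/mnmP => j; apply/eqP; rewrite -eqz_nat h deg_mnmE.
have [p0|p0] := eqVneq p 0.
  by exists 0; [rewrite p0 rmorph0 frac0 hom_elt0|right].
have [ok _] := pE _ (mlead_supp p0); exists (p@_(deg_mnm F e)).
  rewrite -(frac_hom _ ok); congr (frac _ (pr _) _).
  apply/mpolyP => u; rewrite mcoeffZ mcoeffX.
  case: eqP => [->|ne]; rewrite ?mulr1 // mulr0.
  by apply: memN_msupp_eq0; apply/negP => /pE[_ e']; apply: ne.
by left; apply: deg_ok_neg ok.
Qed.

Lemma tdeg_lcE i : tdeg_lc I i a <->
  ~ kvan (fun=> 1) [set: 'I_n] (above neg_support) (@off k n degree_complex) i.
Proof.
split.
  move=> [c [[conc cocy] hom ncob]] kv; apply: ncob.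
  have [F _ _|F _ eF DF|b [Ub Jb]] := kv (fun F => coef_loc (c F)).
  - have [N|N] := boolP (neg_support \subset F); first by left.
    by right; apply: coef_loc_above.
  - by rewrite -coef_loc_d // cocy coef_loc0.
  pose b' F : loc F := if (#|F|.+1 == i)%N then hom_elt F (b F) else 0.
  exists b'; split=> [F Fi|G]; first by rewrite /b' (negPf Fi).
  have [Gi|Gi] := eqVneq #|G| i; last first.
    rewrite conc // /cech_d big1 // => j jG; rewrite /b' ifN ?cech_res0 ?mul0rz ?finset.subsetDl //.
    by apply: contra Gi => /eqP <-; rewrite (cardsD1 j G) jG.
  have Gj j : j \in G -> (#|G :\ j|.+1 = i)%N by move=> jG; rewrite -Gi (cardsD1 j G) jG.
  rewrite (@cech_d_hom b) => [|j jG|j jG]; last first.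
  - exact/Ub/Gj.
  - by rewrite /b' Gj ?eqxx.
  have [t et tA] := homogeneousE G hom.
  have [DG|nDG] := pselect (degree_complex G); last by rewrite et !hom_elt_offcomplex.
  rewrite et; congr hom_elt.
  have /eqP := Jb G (finset.subsetT _) Gi DG; rewrite subr_eq0 et => /eqP <-.
  by case: tA => [N|->]; [rewrite hom_elt_coef|rewrite hom_elt0 coef_loc0].
move=> nkv; apply: contrapT => nc; apply: nkv => g Ug Jg; apply: contrapT => ng.
apply: nc; pose c F : loc F := if (#|F| == i)%N then hom_elt F (g F) else 0.
have cE G j : #|G| = i.+1 -> j \in G -> c (G :\ j) = hom_elt (G :\ j) (g (G :\ j)).
  by move=> Gi jG; rewrite /c ifT // -eqSS -Gi (cardsD1 j G) jG.
exists c; split; first split.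
- by move=> F Fi; rewrite /c (negPf Fi).
- move=> G; have [Gi|Gi] := eqVneq #|G| i.+1; last first.
    rewrite /cech_d big1 // => j jG; rewrite /c ifN ?cech_res0 ?mul0rz ?finset.subsetDl //.
    by apply: contra Gi => /eqP <-; rewrite (cardsD1 j G) jG.
  rewrite (@cech_d_hom g) => [|j jG|j jG]; last first.
  + by apply: Ug => //; move: Gi; rewrite (cardsD1 j) jG => -[].
  + exact: cE.
  have [DG|nDG] := pselect (degree_complex G); last exact: hom_elt_offcomplex.
  by rewrite Jg ?hom_elt0.
- move=> F; rewrite /c; case: ifP => [Fi|_]; last first.
    by exists 0, 0%N; split; [exists 0; split; [rewrite rmorph0|move=> u; rewrite msupp0]|rewrite frac0].
  rewrite /hom_elt; case: ifPn => NF; last first.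
    by exists 0, 0%N; split; [exists 0; split; [rewrite rmorph0|move=> u; rewrite msupp0]|rewrite frac0].
  exists (pr (g F *: 'X_[deg_mnm F height_bound])), height_bound; split=> //.
  exists (g F *: 'X_[deg_mnm F height_bound]); split=> // u /msuppZ_le.
  by rewrite msuppX inE => /eqP-> j; rewrite deg_mnmE // deg_ok_large.
move=> [b [b0 cb]]; apply: ng; exists (fun F => coef_loc (b F)); split=> F _ Fi.
  have [N|N] := boolP (neg_support \subset F); first by left.
  by right; apply: coef_loc_above.
move=> DF; have [N|N] := boolP (neg_support \subset F).
  by rewrite -coef_loc_d // -cb /c Fi eqxx hom_elt_coef // subrr.
rewrite -coef_loc_d // (coef_loc_above _ N) subr0.
have := Ug F (finset.subsetT _) Fi; by case=> // N'; rewrite N' in N.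
Qed.

End CechDegree.

(** * Quasidegrees *)

Lemma kvan_above_ext (k : fieldType) n (G : {set 'I_n}) (J J' : {set 'I_n} -> set k) i :
  mono_fam J -> mono_fam J' -> (forall F : {set 'I_n}, G \subset F -> J F = J' F) ->
  kvan (fun=> 1) [set: 'I_n] (above G) J i -> kvan (fun=> 1) [set: 'I_n] (above G) J' i.
Proof.
move=> mJ mJ' JJ'; have [ltiG _|leGi] := ltnP i #|G|; first exact: kvan_above_lt.
rewrite -(subnK leGi) !kvan_above //; apply: kvan_ext => // F _.
by rewrite /shift_fam JJ' // finset.subsetUl.
Qed.

Lemma kvan_above_cone (k : fieldType) n (G : {set 'I_n}) (D : set {set 'I_n}) j i :
  (forall F F' : {set 'I_n}, F \subset F' -> D F' -> D F) -> j \notin G ->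
  (forall F : {set 'I_n}, G \subset F -> D F -> D (j |: F)) ->
  kvan (fun=> 1) [set: 'I_n] (above G) (@off k n D) i.
Proof.
move=> Ddown jG Dj.
(* The cone condition is known only above G. This complex agrees with D there and has j as a cone
   point everywhere. *)
pose D' : set {set 'I_n} := [set F | D (G :|: F)].
have D'down (F F' : {set 'I_n}) : F \subset F' -> D' F' -> D' F.
  by move=> FF'; apply: Ddown; apply: finset.setUS.
apply: (@kvan_above_ext _ _ G (off D')); try exact: mono_fam_off.
  by move=> F GF; rewrite /off /D' /= (finset.setUidPr GF).
rewrite -(finset.setD1K (finset.in_setT j)); apply: kvan_acyclic => //.
- by rewrite !inE eqxx.
- exact: mono_fam_stable (mono_fam_above _ _).
- exact: mono_fam_stable (@mono_fam_off k n D' D'down).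
- move=> F _; apply/seteqP; split=> x [GF|->]; try by right.
    left; apply/fintype.subsetP => l lG; have := fintype.subsetP GF l lG.
    by rewrite !inE => /predU1P[ej|//]; rewrite -ej lG in jG.
  by left; apply: fintype.subset_trans GF (finset.subsetUr _ _).
move=> F _; rewrite /off /D' /= finset.setUCA.
apply/seteqP; split=> x Hx DF; apply: Hx; last by apply: Ddown DF; apply: finset.subsetUr.
by apply: Dj => //; apply: finset.subsetUl.
Qed.

Section Quasidegrees.
Variables (k : fieldType) (n : nat) (R : realType) (I : ideal {mpoly k[n]}).
Hypothesis Imon : monomial_ideal I.
Local Notation Up := [set u : 'X_{1..n} | 'X_[u] \in I].
Local Notation V := (@distracting_arrangement k n R I).
Implicit Types (F G : {set 'I_n}) (u : 'X_{1..n}).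

Let UpM u (w : 'X_{1..n}) : (u <= w)%MM -> Up u -> Up w.
Proof. exact: ideal_lepm. Qed.

Variable B : nat.
Hypothesis UpB : forall u, Up u -> Up (mnm_trunc B u).

Let nat_pt u : 'I_n -> R[i] := fun j => (u j)%:R.

Let e1I : injective (fun m : nat => m%:R : R[i]).
Proof. exact: natr_inj. Qed.

Lemma flat_distracting u F : standard_flat Up u F -> flat (nat_pt u) F `<=` V.
Proof.
move=> uF v /(closure_grid e1I); apply: closure_mono => {}v [vu vm].
have /choice [m Hm] : forall j, exists m, v j = m%:R :> R[i].
  move=> j; have [jF|jF] := boolP (j \in F); first exact: vm.
  by exists (u j); apply: vu.
exists [multinom m j | j < n] => /=; last by apply/funext => j; rewrite mnmE.
apply/negP; apply: uF => j jF; rewrite mnmE; apply: e1I.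
by rewrite -Hm vu.
Qed.

Let pt (w : {ffun 'I_n -> 'I_B.+1}) := nat_pt (ffun_mnm w).
Let Ft (w : {ffun 'I_n -> 'I_B.+1}) : {set 'I_n} :=
  [set j : 'I_n | (B <= ffun_mnm w j)%N].
Let good (w : {ffun 'I_n -> 'I_B.+1}) : Prop := ~ Up (ffun_mnm w).

Let good_flat w : good w -> standard_flat Up (ffun_mnm w) (Ft w).
Proof. exact: standard_flat_trunc. Qed.

Lemma distractingE v : V v <-> exists2 w, good w & flat (pt w) (Ft w) v.
Proof.
split=> [Vv|[w /good_flat/flat_distracting]]; last exact.
suff : zariski_closed [set v | exists2 w, good w & flat (pt w) (Ft w) v].
  apply; apply: closure_mono Vv => _ [u /= uI <-].
  pose w : {ffun 'I_n -> 'I_B.+1} := [ffun j => inord (minn (u j) B)].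
  have wE j : ffun_mnm w j = minn (u j) B.
    by rewrite mnmE ffunE inordK // ltnS geq_minr.
  exists w.
    move=> wI; case/negP: uI; apply: ideal_lepm wI.
    by apply/mnm_lepP => j; rewrite wE geq_minl.
  move=> j; rewrite inE wE => Bj; rewrite /pt /nat_pt wE; congr _%:R.
  by move: Bj; rewrite /minn; case: ltnP => //; rewrite leqnn.
by apply: closed_bigcup => w; apply: closed_flat.
Qed.

(** The exponent complex expressed through translates u + N^F' contained in Lambda_I rather than
    components of its closure. *)
Definition local_complex (beta : 'I_n -> R[i]) : set {set 'I_n} :=
  [set F : {set 'I_n} | exists u (F' : {set 'I_n}), [/\ F \subset F', standard_flat Up u F' &
     forall j, j \notin F' -> beta j = (u j)%:R]].

Lemma local_complex_down beta F F' : F \subset F' ->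
  local_complex beta F' -> local_complex beta F.
Proof.
move=> FF' [u [F'' [F'F'' uF'' eu]]]; exists u, F''; split=> //.
exact: fintype.subset_trans F'F''.
Qed.

Lemma exponent_complex_local beta : exponent_complex V beta = local_complex beta.
Proof.
apply/seteqP; split=> F.
  move=> /(exponent_complexE distractingE)[w wI [FF' wb]].
  exists (ffun_mnm w), (Ft w); split=> //; exact: good_flat.
move=> [u [F' [FF' uF' eb]]]; apply/(exponent_complexE distractingE).
have sub : flat (nat_pt u) F' `<=` [set v | exists2 w, good w & flat (pt w) (Ft w) v].
  by move=> v /(flat_distracting uF')/distractingE.
have [w|w wI fw] := irreducible_bigcup _ (irreducible_flat _ _) sub.
  exact: closed_flat.
exists w => //; have [F'w _] := flat_subset fw; split; last by apply: fw.
exact: fintype.subset_trans F'w.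
Qed.

Lemma local_complex0 beta : local_complex beta finset.set0 <-> V beta.
Proof.
split=> [[u [F [_ uF eb]]]|/distractingE[w wI wb]].
  exact: (flat_distracting uF).
by exists (ffun_mnm w), (Ft w); split=> //; [apply: finset.sub0set|apply: good_flat].
Qed.

Lemma degree_complex_local (a : 'I_n -> int) beta F :
  (forall j, j \notin neg_support a -> beta j = (a j)%:~R) -> neg_support a \subset F ->
  degree_complex I a F <-> local_complex beta F.
Proof.
move=> ab NF; have aF j : j \notin F -> (absz (a j))%:Z = a j.
  move=> jF; rewrite gez0_abs // leNgt; apply: contra jF => aj.
  by apply: (fintype.subsetP NF); rewrite inE.
have bF j : j \notin F -> beta j = (absz (a j))%:R.
  move=> jF; rewrite ab; first by rewrite -{1}(aF j jF) pmulrn.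
  by apply: contra jF; apply: fintype.subsetP.
split=> [aD|[u [F' [FF' uF' eb]]] w wa].
  exists [multinom absz (a j) | j < n], F; split=> // [w wu wI|j jF].
    suff /negP : 'X_[w] \notin I by apply.
    by apply: aD => j jF; rewrite wu // mnmE aF.
  by rewrite mnmE bF.
apply/negP; apply: uF' => j jF'.
have jF : j \notin F by apply: contra jF'; apply: fintype.subsetP.
apply: e1I; rewrite -eb // bF //; congr _%:R.
by apply/eqP; rewrite -eqz_nat wa // aF.
Qed.

Let lmono beta := @mono_fam_off k n _ (@local_complex_down beta).

Lemma kvan_local (a : 'I_n -> int) beta i :
  (forall j, j \notin neg_support a -> beta j = (a j)%:~R) ->
  tdeg_lc I i a <->
  ~ kvan (fun=> 1) [set: 'I_n] (above (neg_support a)) (@off k n (local_complex beta)) i.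
Proof.
move=> ab; have JJ F : neg_support a \subset F ->
    off (degree_complex I a) F = @off k n (local_complex beta) F.
  by move=> NF; rewrite /off (propext (degree_complex_local ab NF)).
have mD := @mono_fam_off k n _ (@degree_complex_down k n I a).
rewrite tdeg_lcE //; split=> nk kv; apply: nk; apply: kvan_above_ext kv => //.
by move=> F /JJ.
Qed.

(** Whether a is a true degree depends only on its set of negative coordinates and on the other
    coordinates. A true degree has its nonnegative coordinates bounded by B, so finitely many flats
    cover all of them; conversely the negative coordinates vary freely and are dense. *)
Lemma qdeg_local (beta : 'I_n -> R[i]) i : @qdeg n R (tdeg_lc I i) beta <-> exists G,
  (forall j, j \notin G -> exists m : nat, beta j = m%:R) /\
  ~ kvan (fun=> 1) [set: 'I_n] (above G) (@off k n (local_complex beta)) i.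
Proof.
pose acan (Gw : {set 'I_n} * {ffun 'I_n -> 'I_B.+1}) (j : 'I_n) : int :=
  if j \in Gw.1 then -1 else (Gw.2 j : nat)%:Z.
have Nacan Gw : neg_support (acan Gw) = Gw.1.
  by apply/setP => j; rewrite inE /acan; case: ifP.
split.
  move=> Tb.
  have : zariski_closed [set v : 'I_n -> R[i] | exists2 Gw, tdeg_lc I i (acan Gw) &
      flat (fun j => (acan Gw j)%:~R) Gw.1 v].
    by apply: closed_bigcup => Gw; apply: closed_flat.
  move=> /(_ beta) H; case: H => [|[G w] aT ab].
    apply: closure_mono Tb => _ [a aT <-].
    pose w : {ffun 'I_n -> 'I_B.+1} := [ffun j => inord (absz (a j))].
    have aE j : j \notin neg_support a -> a j = (acan (neg_support a, w) j).
      move=> jN; rewrite /acan /= (negPf jN) ffunE.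
      have a0 : (0 <= a j)%R by rewrite leNgt; move: jN; rewrite inE.
      rewrite inordK ?gez0_abs // ltnS leqNgt; apply/negP => Ba.
      (* A coordinate above B is a cone point, because membership in I ignores the excess over B;
         such a degree carries no cohomology. *)
      move/(tdeg_lcE Imon): aT; apply.
      apply: (@kvan_above_cone _ _ _ _ j) => //; first exact: degree_complex_down.
      move=> F NF DF u ua; apply/negP => /UpB uI.
      pose u' : 'X_{1..n} := [multinom if l == j then absz (a j) else u l | l < n].
      have /negP : 'X_[u'] \notin I.
        apply: DF => l lF; rewrite mnmE; case: eqP => [->|/eqP lj].
          by rewrite gez0_abs.
        by apply: ua; rewrite !inE negb_or lj.
      apply; apply: ideal_lepm uI; apply/mnm_lepP => l; rewrite !mnmE.
      case: eqP => [->|_]; last exact: geq_minl.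
      by apply: leq_trans (geq_minr _ _) (ltnW Ba).
    exists (neg_support a, w) => [|j jN] /=; last by rewrite aE.
    pose be : 'I_n -> R[i] := fun j => (a j)%:~R.
    have nk := (@kvan_local a be i (fun _ _ => erefl)).1 aT.
    apply/(@kvan_local _ be); rewrite Nacan // => j jN.
    by rewrite /be (aE j jN).
  exists G; split=> [j jG|].
    by exists (w j); rewrite ab // /acan /= (negPf jG).
  by rewrite -[G](Nacan (G, w)); apply/kvan_local => // j; rewrite Nacan; apply: ab.
move=> [G [bG nk]].
pose e m : R[i] := (- (m.+1)%:Z)%:~R.
have eI : injective e.
  by move=> x y /eqP; rewrite eqr_int => /eqP; lia.
have : flat beta G beta by [].
move=> /(closure_grid eI); apply: closure_mono => v [vb ve].
have /choice [a Ha] : forall j, exists z : int, v j = z%:~R /\ (z < 0)%R = (j \in G).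
  move=> j; have [jG|jG] := boolP (j \in G).
    by have [m ->] := ve j jG; exists (- (m.+1)%:Z).
  by have [m em] := bG j jG; exists m%:Z; rewrite vb // em.
have NG : neg_support a = G by apply/setP => j; rewrite inE (Ha j).2.
exists a; last by apply/funext => j; rewrite (Ha j).1.
apply/(@kvan_local a beta); rewrite NG // => j jG.
by rewrite -vb // (Ha j).1.
Qed.

(** The integrality condition of [qdeg_local] is automatic: if beta j is not a natural number, every
    standard translate through beta contains the direction j, so j is a cone point and the
    cohomology above a G without j vanishes. *)
Lemma qdeg_link_vanishing (beta : 'I_n -> R[i]) d :
  (exists i, (i < d)%N /\ @qdeg n R (tdeg_lc I i) beta) <->
  ~ link_vanishing (@off k n (local_complex beta)) d.
Proof.
rewrite (link_vanishingE _ (lmono beta)); split.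
  by move=> [i [id /qdeg_local[G [_ nk]]]] H; apply: nk; apply: H.
move=> nH; apply: contrapT => h; apply: nH => G i id; apply: contrapT => nk.
apply: h; exists i; split=> //; apply/qdeg_local; exists G; split=> // j jG.
apply: contrapT => nb; apply: nk; apply: (@kvan_above_cone _ _ _ _ j) => //.
  exact: local_complex_down.
move=> F GF [u [F' [FF' uF' eb]]]; exists u, F'; split=> //.
rewrite finset.subUset FF' finset.sub1set andbT; apply: contrapT => /negP jF'.
by apply: nb; exists (u j); apply: eb.
Qed.

End Quasidegrees.

Lemma void_complex (k : fieldType) n (D : set {set 'I_n}) d :
  (forall F, ~ D F) -> CM_complex k D /\ link_vanishing (@off k n D) d.
Proof.
move=> nD; split=> [P [P1 _]|L i _].
  case/negP: P1; suff -> : 1 = 0 :> stanley_reisner_ring k D by apply: rpred0.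
  rewrite -(rmorph1 (qproj (stanley_reisner_ideal k D))); apply/qproj_eq0.
  apply: generated_ideal_mem; exists finset.set0; first exact: nD.
  by rewrite /xprod big_set0.
by move=> c _ _; exists (fun=> 0); split=> // F _ _ /nD.
Qed.

Theorem theorem4p7 (k : fieldType) (n : nat) (R : realType)
    (I : ideal {mpoly k[n]}) (hI : monomial_ideal I)
    (d : nat) (hd : krull_dim (ring_quot I) d) (alpha : 'I_n -> R) :
  ~ CM_near_of_dim k (distracting_arrangement I) d alpha <->
  exists i : nat, (i < d)%N /\ qdegR (tdeg_lc I i) alpha.
Proof.
have [B UpB] := @dickson_bound n [set u | 'X_[u] \in I] (@ideal_lepm _ _ _).
pose beta := complex_point alpha.
rewrite (qdeg_link_vanishing hI UpB beta d).
suff -> : CM_near_of_dim k (distracting_arrangement I) d alpha <->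
    link_vanishing (@off k n (local_complex I beta)) d by [].
rewrite /CM_near_of_dim /CM_near -/beta (exponent_complex_local UpB) -(local_complex0 UpB).
have Ddown := @local_complex_down k n R I beta.
have [D0|nD0] := pselect (local_complex I beta finset.set0).
  rewrite (@reisner k n _ Ddown D0); first by split=> [[cm /(_ D0)]|[cm kd]].
  (* Faces at any point have at most d vertices, since translates in Lambda_I have dimension at most
     that of the quotient ring. *)
  move=> F [u [F' [FF' uF' _]]].
  by apply: leq_trans (subset_leq_card FF') _; apply: flat_card_le hd uF'.
have nD F : ~ local_complex I beta F.
  by move=> DF; apply: nD0; apply: Ddown DF; apply: finset.sub0set.
by have [cm lv] := void_complex k d nD.
Qed.
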